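(* Let $(X,\nu)$ be a standard probability space and let $\mathcal{G}$ be a locally finite, one-ended, measure class preserving (mcp) measurable graph on $(X,\nu)$. Then $\mathcal{G}$ is $\nu$-hyperfinite if and only if $\mathcal{G}$ admits a measurable one-ended spanning tree $\nu$-a.e., i.e. there is a measurable subgraph $\mathcal{T}\subseteq\mathcal{G}$ which is acyclic, whose connected components are one-ended, and which has the same connected components as $\mathcal{G}$ on a $\nu$-conull set.
   Context: A Borel graph on a standard Borel space $X$ is a symmetric Borel set $\mathcal{G}\subseteq X^2$ (its edge set); it is locally finite if every vertex has finitely many neighbours. A measurable graph is a Borel graph on a standard probability space $(X,\nu)$. $\mathcal{R}_{\mathcal{G}}$ denotes the connectedness relation of $\mathcal{G}$ (a countable Borel equivalence relation when $\mathcal G$ is locally countable). $\mathcal{G}$ is measure class preserving (mcp) if every Borel bijection $\gamma:X\to X$ with $(x,\gamma(x))\in\mathcal{R}_{\mathcal{G}}$ for all $x$ maps $\nu$-null sets to $\nu$-null sets. A connected locally finite graph is $\kappa$-ended if $\kappa$ is the supremum of the number of infinite connected components obtained by removing a finite set of vertices; a measurable graph is one-ended if $\nu$-a.e. vertex lies in a one-ended connected component. $\mathcal{G}$ is ($\nu$-)hyperfinite if it can be written as an increasing union of measurable graphs whose connected components are finite $\nu$-a.e. *)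

(* Defs.v *)
From HB Require Import structures.
From mathcomp Require Import all_boot all_order all_algebra.
From mathcomp Require Import all_classical all_reals all_analysis.
Set Implicit Arguments. Unset Strict Implicit. Unset Printing Implicit Defensive.
Import Order.TTheory GRing.Theory Num.Theory.
Local Open Scope classical_set_scope.
Local Open Scope ring_scope.

Section GraphDefs.
Context {T : Type}.
Implicit Types (G : set (T * T)) (A : set T).

Definition symmetric_graph G : Prop := forall x y, G (x, y) -> G (y, x).

Definition locally_finite G : Prop := forall x, finite_set [set y | G (x, y)].

Definition path_in G A (x y : T) : Prop :=
  exists (n : nat) (p : nat -> T),
    [/\ p 0%N = x, p n = y, (forall i, (i <= n)%N -> A (p i))
      & (forall i, (i < n)%N -> G (p i, p i.+1))].

Definition connR G (x y : T) : Prop := path_in G setT x y.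

Definition comp G (x : T) : set T := [set y | connR G x y].

(** the connected component of x is one-ended: the supremum over finite
    vertex sets F of the number of infinite connected components of
    (component of x) minus F equals 1 *)
Definition one_ended_at G (x : T) : Prop :=
  let C := comp G x in
  (exists F : set T, finite_set F /\
     exists y, (C `\` F) y /\ infinite_set [set z | path_in G (C `\` F) y z]) /\
  (forall F : set T, finite_set F -> forall y z,
     (C `\` F) y -> (C `\` F) z ->
     infinite_set [set w | path_in G (C `\` F) y w] ->
     infinite_set [set w | path_in G (C `\` F) z w] ->
     path_in G (C `\` F) y z).

Definition acyclic G : Prop :=
  (forall x, ~ G (x, x)) /\
  (forall (n : nat) (v : nat -> T), (3 <= n)%N ->
     (forall i j, (i < n)%N -> (j < n)%N -> v i = v j -> i = j) ->
     ~ ((forall i, (i.+1 < n)%N -> G (v i, v i.+1)) /\ G (v n.-1, v 0%N))).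
End GraphDefs.

Section MeasDefs.
Context {d : measure_display} {X : measurableType d} {R : realType}.

Definition standard_borel : Prop :=
  exists f : X -> R, [/\ injective f, measurable_fun setT f
                       & forall A : set X, measurable A -> measurable (f @` A)].

Definition mcp (P : probability X R) (G : set (X * X)) : Prop :=
  forall g : X -> X, measurable_fun setT g -> bijective g ->
    (forall x, connR G x (g x)) ->
    forall N : set X, P.-negligible N -> P.-negligible (g @` N).

Definition one_ended (P : probability X R) (G : set (X * X)) : Prop :=
  {ae P, forall x, one_ended_at G x}.

Definition hyperfinite (P : probability X R) (G : set (X * X)) : Prop :=
  exists Gn : nat -> set (X * X),
    [/\ forall n, measurable (Gn n) /\ symmetric_graph (Gn n),
        forall n, Gn n `<=` Gn n.+1,
        \bigcup_n Gn n = G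
      & forall n, {ae P, forall x, finite_set (comp (Gn n) x)}].

Definition has_one_ended_spanning_tree (P : probability X R) (G : set (X * X)) : Prop :=
  exists Tr : set (X * X),
    [/\ measurable Tr, symmetric_graph Tr, Tr `<=` G, acyclic Tr
      & {ae P, forall x, one_ended_at Tr x /\ comp Tr x = comp G x}].
End MeasDefs.

(* Main.v *)
Require Import Defs.
From mathcomp Require Import all_boot all_order all_algebra.
From mathcomp Require Import all_classical all_reals all_analysis.
From mathcomp Require Import measurable_realfun.
From mathcomp Require Import zify ring lra.
Set Implicit Arguments. Unset Strict Implicit. Unset Printing Implicit Defensive.
Import Order.TTheory GRing.Theory Num.Theory.
Import numFieldNormedType.Exports.
Local Open Scope classical_set_scope.
Local Open Scope ring_scope.

(* If G carries a one-ended spanning tree, every vertex x has a unique tree neighbour s x behind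
   which infinitely many vertices remain when x is deleted. Every tree edge has the form (x, s x),
   s has no periodic points, and the set behind z, made of the x with iter i s x = z for some i,
   is finite. These sets are nested or disjoint, so the pairs lying behind a common z that has at
   most n vertices behind it form equivalence relations with finite classes which increase to the
   connectedness relation.

   Conversely let G be the increasing union of the Gn. The key step produces, for each e > 0, a
   set W of measure < e that meets every component in a connected set and contains the frontier
   of the classes of some Gn, so that the components off W are finite. One-endedness enters
   through bonds: a cut of fewer than k edges with both sides connected has a finite side, so the
   endpoints of the small bonds that the classes of Gn do not resolve (theta) form a small set for
   large n. Frontier points of one class can be joined through theta and few other vertices: the
   remaining cuts have more than k edges, so the local-ratio bound for Steiner forests gives a
   joining set using a fraction O(degree / k) of any given mass, within finite classes of some
   larger GM, and it can be chosen measurably.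

   Such sets combine to a decreasing sequence of connected sets U n with null intersection and
   finite components off each U n. Each component of the n-th layer, the difference of U n and
   U (n + 1), flows to one exit into U (n + 1). By connectedness of U n and the Borel-Cantelli
   lemma, along a sparse subsequence the forward orbits of neighbours almost surely merge, so the
   graph of the flow is a one-ended spanning tree. *)

(** * Measurable predicates *)

Section MeasurablePredicates.
Context {d : measure_display} {T : measurableType d}.
Implicit Types P Q : T -> Prop.

(** As [G] preserves only the measure class, nothing can be averaged over orbits. The joining sets
    must therefore be small for every mass distribution on a finite class, which is what the
    local-ratio bound gives; the distribution finally used is read off from [P]. The hypothesis
    [mcp] enters by making saturations of null sets null, so that almost everywhere statements hold
    on an invariant Borel set. The fraction is [4 * dl / k.+1]: one factor 2 is the approximation
    ratio, the other comes from an edge charging the masses of both its ends, and [dl] bounds the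
    degrees off a small set. Measurability rests on a Lusin-Novikov theorem, obtained from the
    separation of analytic sets in the plane: [G] is covered by the graphs of countably many Borel
    functions, so a quantifier over a component, or over its finite subsets, becomes one over words
    in these functions. This is why bonds are also described by lists of their finite side. *)

Definition mpred P := measurable [set x | P x].

Lemma eq_mpred P Q : (forall x, P x <-> Q x) -> mpred P -> mpred Q.
Proof. by move=> PQ; congr measurable; apply/seteqP; split=> x /PQ. Qed.

Lemma mpred_cst (p : Prop) : mpred (fun=> p).
Proof.
have [h|h] := pselect p.
  rewrite /mpred (_ : [set _ | _] = setT); first exact: measurableT.
  by apply/seteqP; split.
by rewrite /mpred (_ : [set _ | _] = set0); [exact: measurable0|apply/seteqP; split].
Qed.

Lemma mpredN P : mpred P -> mpred (fun x => ~ P x).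
Proof. exact: measurableC. Qed.

Lemma mpredI P Q : mpred P -> mpred Q -> mpred (fun x => P x /\ Q x).
Proof. exact: measurableI. Qed.

Lemma mpredU P Q : mpred P -> mpred Q -> mpred (fun x => P x \/ Q x).
Proof. exact: measurableU. Qed.

Lemma mpred_imp P Q : mpred P -> mpred Q -> mpred (fun x => P x -> Q x).
Proof.
move=> mP mQ; apply: (@eq_mpred (fun x => ~ P x \/ Q x)); last first.
  by apply: mpredU => //; exact: mpredN.
by move=> x; split=> [[]//|h]; have [/h|] := pselect (P x); [right|left].
Qed.

Lemma mpred_ex (I : countType) (P : I -> T -> Prop) :
  (forall i, mpred (P i)) -> mpred (fun x => exists i, P i x).
Proof.
move=> mP; rewrite /mpred (_ : [set _ | _] = \bigcup_i [set x | P i x]).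
  by apply: countable_bigcupT_measurable.
by apply/seteqP; split=> [x [i]|x [i _ ?]]; exists i.
Qed.

Lemma mpred_all (I : countType) (P : I -> T -> Prop) :
  (forall i, mpred (P i)) -> mpred (fun x => forall i, P i x).
Proof.
move=> mP; apply: (@eq_mpred (fun x => ~ exists i, ~ P i x)).
  by move=> x; split=> [/forallNP h i|h [i]]; [exact: contrapT (h i)|].
by apply/mpredN/mpred_ex => i; exact: mpredN.
Qed.

Lemma mpred_iff P Q : mpred P -> mpred Q -> mpred (fun x => P x <-> Q x).
Proof. by move=> mP mQ; apply: mpredI; exact: mpred_imp. Qed.

End MeasurablePredicates.

Lemma mpred_comp {d d' : measure_display} {T : measurableType d} {T' : measurableType d'}
    (P : T' -> Prop) (f : T -> T') :
  measurable_fun setT f -> mpred P -> mpred (fun x => P (f x)).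
Proof. by move=> mf mP; have := mf measurableT _ mP; rewrite setTI. Qed.

(** * Analytic sets and projections with finite sections *)

Section Analytic.
Context {T I : Type} (U : I -> set T).
Implicit Types (A C : set T) (S : seq nat -> set T).

Definition scheme S := forall s, S s = \bigcup_i S (rcons s i).

(** A Souslin operation without a topology. [U] plays the part of a base: along a branch whose
    members are all nonempty, the members shrink into every [U i] around some point of [A].
    Nonemptiness at every depth is all that a branch has to supply, so projections and countable
    intersections merely transform schemes. *)
Definition analytic A := exists S, [/\ S [::] = A, scheme S &
  forall a : nat -> nat, (forall n, S (mkseq a n) !=set0) ->
    exists2 x, A x & forall i, U i x -> exists n, S (mkseq a n) `<=` U i].

Definition hausdorff_family := forall x y, x <> y ->
  exists i j, [/\ U i x, U j y & U i `&` U j = set0].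

Lemma scheme_mono S (a : nat -> nat) (m n : nat) : scheme S -> (m <= n)%N ->
  S (mkseq a n) `<=` S (mkseq a m).
Proof.
move=> hS /subnK <-; elim: (n - m)%N => // k ih x.
rewrite addSn mkseqS => h; apply: ih.
by rewrite hS; exists (a (k + m)%N).
Qed.

Lemma analytic_bigcup (F : nat -> set T) :
  (forall n, analytic (F n)) -> analytic (\bigcup_n F n).
Proof.
move=> /choice[S hS].
exists (fun s => if s is i :: s' then S i s' else \bigcup_n F n); split => //.
- move=> [|i s] /=; last by have [_ -> _] := hS i.
  by apply: eq_bigcupr => n _; have [-> _ _] := hS n.
- move=> a ha.
  have [_ _ /(_ (a \o succn))] := hS (a 0%N).
  have E n : mkseq a n.+1 = a 0%N :: mkseq (a \o succn) n.
    by rewrite /mkseq /= -[1%N]/(1 + 0)%N iotaDl -map_comp.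
  case=> [n|x Fx hx]; first by have := ha n.+1; rewrite E.
  exists x; first by exists (a 0%N).
  by move=> i /hx[n hn]; exists n.+1; rewrite E.
Qed.

Lemma analyticI_closed A C : analytic A ->
  (forall x, ~ C x -> exists2 i, U i x & U i `&` C = set0) ->
  analytic (A `&` C).
Proof.
move=> [S [S0 hS hl]] hC; exists (fun s => S s `&` C); split.
- by rewrite S0.
- by move=> s; rewrite hS setI_bigcupl.
- move=> a ha; have [|x Ax hx] := hl a.
    by move=> n; have [y [? _]] := ha n; exists y.
  exists x; last by move=> i /hx[n hn]; exists n => y [/hn].
  split=> //; apply: contrapT => /hC[i Ux UC].
  have [n hn] := hx _ Ux; have [y [/hn Uy Cy]] := ha n.
  by have : (U i `&` C) y by []; rewrite UC.
Qed.

(* The [n]-th digit encodes a finite tuple, whose [j]-th entry is the next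
   digit of the [j]-th scheme; that scheme starts reading at depth [j]. *)
Definition digit (j c : nat) : nat :=
  nth 0%N (odflt [::] (unpickle c : option (seq nat))) j.
Definition subword (j : nat) (s : seq nat) := map (digit j) (drop j s).
Definition subbranch (j : nat) (a : nat -> nat) := fun m => digit j (a (j + m)%N).

Lemma digit_pickle (l : seq nat) (j : nat) : digit j (pickle l) = nth 0%N l j.
Proof. by rewrite /digit pickleK. Qed.

Lemma subword_rcons (j : nat) (s : seq nat) (c : nat) : (j <= size s)%N ->
  subword j (rcons s c) = rcons (subword j s) (digit j c).
Proof. by move=> h; rewrite /subword drop_rcons // map_rcons. Qed.

Lemma subword_oversize (j : nat) (s : seq nat) : (size s <= j)%N -> subword j s = [::].
Proof. by move=> h; rewrite /subword drop_oversize. Qed.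

Lemma subword_mkseq (j : nat) (a : nat -> nat) (n : nat) :
  subword j (mkseq a n) = mkseq (subbranch j a) (n - j).
Proof.
apply: (@eq_from_nth _ 0%N) => [|i]; first by rewrite size_map size_drop !size_mkseq.
rewrite size_map size_drop size_mkseq => h.
rewrite (nth_map 0%N) ?size_drop ?size_mkseq // nth_drop !nth_mkseq //; lia.
Qed.

(** Along a branch of the combined scheme each [F j] receives its own limit point. Two different
    limits would have disjoint neighbourhoods in [U], both containing the combined members from some
    depth on, while these members are nonempty; so all limits coincide. *)
Lemma analytic_bigcap (F : nat -> set T) : hausdorff_family ->
  (forall n, analytic (F n)) -> analytic (\bigcap_n F n).
Proof.
move=> hU /choice[S hS].
have S0 j : S j [::] = F j by have [] := hS j.
have hsch j : scheme (S j) by have [] := hS j.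
exists (fun s => \bigcap_j S j (subword j s)); split.
- by apply: eq_bigcapr => j _ /=.
- move=> s; apply/seteqP; split=> x.
    move=> hx.
    have /choice[c hc] j : exists c, S j (rcons (subword j s) c) x.
      by have := hx j Logic.I; rewrite hsch => -[c _ ?]; exists c.
    exists (pickle (mkseq c (size s).+1)) => // j _.
    have [h|h] := leqP j (size s).
      by rewrite subword_rcons // digit_pickle nth_mkseq.
    by rewrite subword_oversize ?size_rcons // -(subword_oversize (ltnW h)); exact: hx.
  move=> [c _ hx] j _; have := hx j Logic.I.
  have [h|h] := leqP j (size s).
    by rewrite subword_rcons // => ?; rewrite hsch; exists (digit j c).
  by rewrite (subword_oversize (ltnW h)) subword_oversize ?size_rcons.
- move=> a ha.
  have hlim j : exists2 x, F j x & forall i, U i x -> exists n,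
      S j (subword j (mkseq a (n + j))) `<=` U i.
    have [_ _ /(_ (subbranch j a))] := hS j; case=> [n|x Fx hx].
      have [y hy] := ha (n + j)%N; exists y.
      by have := hy j Logic.I; rewrite subword_mkseq addnK.
    by exists x => // i /hx[n hn]; exists n; rewrite subword_mkseq addnK.
  have [x F0x hx] := hlim 0%N.
  exists x; last first.
    move=> i /hx[n hn]; exists (n + 0)%N => y hy.
    by apply: hn; exact: (hy 0%N).
  move=> j _; have [y Fy hy] := hlim j.
  have [->//|] := pselect (x = y).
  move=> /hU[i [i' [Ux Uy UU]]]; exfalso.
  have [n hn] := hx _ Ux; have [m hm] := hy _ Uy.
  have [z hz] := ha (maxn n (m + j)).
  suff : (U i `&` U i') z by rewrite UU.
  split.
    apply: hn; have := hz 0%N Logic.I; rewrite !subword_mkseq.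
    apply: scheme_mono => //; lia.
  apply: hm; have := hz j Logic.I; rewrite !subword_mkseq.
  apply: scheme_mono => //; lia.
Qed.

Lemma analyticU A C : analytic A -> analytic C -> analytic (A `|` C).
Proof.
move=> hA hC; have -> : A `|` C = \bigcup_(n in [set: nat]) (if n is 0%N then A else C).
  apply/seteqP; split=> x; first by case=> h; [exists 0%N|exists 1%N].
  by case=> -[|n] _ h; [left|right].
by apply: analytic_bigcup => -[].
Qed.

Lemma analyticI A C : hausdorff_family -> analytic A -> analytic C -> analytic (A `&` C).
Proof.
move=> hU hA hC; have -> : A `&` C = \bigcap_(n in [set: nat]) (if n is 0%N then A else C).
  apply/seteqP; split=> x; first by case=> h1 h2 [|n].
  by move=> h; split; [exact: (h 0%N)|exact: (h 1%N)].
by apply: analytic_bigcap => // -[].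
Qed.

Lemma analytic0 : analytic set0.
Proof.
exists (fun=> set0); split=> //; first by move=> s; rewrite bigcup0.
by move=> a /(_ 0%N)[].
Qed.

Lemma analytic_sigma (G : set (set T)) : hausdorff_family -> analytic setT ->
  (forall A, G A -> analytic A /\ analytic (~` A)) ->
  forall A, <<s G >> A -> analytic A /\ analytic (~` A).
Proof.
move=> hU hT hG; apply: smallest_sub => //; split.
- by split; [exact: analytic0|rewrite setC0].
- by move=> A [h1 h2]; rewrite setTD setCK.
- move=> F hF; split.
    by apply: analytic_bigcup => n; case: (hF n).
  by rewrite setC_bigcup; apply: analytic_bigcap => // n; case: (hF n).
Qed.

End Analytic.

(** * Separation of analytic sets by Borel sets *)

Section Novikov.
Context {d : measure_display} {T : measurableType d} {I : Type} (U : I -> set T).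
Hypothesis hU : hausdorff_family U.
Hypothesis mU : forall i, measurable (U i).

Definition separable (C : nat -> set T) := exists B : nat -> set T,
  [/\ forall n, measurable (B n), forall n, C n `<=` B n & \bigcap_n B n = set0].

(** Separating sets for the pieces are glued by a union at the place [j] and by intersections at all
    other places. *)
Lemma separable_bigcup (C : nat -> set T) (j : nat) (D : nat -> set T) :
  C j = \bigcup_i D i ->
  (forall i, separable (fun n => if n == j then D i else C n)) -> separable C.
Proof.
move=> Cj /choice[B hB].
exists (fun n => if n == j then \bigcup_i B i n else \bigcap_i B i n); split.
- move=> n; case: ifP => _; [apply: bigcupT_measurable|apply: bigcapT_measurable].
    by move=> i; have [] := hB i.
  by move=> i; have [] := hB i.
- move=> n; case: eqP => [->|/eqP/negbTE nj].
    rewrite Cj => x [i _ Dx]; exists i => //.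
    by have [_ /(_ j) + _] := hB i; rewrite eqxx; apply.
  move=> x Cx i _; have [_ /(_ n) + _] := hB i; rewrite nj; exact.
- rewrite -subset0 => x hx; have := hx j Logic.I; rewrite eqxx => -[i _ Bx].
  have [_ _ <-] := hB i => n _; have := hx n Logic.I.
  by case: eqP => [->//|_ ]; exact.
Qed.

Lemma separable_refine (C : nat -> set T) (D : nat -> nat -> set T) (k : nat) :
  (forall j, C j = \bigcup_i D j i) -> ~ separable C ->
  exists c : seq nat, ~ separable (fun n => if (n < k)%N then D n (nth 0%N c n) else C n).
Proof.
move=> hD nC; elim: k => [|k [c hc]].
  by exists [::]; apply: contra_not nC => h.
apply: contrapT => /forallNP h; apply: hc.
apply: (@separable_bigcup _ k (D k)); first by rewrite ltnn hD.
move=> i; have /contrapT := h (set_nth 0%N c k i).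
congr separable; apply/funext => n; rewrite ltnS leq_eqVlt nth_set_nth /=.
by case: eqP => [->//|].
Qed.

(** For an inseparable family one can choose digits successively so that the corresponding scheme
    members stay inseparable, because separations of all children glue to one of the parent. The
    members along this branch are nonempty and converge to a point of each [F j]. As the
    intersection is empty, two of these limits differ, and disjoint neighbourhoods of them separate
    the family at a deep level. *)
Lemma novikov (F : nat -> set T) : (forall n, analytic U (F n)) ->
  \bigcap_n F n = set0 -> separable F.
Proof.
move=> /choice[S hS] F0; apply: contrapT => nF.
have S0 j : S j [::] = F j by have [] := hS j.
have hsch j : scheme (S j) by have [] := hS j.
pose C s := fun j => S j (subword j s).
have step s : ~ separable (C s) -> exists c, ~ separable (C (rcons s c)).
  (* Only the sets of index at most [size s] read a digit at this depth, so finitely many choices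
     are coded in one number. *)
  move=> /(@separable_refine _ (fun j i => S j (rcons (subword j s) i)) (size s).+1).
  case=> [j|c H]; first exact: hsch.
  exists (pickle c); move: H; congr (~ separable _); apply/funext => n.
  rewrite /C ltnS; case: leqP => h; first by rewrite subword_rcons // digit_pickle.
  by rewrite (subword_oversize (ltnW h)) subword_oversize ?size_rcons.
have /choice[g hg] : forall s, exists c, ~ separable (C s) -> ~ separable (C (rcons s c)).
  move=> s; have [h|h] := pselect (separable (C s)); first by exists 0%N.
  by have [c hc] := step s h; exists c.
pose st n := iter n (fun s => rcons s (g s)) [::].
pose a n := g (st n).
have Est n : mkseq a n = st n.
  elim: n => //= n ih; by rewrite mkseqS ih.
have nsep n : ~ separable (C (mkseq a n)).
  rewrite Est; elim: n => [|n ih] /=; last exact: hg.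
  by move: nF; congr (~ separable _); apply/funext => j; rewrite /C -S0.
have ne n j : C (mkseq a n) j !=set0.
  apply/set0P/eqP => h0; apply: (nsep n).
  exists (fun i => if i == j then set0 else setT); split.
  - by move=> i; case: ifP => _; [exact: measurable0|exact: measurableT].
  - by move=> i; case: eqP => [->|//]; rewrite h0.
  - by rewrite -subset0 => x /(_ j Logic.I); rewrite eqxx.
have hlim j : exists2 x, F j x & forall i, U i x -> exists n, C (mkseq a (n + j)) j `<=` U i.
  have [_ _ /(_ (subbranch j a))] := hS j; case=> [n|x Fx hx].
    by have := ne (n + j)%N j; rewrite /C subword_mkseq addnK.
  by exists x => // i /hx[n hn]; exists n; rewrite /C subword_mkseq addnK.
have [x F0x hx] := hlim 0%N.
have [j Fjx] : exists j, ~ F j x.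
  apply: contrapT => /forallNP h.
  by rewrite -[False]/(set0 x) -F0 => j _; apply: contrapT; exact: h.
have [y Fy hy] := hlim j.
have [|i [i' [Ux Uy UU]]] := hU (x := x) (y := y); first by move=> E; apply: Fjx; rewrite E.
have [n hn] := hx _ Ux; have [m hm] := hy _ Uy.
pose N := maxn (n + 0) (m + j).
apply: (nsep N).
have mono k p : (p <= N)%N -> C (mkseq a N) k `<=` C (mkseq a p) k.
  by move=> h; rewrite /C !subword_mkseq; apply: scheme_mono => //; lia.
have [j0|j0] := eqVneq j 0%N; first by case: Fjx; rewrite j0.
exists (fun k => if k == 0%N then U i else if k == j then U i' else setT); split.
- by move=> k; case: ifP => _; [|case: ifP => _].
- move=> k; case: eqP => [->|_].
    by apply: subset_trans hn; apply: mono; rewrite /N leq_maxl.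
  case: eqP => [->|//].
  by apply: subset_trans hm; apply: mono; rewrite /N leq_maxr.
- rewrite -subset0 => z hz; rewrite -UU; split; first exact: (hz 0%N Logic.I).
  by have := hz j Logic.I; rewrite (negbTE j0) eqxx.
Qed.

Lemma lusin_separation (A B : set T) : analytic U setT -> analytic U A -> analytic U B ->
  A `&` B = set0 -> exists C, [/\ measurable C, A `<=` C & C `&` B = set0].
Proof.
move=> hT hA hB AB.
have [] := @novikov (fun n => if n == 0%N then A else if n == 1%N then B else setT).
- by move=> [|[|n]].
- rewrite -subset0 => x hx; rewrite -AB; split; [exact: (hx 0%N)|exact: (hx 1%N)].
move=> D [mD hD D0]; exists (D 0%N); split=> //; first exact: (hD 0%N).
rewrite -subset0 => x [D0x Bx]; rewrite -D0 => -[|[|n]] _ //; first exact: (hD 1%N).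
exact: (hD n.+2).
Qed.

End Novikov.

Section AnalyticProd.
Context {T1 T2 I1 I2 : Type} (U1 : I1 -> set T1) (U2 : I2 -> set T2).

Definition prod_family (p : I1 * I2) : set (T1 * T2) := U1 p.1 `*` U2 p.2.

Lemma hausdorff_prod : hausdorff_family U1 -> hausdorff_family U2 ->
  (forall x, exists i, U1 i x) -> (forall x, exists i, U2 i x) ->
  hausdorff_family prod_family.
Proof.
move=> h1 h2 c1 c2 [x x'] [y y'] xy.
have [E|/h1[i [j [Ux Uy UU]]]] := pselect (x = y).
  have [E'|/h2[i [j [Ux Uy UU]]]] := pselect (x' = y').
    by case: xy; rewrite E E'.
  have [k kx] := c1 x; exists (k, i), (k, j); split => //.
    by split=> //=; rewrite -E.
  rewrite -subset0 => -[a b] [[_ /= ?] [_ /= ?]].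
  by have : (U2 i `&` U2 j) b by []; rewrite UU.
have [k kx] := c2 x'; have [l lx] := c2 y'; exists (i, k), (j, l); split => //.
rewrite -subset0 => -[a b] [[/= ? _] [/= ? _]].
by have : (U1 i `&` U1 j) a by []; rewrite UU.
Qed.

Lemma analyticX (A : set T1) (B : set T2) :
  analytic U1 A -> analytic U2 B -> analytic prod_family (A `*` B).
Proof.
move=> [S [S0 hS hl]] [S' [S'0 hS' hl']].
exists (fun s => S (map (digit 0) s) `*` S' (map (digit 1) s)); split.
- by rewrite /= S0 S'0.
- move=> s; apply/seteqP; split=> -[x y].
    move=> [/=]; rewrite {1}hS {1}hS' => -[a _ ha] [b _ hb].
    by exists (pickle [:: a; b]) => //; rewrite !map_rcons !digit_pickle.
  move=> [c _ [/= ha hb]]; split=> /=.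
    by rewrite hS; exists (digit 0 c) => //; rewrite -map_rcons.
  by rewrite hS'; exists (digit 1 c) => //; rewrite -map_rcons.
- move=> a ha.
  have E j n : map (digit j) (mkseq a n) = mkseq (digit j \o a) n.
    by rewrite /mkseq -map_comp.
  have [|x Ax hx] := hl (digit 0 \o a).
    by move=> n; have [[x y] [/= + _]] := ha n; rewrite E; exists x.
  have [|y By hy] := hl' (digit 1 \o a).
    by move=> n; have [[u y] [/= _ +]] := ha n; rewrite E; exists y.
  exists (x, y) => // -[i j] [/= /hx[n hn] /hy[m hm]].
  exists (maxn n m) => -[u v] [/=]; rewrite !E => h1 h2; split=> /=.
    by apply: hn; apply: scheme_mono h1 => //; rewrite leq_maxl.
  by apply: hm; apply: scheme_mono h2 => //; rewrite leq_maxr.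
Qed.

Lemma analytic_fst (A : set (T1 * T2)) : (forall x, exists i, U2 i x) ->
  analytic prod_family A -> analytic U1 (fst @` A).
Proof.
move=> c2 [S [S0 hS hl]]; exists (fun s => fst @` S s); split.
- by rewrite S0.
- by move=> s; rewrite hS image_bigcup.
- move=> a ha; have [|[x y] Axy hxy] := hl a.
    by move=> n; have [_ [z Sz _]] := ha n; exists z.
  exists x; first by exists (x, y).
  move=> i Ux; have [j Uy] := c2 y.
  by have [//|n hn] := hxy (i, j); exists n => _ [z /hn[/= ? _] <-].
Qed.
End AnalyticProd.

(** * Analytic subsets of the line and the plane *)

Section AnalyticReal.
Context {R : realType}.

Definition rat_itv (p : rat * rat) : set R := [set x | ratr p.1 < x < ratr p.2].

Lemma rat_itv_near (x e : R) : 0 < e ->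
  exists2 p, rat_itv p x & forall y, rat_itv p y -> `|y - x| < e.
Proof.
move=> e0; have [p] := @rat_in_itvoo R (x - e) x ltac:(lra).
have [q] := @rat_in_itvoo R x (x + e) ltac:(lra).
rewrite !in_itv /= => /andP[h1 h2] /andP[h3 h4].
exists (p, q); first by rewrite /rat_itv /= h4 h1.
by move=> y /andP[/= h5 h6]; rewrite ltr_norml; lra.
Qed.

Lemma rat_itv_cover (x : R) : exists p, rat_itv p x.
Proof. by have [p] := rat_itv_near x ltr01; exists p. Qed.

Lemma hausdorff_rat_itv : hausdorff_family rat_itv.
Proof.
move=> x y /eqP xy; have e0 : 0 < `|x - y| / 2 by rewrite divr_gt0 // normr_gt0 subr_eq0.
have [p px hp] := rat_itv_near x e0; have [q qx hq] := rat_itv_near y e0.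
exists p, q; split=> //; rewrite -subset0 => z [/hp h1 /hq h2].
have := ler_distD z x y; rewrite distrC in h1; lra.
Qed.

Lemma measurable_rat_itv p : measurable (rat_itv p).
Proof.
rewrite (_ : rat_itv p = `]ratr p.1, ratr p.2[%classic) //.
Qed.

(** The [i]-th digit codes a rational [q] and confines the point to the interval from [q] to
    [q + 1 / (i + 1)]. The intervals along a branch with nonempty members meet pairwise, so the
    supremum of their left ends lies in all of them. *)
Lemma analytic_realT : analytic rat_itv setT.
Proof.
pose r c : R := ratr (odflt 0 (unpickle c : option rat)).
pose J i c := [set x : R | r c <= x <= r c + i.+1%:R^-1].
exists (fun s => \bigcap_(i in [set i | (i < size s)%N]) J i (nth 0%N s i)); split.
- by apply/seteqP; split=> // x _ i.
- move=> s; apply/seteqP; split=> x.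
    move=> hx.
    have [q] := @rat_in_itvoo R (x - (size s).+1%:R^-1) x ltac:(by rewrite gtrBl invr_gt0 ltr0n).
    rewrite in_itv /= => /andP[q1 q2].
    exists (pickle q) => // i; rewrite /= size_rcons ltnS leq_eqVlt.
    case/orP=> [/eqP ->|h]; rewrite nth_rcons.
      rewrite ltnn eqxx /J /r /= pickleK /=; apply/andP; split; first exact: ltW.
      by rewrite -lerBlDr ltW.
    by rewrite h; exact: hx.
  move=> [c _ hx] i /= h; have := hx i; rewrite /= size_rcons nth_rcons h; apply.
  by rewrite ltnW.
- move=> a ha.
  have mem n x i : (\bigcap_(i in [set i | (i < size (mkseq a n))%N]) J i (nth 0%N (mkseq a n) i)) x ->
      (i < n)%N -> J i (a i) x.
    by move=> hx h; have := hx i; rewrite /= size_mkseq nth_mkseq //; exact.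
  have lu i j : r (a i) <= r (a j) + j.+1%:R^-1.
    have [x hx] := ha (maxn i j).+1.
    have /andP[h1 _] := mem _ _ i hx ltac:(by rewrite ltnS leq_maxl).
    have /andP[_ h2] := mem _ _ j hx ltac:(by rewrite ltnS leq_maxr).
    exact: le_trans h1 h2.
  pose x := sup (range (r \o a)).
  have xl i : r (a i) <= x.
    apply: ub_le_sup; last by exists i.
    by exists (r (a 0%N) + 1%:R^-1) => _ [j _ <-]; exact: lu.
  have xu i : x <= r (a i) + i.+1%:R^-1.
    by apply: ge_sup; [exists (r (a 0%N)); exists 0%N|move=> _ [j _ <-]; exact: lu].
  exists x => // -[p q] /andP[/= px xq].
  have [n hn] : exists n : nat, 0 + n.+1%:R^-1 < Num.min (x - ratr p) (ratr q - x).
    by apply: ltr_add_invr; rewrite lt_min !subr_gt0 px.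
  exists n.+1 => y /(mem n.+1 y n)/(_ (ltnSn n)) /andP[h1 h2].
  have := xl n; have := xu n; move: hn; rewrite add0r lt_min => /andP[].
  move: h1 h2; set z := _^-1 => h1 h2 zx zq xu' xl'.
  rewrite /rat_itv /=; move: (r (a n)) (x) (ratr p) (ratr q) h1 h2 zx zq xu' xl' => *.
  by apply/andP; split; lra.
Qed.

Lemma real_analytic (A : set R) : measurable A ->
  analytic rat_itv A /\ analytic rat_itv (~` A).
Proof.
move=> mA; apply: (@analytic_sigma _ _ _ (@measurable_realfun.RGenOInfty.G R)).
- exact: hausdorff_rat_itv.
- exact: analytic_realT.
- move=> _ [x ->]; split.
    have -> : `]x, +oo[%classic = \bigcup_n `[x + n.+1%:R^-1, +oo[%classic.
      apply/seteqP; split=> y.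
        rewrite /= in_itv /= andbT => /ltr_add_invr[n hn]; exists n => //.
        by rewrite /= in_itv /= andbT ltW.
      move=> [n _]; rewrite /= !in_itv /= !andbT; apply: lt_le_trans.
      by rewrite ltrDl invr_gt0 ltr0n.
    apply: analytic_bigcup => n; rewrite -[X in analytic _ X]setTI.
    apply: analyticI_closed; first exact: analytic_realT.
    move=> y; rewrite /= in_itv /= andbT => /negP; rewrite -ltNge => yx.
    have [|p py hp] := @rat_itv_near y (x + n.+1%:R^-1 - y); first by rewrite subr_gt0.
    exists p => //; rewrite -subset0 => z [/hp h1]; rewrite /= in_itv /= andbT => h2.
  move: h1; rewrite ltr_norml => /andP[h1 h3]; move: (_^-1) h1 h2 h3 yx => *; lra.
  rewrite -[X in analytic _ X]setTI.
  apply: analyticI_closed; first exact: analytic_realT.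
  move=> y /contrapT; rewrite /= in_itv /= andbT => xy.
  have [|p py hp] := @rat_itv_near y (y - x); first by rewrite subr_gt0.
  exists p => //; rewrite -subset0 => z [/hp h1]; rewrite /= in_itv /= andbT => h2.
  move: h1; rewrite ltr_norml => /andP[h1 h3]; lra.
- have := mA; change (measurable A) with ((@ocitv R).-sigma.-measurable A).
  by rewrite measurable_realfun.RGenOInfty.measurableE.
Qed.

Let U2 := prod_family (@rat_itv) (@rat_itv).

Lemma hausdorff_rat_itv2 : hausdorff_family U2.
Proof.
apply: hausdorff_prod; by [exact: hausdorff_rat_itv|exact: rat_itv_cover].
Qed.

Lemma analytic_realT2 : analytic U2 setT.
Proof. by rewrite -setXTT; apply: analyticX; exact: analytic_realT. Qed.

Lemma real2_analytic (A : set (R * R)) : measurable A ->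
  analytic U2 A /\ analytic U2 (~` A).
Proof.
rewrite measurable_prod_measurableType; apply: analytic_sigma.
- exact: hausdorff_rat_itv2.
- exact: analytic_realT2.
move=> _ [B mB] [C mC] <-; have [aB aB'] := real_analytic mB.
have [aC aC'] := real_analytic mC; split; first exact: analyticX.
have -> : ~` (B `*` C) = (~` B `*` setT) `|` (setT `*` ~` C).
  apply/seteqP; split=> -[x y] /=.
    by move=> /not_andP[]; [left|right].
  by case=> -[/= h1 h2] [].
by apply: analyticU; apply: analyticX => //; exact: analytic_realT.
Qed.

(** A projection is a priori only analytic, so the complement is described instead. Finite sections
    are closed, hence the complement of [A] is the union of the boxes formed by the complement of
    [D n] and [U n]. Novikov separation of the complement of [A] and the complements [Z n] of these
    boxes yields Borel sets [B n] disjoint from [D n] such that each point outside [A] lies in the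
    product of some [B n] and [U n]. By compactness, [x] misses the projection iff every interval
    from [- m] to [m] is covered by finitely many [U n] with [B n x], which is a countable
    condition. *)
Lemma measurable_fst_finite_section (A : set (R * R)) : measurable A ->
  (forall x, finite_set [set y | A (x, y)]) -> measurable (fst @` A).
Proof.
move=> mA fA; have [aA aA'] := real2_analytic mA.
pose U n := rat_itv (odflt (0, 0) (unpickle n : option (rat * rat))) : set R.
have mU n : measurable (U n) by exact: measurable_rat_itv.
have Up p : U (pickle p) = rat_itv p by rewrite /U pickleK.
pose D n := fst @` (A `&` (setT `*` U n)).
have aD n : analytic rat_itv (D n).
  apply: analytic_fst; first exact: rat_itv_cover.
  apply: analyticI => //; first exact: hausdorff_rat_itv2.
  by apply: analyticX; [exact: analytic_realT|case: (real_analytic (mU n))].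
pose Z n := (D n `*` setT) `|` (setT `*` ~` U n).
have aZ n : analytic U2 (Z n).
  apply: analyticU; apply: analyticX => //; try exact: analytic_realT.
  by case: (real_analytic (mU n)).
have sep x y : ~ A (x, y) -> exists2 n, U n y & forall z, U n z -> ~ A (x, z).
  move=> nA; have : \forall z \near y, ~ [set y | A (x, y)] z.
    have /closed_openC := accessible_finite_set_closed.1 (hausdorff_accessible (@norm_hausdorff _ R)) _ (fA x).
    by rewrite openE => /(_ y nA).
  move=> /nbhs_ballP[e /= e0 he]; have [p py hp] := rat_itv_near y e0.
  exists (pickle p); rewrite Up // => z /hp h; apply: he.
  by rewrite /ball /= distrC.
have := @novikov _ _ _ U2 hausdorff_rat_itv2 _ (fun n => if n is m.+1 then Z m else ~` A).
case.
- by move=> [p q]; apply: measurableX; exact: measurable_rat_itv.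
- by case.
- rewrite -subset0 => -[x y] h; have := h 0%N Logic.I => /= /sep[n Uy hn].
  case: (h n.+1 Logic.I) => [[[[u z] [/= Axz [_ /= Uz]]] /= E _]|[_ /=]//].
  by apply: (hn z) => //; rewrite -E.
move=> W [mW hW W0].
have /choice[B hB] n : exists B, [/\ measurable B, fst @` (~` W n.+1) `<=` B & B `&` D n = set0].
  apply: (@lusin_separation _ _ _ _ hausdorff_rat_itv).
  - exact: measurable_rat_itv.
  - exact: analytic_realT.
  - apply: analytic_fst; first exact: rat_itv_cover.
    by case: (real2_analytic (mW n.+1)).
  - exact: aD.
  - rewrite -subset0 => _ [[[x y] /= nW <-] Dx]; apply: nW.
    by apply: (hW n.+1); left.
pose Q (m : nat) x := exists s : seq nat,
    (forall y, `|y| <= m%:R -> exists2 n, n \in s & U n y) /\ (forall n, n \in s -> B n x).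
have E x : (~ (fst @` A) x) <-> forall m : nat, Q m x.
  split=> [nA m|h [[u y] /= Ay ux]]; last first.
    have [s [hs hsB]] := h (Num.truncn `|y|).+1.
    have [n ns Uy] := hs y (ltW (truncnS_gt _)).
    have [_ _ BD] := hB n; rewrite -[False]/(set0 x) -BD; split; first exact: hsB.
    by exists (u, y).
  have cpt : compact `[- m%:R : R, m%:R]%classic by exact: segment_compact.
  rewrite compact_cover in cpt.
  have [|y _|s sB hs] := cpt _ [set n | B n x] U.
  - move=> n _; rewrite /U /rat_itv.
    set p := odflt _ _; rewrite (_ : [set _ | _] = `]ratr p.1, ratr p.2[%classic).
      exact: interval_open.
    by apply/seteqP; split=> y; rewrite /= in_itv.
  - have nAxy : ~ A (x, y) by move=> Axy; apply: nA; exists (x, y).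
    have [n nW] : exists n, ~ W n (x, y).
      apply: contrapT => /forallNP h; rewrite -[False]/(set0 (x, y)) -W0 => n _.
      exact: contrapT (h n).
    case: n nW => [nW|n nW]; first by case: nW; exact: (hW 0%N).
    exists n.
      by have [_ + _] := hB n; apply; exists (x, y).
    by apply: contrapT => nU; apply: nW; apply: (hW n.+1); right.
  - exists (finmap.enum_fset s); split.
      move=> y ym; have [|n /= ns Uy] := hs y; first by rewrite /= in_itv /= -ler_norml.
      by exists n.
    by move=> n ns; have := sB n ns; rewrite inE.
have -> : fst @` A = ~` [set x | forall m, Q m x].
  by apply/seteqP; split=> x /=; [move=> h /E|move=> h; apply: contrapT => /E].
apply: measurableC.
apply: (@mpred_all _ _ _ Q) => m; apply: mpred_ex => s.
apply: mpredI; first exact: mpred_cst.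
apply: mpred_all => n; apply: mpred_imp; first exact: mpred_cst.
by have [] := hB n.
Qed.
End AnalyticReal.

(** * Neighbour functions of a locally finite Borel graph *)

Section StandardBorel.
Context {d : measure_display} {X : measurableType d} {R : realType}.
Variable f : X -> R.
Hypothesis finj : injective f.
Hypothesis mf : measurable_fun setT f.
Hypothesis fimg : forall A : set X, measurable A -> measurable (f @` A).

Let f2 (p : X * X) : R * R := (f p.1, f p.2).

Lemma measurable_f_preimage (A : set R) : measurable A -> measurable (f @^-1` A).
Proof. by move=> mA; have := mf measurableT mA; rewrite setTI. Qed.

Lemma f_preimage_image (A : set X) : f @^-1` (f @` A) = A.
Proof. by apply/seteqP; split=> x /=; [case=> y Ay /finj <-|exists x]. Qed.

Lemma measurable_fun_of_f (g : X -> X) :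
  (forall A : set R, measurable A -> measurable (g @^-1` (f @^-1` A))) ->
  measurable_fun setT g.
Proof.
move=> h _ A mA; rewrite setTI -(f_preimage_image A).
by apply: h; exact: fimg.
Qed.

Lemma mpred_eq_fun (d' : measure_display) (Y : measurableType d') (g h : Y -> X) :
  measurable_fun setT g -> measurable_fun setT h -> mpred (fun x => g x = h x).
Proof.
move=> mg mh; apply: (@eq_mpred _ _ (fun x => forall q : rat, f (g x) < ratr q <-> f (h x) < ratr q)).
  move=> x; split=> [hq|->//]; apply: finj; apply/eqP.
  have [xy|xy|//] := ltgtP (f (g x)) (f (h x)).
    by have [q] := rat_in_itvoo xy; rewrite in_itv /= => /andP[/hq h1 /(lt_trans h1)]; rewrite ltxx.
  by have [q] := rat_in_itvoo xy; rewrite in_itv /= => /andP[/hq h1 /(lt_trans h1)]; rewrite ltxx.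
have aux (k : Y -> X) q : measurable_fun setT k -> mpred (fun x => f (k x) < ratr q).
  move=> mk; apply: (@mpred_comp _ _ _ _ (fun y => f y < ratr q) k) => //.
  have := @measurable_f_preimage `]-oo, ratr q[%classic (measurable_itv _).
  by congr measurable; apply/seteqP; split=> x; rewrite /= in_itv.
by apply: mpred_all => q; apply: mpred_iff; exact: aux.
Qed.

Let f2inj : injective f2.
Proof. by move=> [a b] [a' b'] [/finj -> /finj ->]. Qed.

Lemma measurable_f2_image (A : set (X * X)) : measurable A -> measurable (f2 @` A).
Proof.
have ET : f2 @` setT = range f `*` range f.
  apply/seteqP; split=> -[a b].
    by move=> [[x y] _ [<- <-]]; split; [exists x|exists y].
  by move=> [[x _ /= <-] [y _ /= <-]]; exists (x, y).
have mT : measurable (f2 @` setT).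
  by rewrite ET; apply: measurableX; apply: fimg.
rewrite measurable_prod_measurableType => hA.
suff : <<s [set A `*` B | A in @measurable _ X & B in @measurable _ X] >> `<=`
    [set A | measurable (f2 @` A)] by apply.
apply: smallest_sub; first split.
- by rewrite /= image_set0; exact: measurable0.
- move=> B /= mB; rewrite setTD.
  rewrite (_ : f2 @` _ = f2 @` setT `\` f2 @` B); first exact: measurableD.
  apply/seteqP; split.
    move=> _ [p hp <-]; split; first by exists p.
    by case=> q Bq /f2inj E; apply: hp; rewrite -E.
  by move=> _ [[p _ <-] h]; exists p => // Bp; apply: h; exists p.
- by move=> F mF /=; rewrite image_bigcup; exact: bigcupT_measurable.
- move=> _ [B mB] [C mC] <- /=.
  rewrite (_ : f2 @` _ = (f @` B) `*` (f @` C)); first by apply: measurableX; exact: fimg.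
  apply/seteqP; split=> -[a b].
    by move=> [[x y] [/= hx hy] [<- <-]]; split; [exists x|exists y].
  by move=> [[x ? /= <-] [y ? /= <-]]; exists (x, y).
Qed.

Lemma mpred_finite_section (A : set (X * X)) : measurable A ->
  (forall x, finite_set [set y | A (x, y)]) -> mpred (fun x => exists y, A (x, y)).
Proof.
move=> mA fA.
have fin x : finite_set [set y | (f2 @` A) (x, y)].
  have [[y xy]|nx] := pselect (exists y, f y = x).
    apply: (@sub_finite_set _ _ (f @` [set z | A (y, z)])).
      by move=> z [[u v] Auv /= [E <-]]; exists v => //=; rewrite -(finj (etrans E (esym xy))).
    exact: finite_image.
  rewrite (_ : [set _ | _] = set0) //; rewrite -subset0 => z [[u v] _ [E _]].
  by apply: nx; exists u.
have := measurable_fst_finite_section (measurable_f2_image mA) fin.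
move=> /measurable_f_preimage; congr measurable; apply/seteqP; split=> x /=.
  by move=> [_ [[u v] Auv <-] /= /finj <-]; exists v.
by move=> [y Axy]; exists (f x, f y) => //; exists (x, y).
Qed.

(** [g n x] is the neighbour of [x] whose image under [f] lies in the [n]-th rational interval if
    there is exactly one, and [x] itself otherwise. Local finiteness lets some interval isolate any
    given neighbour. For measurability only Borel sets with finite sections have to be projected. *)
Lemma neighbor_functions (G : set (X * X)) : measurable G -> locally_finite G ->
  exists g : nat -> X -> X, [/\ forall n, measurable_fun setT (g n),
    forall n x, g n x = x \/ G (x, g n x) & forall x y, G (x, y) -> exists n, y = g n x].
Proof.
move=> mG lfG.
pose U n := rat_itv (odflt (0, 0) (unpickle n : option (rat * rat))) : set R.
have mU n : measurable (U n) by exact: measurable_rat_itv.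
have Up p : U (pickle p) = rat_itv p by rewrite /U pickleK.
pose N (V : set X) x := exists y, G (x, y) /\ V y.
have mN V : measurable V -> mpred (N V).
  move=> mV; have := @mpred_finite_section (G `&` (setT `*` V)).
  move=> /(_ (measurableI _ _ mG (measurableX measurableT mV))) h.
  apply: eq_mpred (h _); last by move=> x; apply: sub_finite_set (lfG x) => y [].
  by move=> x; split=> -[y]; [case=> ? [_ ?]|case=> ? ?]; exists y.
pose uniq n x y := [/\ G (x, y), U n (f y) & forall z, G (x, z) -> U n (f z) -> z = y].
have /choice[h hh] : forall nx : nat * X, exists y,
    ((exists y, uniq nx.1 nx.2 y) -> uniq nx.1 nx.2 y) /\
    (~ (exists y, uniq nx.1 nx.2 y) -> y = nx.2).
  move=> [n x]; have [[y hy]|hn] := pselect (exists y, uniq n x y).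
    by exists y; split=> // -[]; exists y.
  by exists x; split.
have hu n x y : uniq n x y -> h (n, x) = y.
  move=> hy; have [h1 _] := hh (n, x); have [_ _ hz] := hy.
  by have [G1 U1 _] := h1 (ex_intro _ y hy); apply: hz.
exists (fun n x => h (n, x)); split.
- move=> n; apply: measurable_fun_of_f => A mA.
  pose D x := exists y, uniq n x y.
  have mfU V : measurable V -> measurable (f @^-1` V) by exact: measurable_f_preimage.
  (* Uniqueness by countable quantifiers: no two disjoint rational intervals both contain images of
     neighbours from [U n]. *)
  have mD : mpred D.
    apply: (@eq_mpred _ _ (fun x => N (f @^-1` U n) x /\ forall p q : nat,
       ~ (U p `&` U q = set0 /\ N (f @^-1` (U n `&` U p)) x /\ N (f @^-1` (U n `&` U q)) x))).
      move=> x; split.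
        move=> [[y [Gxy Uy]] hpq]; exists y; split=> // z Gxz Uz.
        apply: contrapT => zy.
        have [|p [q [pz qy pq]]] := @hausdorff_rat_itv R (f z) (f y).
          by move=> /finj.
        apply: (hpq (pickle p) (pickle q)); rewrite !Up; split=> //.
        by split; [exists z|exists y].
      move=> [y [Gxy Uy hy]]; split; first by exists y.
      move=> p q [pq [[z [Gxz [Uz pz]]] [z' [Gxz' [Uz' qz']]]]].
      rewrite (hy z) // in pz; rewrite (hy z') // in qz'.
      by rewrite -[False]/(set0 (f y)) -pq.
    apply: mpredI; first exact/mN/mfU.
    apply: mpred_all => p; apply: mpred_all => q; apply/mpredN/mpredI; first exact: mpred_cst.
    by apply: mpredI; apply/mN/mfU/measurableI.
  have : mpred (fun x => (D x /\ N (f @^-1` (U n `&` A)) x) \/ (~ D x /\ (f @^-1` A) x)).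
    apply: mpredU; apply: mpredI => //; first exact/mN/mfU/measurableI.
      exact: mpredN.
    exact: mfU.
  apply: eq_mpred => x; rewrite /preimage /=.
  have [Dx|Dx] := pselect (D x).
    have [y hy] := Dx; rewrite (hu _ _ _ hy); have [Gxy Uy hz] := hy.
    split; last by left; split=> //; exists y.
    by case=> [[_ [z [Gxz [Uz Az]]]]|[]//]; rewrite -(hz z).
  have [_ /(_ Dx) /= ->] := hh (n, x).
  by split=> [[[]//|[]//]|]; right.
- move=> n x; have [h1 h2] := hh (n, x).
  by have [/h1 []|/h2] := pselect (exists y, uniq n x y); [right|left].
- move=> x y Gxy.
  have [e e0 he] : exists2 e : R, 0 < e & forall z, G (x, z) -> `|f z - f y| < e -> z = y.
    have /closed_openC := accessible_finite_set_closed.1 (hausdorff_accessible (@norm_hausdorff _ R)) _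
      (finite_image f (finite_setD [set y] (lfG x))).
    rewrite openE => /(_ (f y)); case.
      by move=> [z [_ /= zy]] /finj.
    move=> e /= e0 he; exists e => // z Gxz zy; apply: contrapT => zny.
    by apply: (he (f z)); [rewrite /ball /= distrC|exists z].
  have [p py hp] := rat_itv_near (f y) e0.
  exists (pickle p); apply/esym/hu; split=> //; first by rewrite Up.
  by move=> z Gxz; rewrite Up => /hp; exact: he.
Qed.

End StandardBorel.

(** * Paths and words *)

Section Paths.
Context {T : Type}.
Implicit Types (G E : set (T * T)) (A B : set T).

Lemma path_in_refl G A x : A x -> path_in G A x x.
Proof. by move=> Ax; exists 0%N, (fun=> x); split=> // -[]. Qed.

Lemma path_in_rcons G A x y z :
  path_in G A x y -> G (y, z) -> A z -> path_in G A x z.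
Proof.
move=> [n [p [p0 pn pA pG]]] yz Az.
exists n.+1, (fun i => if (i <= n)%N then p i else z); split.
- by rewrite leq0n.
- by rewrite ltnn.
- by move=> i _; case: leqP => // /pA.
- move=> i; rewrite ltnS => le_in; rewrite le_in; case: (leqP i.+1 n) => [h|]; first exact: pG.
  by move=> n_i; have -> : i = n; [lia|rewrite pn].
Qed.

Lemma path_in_ind G A x (Q : T -> Prop) : (A x -> Q x) ->
  (forall y z, path_in G A x y -> Q y -> G (y, z) -> A z -> Q z) ->
  forall y, path_in G A x y -> Q y.
Proof.
move=> Q0 QS y [n [p [p0 <- pA pG]]].
suff H i : (i <= n)%N -> path_in G A x (p i) /\ Q (p i) by have [] := H n (leqnn n).
elim: i => [|i ih] h.
  have Ax : A x by rewrite -p0; exact: pA.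
  by rewrite p0; split; [exact: path_in_refl|exact: Q0].
have [pi Qi] := ih (ltnW h).
have Gi : G (p i, p i.+1) by exact: pG.
by split; [apply: path_in_rcons pi Gi _; exact: pA|apply: QS pi Qi Gi _; exact: pA].
Qed.

Lemma path_in_mono G E A B x y : G `<=` E -> A `<=` B ->
  path_in G A x y -> path_in E B x y.
Proof.
move=> GE AB [n [p [p0 pn pA pG]]]; exists n, p; split=> // i h.
  exact/AB/pA.
exact/GE/pG.
Qed.

Lemma path_in_target G A x y : path_in G A x y -> A y.
Proof. by apply: path_in_ind. Qed.

Lemma path_in_source G A x y : path_in G A x y -> A x.
Proof. by move=> [n [p [<- _ pA _]]]; exact: pA. Qed.

Lemma path_in_trans G A y x z : path_in G A x y -> path_in G A y z -> path_in G A x z.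
Proof.
by move=> xy; move: z; apply: path_in_ind => [//|u v _ xu uv Av]; exact: path_in_rcons uv Av.
Qed.

Lemma path_in_cons G A x y z : A x -> G (x, y) -> path_in G A y z -> path_in G A x z.
Proof.
move=> Ax xy yz; have Ay := path_in_source yz; apply: path_in_trans yz.
exact: path_in_rcons (path_in_refl _ Ax) xy Ay.
Qed.

Lemma path_in_edge G A x y : A x -> A y -> G (x, y) -> path_in G A x y.
Proof. by move=> Ax Ay xy; apply: path_in_rcons (path_in_refl _ Ax) xy Ay. Qed.

Lemma path_in_sym G A x y : symmetric_graph G -> path_in G A x y -> path_in G A y x.
Proof.
move=> sG xy; have Ax := path_in_source xy; move: y xy; apply: path_in_ind.
  by move=> _; exact: path_in_refl.
by move=> y z _ yx yz Az; apply: path_in_cons yx => //; exact: sG.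
Qed.

Lemma path_in_restrict G A x y : path_in G A x y -> path_in G [set z | path_in G A x z] x y.
Proof.
move: y; apply: path_in_ind => [Ax|y z xy ih yz Az].
  by apply: path_in_refl; exact: path_in_refl.
by apply: (path_in_rcons ih yz); exact: path_in_rcons xy yz Az.
Qed.

Lemma connR_refl G x : connR G x x. Proof. exact: path_in_refl. Qed.

Lemma connR_sym G x y : symmetric_graph G -> connR G x y -> connR G y x.
Proof. exact: path_in_sym. Qed.

Lemma path_in_connR G A x y : path_in G A x y -> connR G x y.
Proof. exact: path_in_mono. Qed.

Lemma connR_edge G x y : G (x, y) -> connR G x y.
Proof. exact: path_in_edge. Qed.

Lemma path_in_cross G A B x y : path_in G A x y -> B x -> ~ B y ->
  exists u v, [/\ path_in G (A `&` B) x u, B u, ~ B v, A v & G (u, v)].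
Proof.
move=> xy Bx nBy; apply: contrapT => h; apply: nBy.
suff : path_in G (A `&` B) x y by move=> /path_in_target[].
move: y xy; apply: path_in_ind => [Ax|y z _ ih yz Az]; first exact: path_in_refl.
have [Ay By] := path_in_target ih.
apply: (path_in_rcons ih yz); split=> //; apply: contrapT => nBz; by apply: h; exists y, z; split.
Qed.

End Paths.

(** * Words in the neighbour functions *)

Section Words.
Context {d : measure_display} {X : measurableType d}.
Variables (G : set (X * X)) (g : nat -> X -> X).
Hypothesis mg : forall n, measurable_fun setT (g n).
Hypothesis gG : forall n x, g n x = x \/ G (x, g n x).
Hypothesis Gg : forall x y, G (x, y) -> exists n, y = g n x.

Definition act (w : seq nat) (x : X) : X := foldl (fun y n => g n y) x w.

Lemma act_rcons w n x : act (rcons w n) x = g n (act w x).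
Proof. by rewrite /act foldl_rcons. Qed.

Lemma act_cat u w x : act (u ++ w) x = act w (act u x).
Proof. by rewrite /act foldl_cat. Qed.

Lemma measurable_act w : measurable_fun setT (act w).
Proof.
elim/last_ind: w => [|w n ih]; first exact: measurable_id.
rewrite (_ : act _ = g n \o act w); last by apply/funext => x; rewrite act_rcons.
exact: measurableT_comp.
Qed.

Lemma connR_act w x : connR G x (act w x).
Proof.
elim/last_ind: w => [|w n ih]; first exact: connR_refl.
rewrite act_rcons; have [->//|h] := gG n (act w x).
exact: path_in_rcons ih h _.
Qed.

Lemma connR_word x y : connR G x y -> exists w, y = act w x.
Proof.
move: y; apply: path_in_ind => [_|y z _ [w ->] /Gg[n ->] _]; first by exists [::].
by exists (rcons w n); rewrite act_rcons.
Qed.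

Context {d' : measure_display} {Y : measurableType d'}.
Implicit Types phi psi : Y -> X.

Lemma measurable_act_fun w phi : measurable_fun setT phi ->
  measurable_fun setT (fun x => act w (phi x)).
Proof. by move=> h; apply: measurableT_comp h; exact: measurable_act. Qed.

Lemma mpred_rel (E : set (X * X)) phi psi : measurable E -> measurable_fun setT phi ->
  measurable_fun setT psi -> mpred (fun x => E (phi x, psi x)).
Proof.
move=> mE h1 h2; apply: (@mpred_comp _ _ _ _ E (fun x => (phi x, psi x))) => //.
exact/measurable_fun_pair.
Qed.

Lemma mpred_connR_ex (Q : Y -> X -> Prop) phi :
  (forall w, mpred (fun x => Q x (act w (phi x)))) ->
  mpred (fun x => exists y, connR G (phi x) y /\ Q x y).
Proof.
move=> h; apply: eq_mpred (mpred_ex h) => x; split.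
  by move=> [w hw]; exists (act w (phi x)); split=> //; exact: connR_act.
by move=> [y [/connR_word[w ->]]]; exists w.
Qed.

Lemma mpred_connR_all (Q : Y -> X -> Prop) phi :
  (forall w, mpred (fun x => Q x (act w (phi x)))) ->
  mpred (fun x => forall y, connR G (phi x) y -> Q x y).
Proof.
move=> h; apply: eq_mpred (mpred_all h) => x; split.
  by move=> hw y /connR_word[w ->].
by move=> hw w; apply: hw; exact: connR_act.
Qed.

(** A word by itself is no path in [E]: a letter may fix a point, or lead along an edge outside [E]
    or out of [A], so every step is checked. *)
Fixpoint spells (E : set (X * X)) (A : set X) (y : X) (w : seq nat) : Prop :=
  if w is n :: w' then [/\ A y, E (y, g n y) & spells E A (g n y) w'] else A y.

Lemma path_in_spells (E : set (X * X)) A x y : E `<=` G ->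
  path_in E A x y <-> exists w, spells E A x w /\ act w x = y.
Proof.
move=> EG; split; last first.
  move=> [w []]; elim: w x => [|n w ih] x /=; first by move=> Ax <-; exact: path_in_refl.
  by move=> [Ax xn sw] E'; apply: path_in_cons xn _ => //; exact: ih.
suff H w u v : spells E A x w -> act w x = u -> E (u, v) -> A v -> exists n,
    spells E A x (rcons w n) /\ act (rcons w n) x = v.
  move: y; apply: path_in_ind => [Ax|u v _ [w [hw E']] uv Av]; first by exists [::].
  by have [n hn] := H _ _ _ hw E' uv Av; exists (rcons w n).
move=> hw Ew uv Av; have [n vn] := Gg (EG _ uv); exists n; rewrite act_rcons Ew -vn; split=> //.
elim: w x hw Ew => [|m w ih] x /=; first by move=> Ax Ex; rewrite Ex in Ax *; rewrite -vn.
by move=> [Ax xm sw] Ew; split=> //; exact: ih.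
Qed.

Lemma mpred_path (E : set (X * X)) (A : Y -> set X) phi psi :
  (forall u v : Y -> X, measurable_fun setT u -> measurable_fun setT v -> mpred (fun x => u x = v x)) ->
  measurable E -> E `<=` G ->
  measurable_fun setT phi -> measurable_fun setT psi ->
  (forall w, mpred (fun x => A x (act w (phi x)))) ->
  mpred (fun x => path_in E (A x) (phi x) (psi x)).
Proof.
move=> eqX mE EG mphi mpsi mA.
apply: (@eq_mpred _ _ (fun x => exists w, spells E (A x) (phi x) w /\ act w (phi x) = psi x)).
  by move=> x; rewrite path_in_spells.
apply: mpred_ex => w; apply: mpredI; last by apply: eqX => //; exact: measurable_act_fun.
suff H u : mpred (fun x => spells E (A x) (act u (phi x)) w) by exact: (H [::]).
elim: w u => [|n w ih] u /=; first exact: mA.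
apply: (@eq_mpred _ _ (fun x => A x (act u (phi x)) /\ (E (act u (phi x), act (rcons u n) (phi x)) /\
    spells E (A x) (act (rcons u n) (phi x)) w))).
  by move=> x; rewrite act_rcons; split=> [[? []]|[]].
apply: mpredI => //; apply: mpredI => //.
by apply: mpred_rel => //; exact: measurable_act_fun.
Qed.

End Words.

(** * Null sets *)

Section MeasureLimits.
Context {d : measure_display} {X : measurableType d} {R : realType}.
Variable P : probability X R.
Local Open Scope ereal_scope.

Lemma prob_fin (A : set X) : measurable A -> P A < +oo.
Proof. by move=> mA; rewrite (le_lt_trans (probability_le1 P mA)) // ltry. Qed.

Lemma prob_eventually_small (B : nat -> set X) (N : set X) :
  (forall n, measurable (B n)) -> P.-negligible N ->
  (forall x, ~ N x -> exists m, forall n, (m <= n)%N -> ~ B n x) ->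
  forall e : R, (0 < e)%R -> exists m, forall n, (m <= n)%N -> P (B n) < e%:E.
Proof.
move=> mB N0 hB e e0.
pose C m := \bigcup_(n in [set n | (m <= n)%N]) B n.
have mC m : measurable (C m) by exact: bigcup_measurable.
have C0 : P (\bigcap_m C m) = 0.
  apply/negligibleP; first exact: bigcapT_measurable.
  apply: negligibleS N0 => x hx; apply: contrapT => /hB[m hm].
  by have [n /= mn] := hx m I; exact: hm.
have : P \o C @ \oo --> P (\bigcap_m C m).
  apply: nonincreasing_cvg_mu => //.
  - exact: prob_fin.
  - exact: bigcapT_measurable.
  - by move=> m n mn; apply/subsetPset => x [k /= nk Bk]; exists k => //=; exact: leq_trans nk.
rewrite C0 => /(_ [set x | x < e%:E]); case.
  by apply: open_ereal_lt' => //; rewrite lte_fin.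
move=> m _ hm; exists m => n mn; apply: le_lt_trans (hm m (leqnn m)).
by rewrite le_measure ?inE //; exists n.
Qed.

Lemma negligible_limsup (B : nat -> set X) : (forall n, measurable (B n)) ->
  (forall n, P (B n) <= (1 / (2 ^ n.+1)%:R)%:E) ->
  P.-negligible [set x | forall m, exists2 n, (m <= n)%N & B n x].
Proof.
move=> mB hB; apply: (@negligibleS _ _ _ _ (lim_sup_set B)).
  by move=> x hx m _; have [n mn Bn] := hx m; exists n.
apply/negligibleP.
  by apply: bigcapT_measurable => n; exact: bigcup_measurable.
apply: lim_sup_set_cvg0 => //.
apply: (@le_lt_trans _ _ 1); last exact: ltry.
apply: le_trans (@epsilon_trick0 R 1 xpredT ler01).
by apply: lee_nneseries => // n _; exact: hB.
Qed.

End MeasureLimits.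

(** * Saturations of null sets *)

Section NullSaturation.
Context {d : measure_display} {X : measurableType d} {R : realType}.
Variables (P : probability X R) (G : set (X * X)) (f : X -> R) (g : nat -> X -> X).
Hypothesis finj : injective f.
Hypothesis mf : measurable_fun setT f.
Hypothesis sG : symmetric_graph G.
Hypothesis mg : forall n, measurable_fun setT (g n).
Hypothesis gG : forall n x, g n x = x \/ G (x, g n x).
Hypothesis Gg : forall x y, G (x, y) -> exists n, y = g n x.
Hypothesis mcpG : mcp P G.

(** Class preservation speaks of Borel bijections only, so the edges are covered by countably many
    Borel involutions. For [t = (i, j, q)] the map [s t] exchanges [x] and [g i x] if [g j] leads
    back and [q] lies strictly between [f x] and the larger value [f (g i x)]. The threshold [q]
    keeps the lower and the upper ends of the exchanged pairs apart, which makes [s t] well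
    defined. *)
Lemma negligible_neighbors (N : set X) : P.-negligible N ->
  P.-negligible [set y | exists2 x, N x & G (x, y)].
Proof.
move=> N0.
pose B (t : nat * nat * rat) x := f x < ratr t.2 /\ ratr t.2 < f (g t.1.1 x) /\
  g t.1.2 (g t.1.1 x) = x.
pose B' t y := B t (g t.1.2 y) /\ g t.1.1 (g t.1.2 y) = y.
pose s t x := if `[< B t x >] then g t.1.1 x
              else if `[< B' t x >] then g t.1.2 x else x.
have sB t x : B t x -> s t x = g t.1.1 x.
  by move=> h; rewrite /s asboolT.
have nBB' t x : B' t x -> ~ B t x.
  by move=> [[_ [h1 _]] E] [h2 _]; move: h1; rewrite E ltNge (ltW h2).
have sB' t x : B' t x -> s t x = g t.1.2 x.
  by move=> h; rewrite /s asboolF ?asboolT //; exact: nBB'.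
have BB' t x : B t x -> B' t (g t.1.1 x) by move=> h; have [_ [_ E]] := h; rewrite /B' E.
have sK t x : s t (s t x) = x.
  have [h|h] := pselect (B t x).
    by rewrite (sB _ _ h) (sB' _ _ (BB' _ _ h)); case: h => _ [].
  have [h'|h'] := pselect (B' t x).
    by rewrite (sB' _ _ h'); have [h1 E] := h'; rewrite sB.
  have E : s t x = x by by rewrite /s !asboolF.
  by rewrite !E.
have eqX := @mpred_eq_fun _ _ _ f finj mf.
have mgg i j : measurable_fun setT (fun x => g i (g j x)) by exact: measurableT_comp.
have mfl (h : X -> X) q : measurable_fun setT h -> mpred (fun x => f (h x) < ratr q).
  move=> mh; apply: (@mpred_comp _ _ _ _ (fun y => f y < ratr q) h) => //.
  have := mf measurableT (measurable_itv `]-oo, (ratr q : R)[); rewrite setTI.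
  by congr measurable; apply/seteqP; split=> x; rewrite /= in_itv.
have mfr (h : X -> X) q : measurable_fun setT h -> mpred (fun x => ratr q < f (h x)).
  move=> mh; apply: (@mpred_comp _ _ _ _ (fun y => ratr q < f y) h) => //.
  have := mf measurableT (measurable_itv `](ratr q : R), +oo[); rewrite setTI.
  by congr measurable; apply/seteqP; split=> x; rewrite /= in_itv /= andbT.
have mB t : mpred (B t).
  by apply: mpredI; [exact: (mfl id)|apply: mpredI; [exact: mfr|apply: eqX]].
have mB' t : mpred (B' t).
  by apply: mpredI; [exact: (@mpred_comp _ _ _ _ (B t) (g t.1.2))|exact: eqX].
have ms t : measurable_fun setT (s t).
  move=> _ A mA; rewrite setTI.
  have : mpred (fun x => (B t x /\ A (g t.1.1 x)) \/
     (~ B t x /\ ((B' t x /\ A (g t.1.2 x)) \/ (~ B' t x /\ A x)))).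
    apply: mpredU; apply: mpredI => //; first exact: (@mpred_comp _ _ _ _ A (g t.1.1)).
      exact: mpredN.
    apply: mpredU; apply: mpredI => //; first exact: (@mpred_comp _ _ _ _ A (g t.1.2)).
    exact: mpredN.
  congr measurable; apply/seteqP; split=> x; rewrite /preimage /=.
    move=> [[b ?]|[nb [[b' ?]|[nb' ?]]]]; first by rewrite sB.
      by rewrite sB'.
    by rewrite /s !asboolF.
  have [b|b] := pselect (B t x); first by rewrite sB //; left.
  have [b'|b'] := pselect (B' t x); first by rewrite sB' //; right; split=> //; left.
  by rewrite /s !asboolF //; right; split=> //; right.
have sN t : P.-negligible (s t @` N).
  apply: (mcpG (ms t)) => //; first by exists (s t).
  have gc n x : connR G x (g n x).
    by have [->|h] := gG n x; [exact: connR_refl|exact: connR_edge].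
  move=> x; rewrite /s; case: asboolP => // _.
  by case: asboolP => // _; exact: connR_refl.
pose t_ n : nat * nat * rat := odflt (0%N, 0%N, 0) (unpickle n).
apply: (@negligibleS _ _ _ _ (N `|` \bigcup_n (s (t_ n) @` N))); last first.
  by apply: negligibleU => //; exact: negligible_bigcup.
move=> y [x Nx Gxy].
have [fxy|fyx|/finj E] := ltgtP (f x) (f y); last by left; rewrite -E.
  right; have [q] := rat_in_itvoo fxy; rewrite in_itv /= => /andP[h1 h2].
  have [i yi] := Gg Gxy; have [j xj] := Gg (sG Gxy).
  exists (pickle (i, j, q)) => //; exists x => //.
  rewrite /t_ pickleK /= sB // /B /= -yi -xj; split=> //.
right; have [q] := rat_in_itvoo fyx; rewrite in_itv /= => /andP[h1 h2].
have [i yi] := Gg Gxy; have [j xj] := Gg (sG Gxy).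
exists (pickle (j, i, q)) => //; exists x => //.
rewrite /t_ pickleK /= sB' // /B' /= -yi -xj; split=> //.
by rewrite /B /= -xj -yi.
Qed.

Lemma negligible_saturation (N : set X) : P.-negligible N ->
  P.-negligible [set y | exists2 x, N x & connR G x y].
Proof.
move=> N0.
pose S n := iter n (fun A => A `|` [set y | exists2 x, A x & G (x, y)]) N.
have S0 n : P.-negligible (S n).
  by elim: n => //= n ih; apply: negligibleU => //; exact: negligible_neighbors.
apply: (@negligibleS _ _ _ _ (\bigcup_n S n)); last exact: negligible_bigcup.
move=> y [x Nx]; move: y; apply: path_in_ind => [_|y z _ [n _ Sn] yz _]; first by exists 0%N.
by exists n.+1 => //; right; exists y.
Qed.

Lemma invariant_conull (Q : X -> Prop) : {ae P, forall x, Q x} ->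
  exists X0 : set X, [/\ measurable X0, P.-negligible (~` X0),
    forall x y, X0 x -> connR G x y -> X0 y & forall x, X0 x -> Q x].
Proof.
move=> [N [mN N0 QN]].
exists [set x | forall y, connR G x y -> ~ N y]; split.
- apply: (@mpred_connR_all _ _ G g gG Gg _ _ (fun _ y => ~ N y) id) => w.
  by apply: mpredN; apply: (@mpred_comp _ _ _ _ N (act g w)) => //; exact: measurable_act.
- have := @negligible_saturation N; case; first by exists N; split.
  move=> M [mM M0 NM]; exists M; split=> // x /existsNP[y /not_implyP[xy /contrapT Ny]].
  by apply: NM; exists y => //; exact: connR_sym.
- by move=> x y hx xy z yz; apply: hx; exact: path_in_trans yz.
- by move=> x hx; apply: contrapT => nQ; apply: (hx x); [exact: connR_refl|exact: QN].
Qed.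

End NullSaturation.

(** * Steiner forests in finite graphs *)

Section SteinerForest.
Local Close Scope classical_set_scope.
Context {R : realFieldType} {T : finType}.
Variables (e dm : rel T) (k : nat).
Hypothesis esym : symmetric e.
Hypothesis dmsym : symmetric dm.
Hypothesis k_gt0 : (0 < k)%N.
Implicit Types (F : {set T * T}) (w : T * T -> R).

Definition swap (p : T * T) := (p.2, p.1).

Lemma swapK : involutive swap. Proof. by case. Qed.

Definition sym_set F := forall p, (swap p \in F) = (p \in F).

Definition edges : {set T * T} := [set p | e p.1 p.2].

Lemma edges_sym : sym_set edges.
Proof. by move=> p; rewrite !inE /= esym. Qed.

Definition joined F : rel T := connect [rel u v | (u, v) \in F].

Lemma joined_sym F : sym_set F -> symmetric (joined F).
Proof.
by move=> sF; apply: sym_connect_sym => u v /=; rewrite -(sF (u, v)).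
Qed.

Lemma joined_mono F F' : F \subset F' -> forall u v, joined F u v -> joined F' u v.
Proof.
by move=> /fintype.subsetP FF'; apply: connect_sub => u v uv; apply: connect1; exact: FF'.
Qed.

Lemma sum_swap F (h : T * T -> nat) : sym_set F ->
  (\sum_(p in F) h (swap p) = \sum_(p in F) h p)%N.
Proof.
move=> sF; rewrite [RHS](reindex_inj (inv_inj swapK)) /=.
by apply: eq_bigl => p; rewrite sF.
Qed.

Section Contracted.
Variable Z : {set T * T}.
Hypothesis Zsym : sym_set Z.

Let r := fingraph.root [rel u v | (u, v) \in Z].

Let Zcs : connect_sym [rel u v | (u, v) \in Z].
Proof. exact: joined_sym. Qed.

Let rE u v : (r u == r v) = joined Z u v.
Proof. exact: (root_connect Zcs). Qed.

Definition active : {set T} :=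
  [set c | [exists u, exists v, [&& r u == c, r v != c & dm u v]]].

Definition feasible F := forall u v, dm u v -> joined (F :|: Z) u v.

Definition cdeg F (c : T) := #|[set p in F | (r p.1 == c) && (r p.2 != c)]|.

(** The number of active ends of an edge after contracting [Z]. Its sum over a set of edges is twice
    a sum of degrees of active classes, which is bounded above for minimal solutions and below for
    the set of all edges. *)
Definition cweight (p : T * T) : nat :=
  if r p.1 == r p.2 then 0%N else ((r p.1 \in active) + (r p.2 \in active))%N.

Lemma sum_cweight F : sym_set F ->
  (\sum_(p in F) cweight p = (\sum_(c in active) cdeg F c).*2)%N.
Proof.
move=> sF.
pose h p : nat := ((r p.1 != r p.2) && (r p.1 \in active)).
have -> : (\sum_(p in F) cweight p = \sum_(p in F) h p + \sum_(p in F) h (swap p))%N.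
  rewrite -big_split; apply: eq_bigr => p _; rewrite /cweight /h /= (eq_sym (r p.2)).
  by case: eqP.
rewrite sum_swap // addnn; congr _.*2.
rewrite /h; under eq_bigr => p _ do rewrite -[nat_of_bool _]/(if _ then 1 else 0)%N.
transitivity #|[set p in F | (r p.1 != r p.2) && (r p.1 \in active)]|.
  rewrite -sum1_card big_mkcond [RHS]big_mkcond; apply: eq_bigr => p _.
  by rewrite inE; case: (p \in F) => //=; case: (_ && _).
rewrite -sum1_card (partition_big (fun p => r p.1) (mem active)) /=; last first.
  by move=> p; rewrite inE => /and3P[].
apply: eq_bigr => c cA; rewrite /cdeg -sum1_card; apply: eq_bigl => p.
move: active cA => A cA.
rewrite !inE; case: (p \in F) => //=; case: (r p.1 =P c) => [->|]; last by rewrite !andbF.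
by rewrite cA !andbT eq_sym.
Qed.

Definition minimal_feasible F := [/\ sym_set F, feasible F &
  forall p, p \in F -> ~ feasible (F :\: [set p; swap p])].

Section Minimal.
Variable F : {set T * T}.
Hypothesis Fmin : minimal_feasible F.

Let sF : sym_set F. Proof. by case: Fmin. Qed.

Let drop p := (F :\: [set p; swap p]) :|: Z.

Let sdrop p : sym_set (drop p).
Proof.
move=> q; rewrite !inE sF Zsym; congr ((~~ _ && _) || _).
by rewrite (inv_eq swapK) (inj_eq (inv_inj swapK)) orbC.
Qed.

Lemma minimal_bridge p : p \in F -> ~~ joined (drop p) p.1 p.2.
Proof.
move=> pF; have [_ hF /(_ p pF) nf] := Fmin.
apply/negP => j; apply: nf => u v /hF.
apply: connect_sub => a b /=; rewrite !inE => /orP[abF|abZ]; last first.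
  by apply: connect1; rewrite /= !inE abZ orbT.
have [E|n1] := eqVneq (a, b) p; first by move: j; rewrite -E.
have [E|n2] := eqVneq (a, b) (swap p).
  by move: j; rewrite -(swapK p) -E /= -/(joined (drop p) b a) joined_sym.
by apply: connect1; rewrite /= !inE (negbTE n1) (negbTE n2) abF.
Qed.

Let touched : {set T} := [set r p.1 | p in F].

Let side p := [set u | joined (drop p) p.1 u].

Let side_r p u : (r u \in side p) = (u \in side p).
Proof.
rewrite !inE; have h : joined (drop p) (r u) u.
  have : joined Z (r u) u by rewrite -rE /r (root_root Zcs).
  by apply: joined_mono; exact: finset.subsetUr.
by apply/idP/idP => j; apply: connect_trans j _; rewrite // -/(joined _ _ _) joined_sym.
Qed.

Let side_drop p q : q \in F -> q != p -> q != swap p ->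
  (q.1 \in side p) = (q.2 \in side p).
Proof.
move=> qF n1 n2; rewrite !inE.
have h : joined (drop p) q.1 q.2.
  by apply: connect1; rewrite /= -surjective_pairing !inE (negbTE n1) (negbTE n2) qF.
by apply/idP/idP => j; apply: connect_trans j _; rewrite // -/(joined _ _ _) joined_sym.
Qed.

Let F_cross p : p \in F -> r p.1 != r p.2.
Proof.
move=> pF; rewrite rE; apply: contra (minimal_bridge pF).
by apply: joined_mono; exact: finset.subsetUr.
Qed.

Let half := [set p in F | (enum_rank p.1 < enum_rank p.2)%N].

Lemma card_half : (#|F| = #|half|.*2)%N.
Proof.
have -> : F = half :|: [set swap p | p in half].
  apply/finset.setP => p; rewrite !inE; apply/idP/idP.
    move=> pF; rewrite pF /=.
    have [//|lt|E] := ltngtP (enum_rank p.1) (enum_rank p.2); last first.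
      by have := F_cross pF; rewrite (enum_rank_inj (val_inj E)) eqxx.
    by apply/imsetP; exists (swap p); rewrite ?swapK // !inE sF pF.
  case/orP => [/andP[]//|/imsetP[q]]; rewrite !inE => /andP[qF _] ->.
  by rewrite sF.
rewrite cardsU (card_imset _ (inv_inj swapK)) -addnn.
rewrite (_ : half :&: _ = finset.set0) ?cards0 ?subn0 //.
apply/finset.setP => p; rewrite !inE; apply/negbTE/negP => /andP[/andP[_ lt] /imsetP[q]].
by rewrite !inE => /andP[_ lt'] E; move: lt; rewrite E /= ltnNge ltnW.
Qed.

(* Each edge of a minimal solution is the only one crossing its side, so the
   incidence matrix has a right inverse. *)
Lemma card_half_touched : (#|half| <= #|touched|)%N.
Proof.
pose E (i : 'I_#|half|) := enum_val i.
pose V (j : 'I_#|touched|) := enum_val j.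
have EF i : E i \in F by have := enum_valP i; rewrite inE => /andP[].
have tou p : p \in F -> r p.1 \in touched by move=> pF; apply/imsetP; exists p.
have tou2 p : p \in F -> r p.2 \in touched.
  by move=> pF; apply/imsetP; exists (swap p); rewrite ?sF.
pose A : 'M[rat]_(_, _) := \matrix_(i < #|half|, j < #|touched|)
   ((r (E i).1 == V j)%:R - (r (E i).2 == V j)%:R).
pose B : 'M[rat]_(_, _) := \matrix_(j < #|touched|, i < #|half|) (V j \in side (E i))%:R.
apply: (@mulmx1_min _ _ _ A B); apply/matrixP => i i'; rewrite !mxE.
have sumV c (h : T -> rat) : c \in touched ->
    \sum_(j < #|touched|) (c == V j)%:R * h (V j) = h c.
  move=> ct; rewrite (bigD1 (enum_rank_in ct c)) //= /V enum_rankK_in // eqxx mul1r.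
  rewrite big1 ?addr0 // => j nj; case: eqP => [Ec|_]; last by rewrite mul0r.
  case/negP: nj; apply/eqP/enum_val_inj.
  by rewrite enum_rankK_in.
under eq_bigr => j _ do rewrite !mxE mulrBl.
rewrite sumrB (sumV _ (fun c => (c \in side (E i'))%:R)) ?tou //.
rewrite (sumV _ (fun c => (c \in side (E i'))%:R)) ?tou2 // !side_r.
have [->|ne] := eqVneq i i'.
  rewrite !inE /joined connect0 -/(joined _ _ _) (negbTE (minimal_bridge (EF i'))).
  by rewrite subr0.
have n1 : E i != E i' by apply: contra ne => /eqP/enum_val_inj ->.
have n2 : E i != swap (E i').
  apply/eqP => h; have := enum_valP i; have := enum_valP i'.
  by rewrite !inE -/(E i) -/(E i') h /= => /andP[_ a] /andP[_]; rewrite ltnNge ltnW.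
by rewrite (side_drop (EF i) n1 n2) subrr.
Qed.

Lemma cdeg_touched c : c \in touched -> (0 < cdeg F c)%N.
Proof.
move=> /imsetP[p pF ->]; rewrite card_gt0; apply/set0Pn; exists p.
by rewrite !inE pF eqxx eq_sym F_cross.
Qed.

(** Otherwise the class is a leaf without demand. Its edge [p] could then be deleted, against
    minimality: a walk between demand partners that visits [c] enters and leaves it through [p], so
    the visit can be cut out. *)
Lemma inactive_cdeg c : c \in touched -> c \notin active -> (1 < cdeg F c)%N.
Proof.
move=> ct nac; have := cdeg_touched ct; rewrite leq_eqVlt => /orP[|//].
rewrite eq_sym => /cards1P[p hp].
have hq q : q \in F -> r q.1 = c -> q = p.
  move=> qF qc; apply/set1P; rewrite -hp !inE qF -qc eqxx /= eq_sym; exact: F_cross.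
have /andP[pF /andP[/eqP pc pn]] : (p \in F) && ((r p.1 == c) && (r p.2 != c)).
  by have := set11 p; rewrite -hp !inE.
have [_ hF /(_ p pF) nf] := Fmin; exfalso; apply: nf => x y xy.
have inC u v : dm u v -> r u = c -> r v = c.
  move=> uv uc; apply/eqP/negPn/negP => vc; move/negP: nac; apply; rewrite inE.
  by apply/existsP; exists u; apply/existsP; exists v; rewrite uc eqxx vc.
have [xc|xc] := eqVneq (r x) c.
  have : joined Z x y by rewrite -rE xc (inC _ _ xy xc).
  by apply: joined_mono; exact: finset.subsetUr.
(* While the walk is in the class [c], its position is replaced by [p.2], the outer end of the only
   edge at [c]. *)
suff H z : joined (F :|: Z) x z ->
    if r z == c then joined (drop p) x p.2 else joined (drop p) x z.
  have := H _ (hF _ _ xy); case: eqP => [yc|//].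
  by move: xc; rewrite (inC _ _ _ yc) ?eqxx // dmsym.
move=> /connectP[s]; elim/last_ind: s z => [|s z' ih] z /=.
  by move=> _ ->; rewrite (negbTE xc) /joined connect0.
rewrite rcons_path last_rcons => /andP[hs hz] ->; have {ih} := ih _ hs erefl.
set y' := last x s in hz *; move: hz; rewrite /= inE => /orP[zF|zZ]; last first.
  have <- : r y' = r z' by apply/eqP; rewrite rE; exact: connect1.
  case: ifP => // _ j; apply: connect_trans j _.
  by apply: connect1; rewrite /= !inE zZ orbT.
have /= ne := F_cross zF; case: (r y' =P c) => y'c; case: (r z' =P c) => z'c //.
- by rewrite -(hq _ zF y'c).
- by have -> : p.2 = y' by rewrite -(hq (swap (y', z'))) // sF.
- move=> j; apply: connect_trans j _; apply: connect1; rewrite /= !inE zF andbT negb_or.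
  apply/orP; left; apply/andP; split; apply/eqP => E.
    by move: y'c; rewrite -pc -E.
  by move: z'c; rewrite -pc -(swapK p) -E.
Qed.

(** In a forest the degrees sum to at most twice the number of touched vertices. Inactive touched
    vertices use up at least two each, which leaves at most two on average for the active ones. *)
Lemma sum_cdeg_active : (\sum_(c in active) cdeg F c <= #|active|.*2)%N.
Proof.
have S : (\sum_(c in touched) cdeg F c = #|F|)%N.
  rewrite -[RHS]sum1_card (partition_big (fun p => r p.1) (mem touched)) /=; last first.
    by move=> p pF; apply/imsetP; exists p.
  apply: eq_bigr => c _; rewrite /cdeg -sum1_card; apply: eq_bigl => p; rewrite inE.
  case pF: (p \in F) => //=; case: (r p.1 =P c) => //= <-.
  by rewrite eq_sym F_cross.
have nt c : c \notin touched -> cdeg F c = 0%N.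
  move=> ct; apply/eqP; rewrite cards_eq0; apply/eqP/setP => p; rewrite !inE.
  apply/negbTE/negP => /and3P[pF /eqP pc _]; move/negP: ct; apply.
  by apply/imsetP; exists p.
have -> : (\sum_(c in active) cdeg F c = \sum_(c in active :&: touched) cdeg F c)%N.
  rewrite [RHS]big_mkcond [LHS]big_mkcond; apply: eq_bigr => c _; rewrite finset.in_setI.
  by case: (c \in active) => //=; case: ifPn => // h; rewrite nt.
have A1 : (\sum_(c in touched :\: active) cdeg F c >= #|touched :\: active|.*2)%N.
  rewrite -muln2 -sum_nat_const; apply: leq_sum => c; rewrite inE => /andP[ca ct].
  exact: inactive_cdeg.
have E1 : (#|touched| = #|active :&: touched| + #|touched :\: active|)%N.
  by rewrite -(cardsID active touched) finset.setIC.
have E2 : (\sum_(c in touched) cdeg F c = \sum_(c in active :&: touched) cdeg F c +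
    \sum_(c in touched :\: active) cdeg F c)%N.
  by rewrite (big_setID active) /= finset.setIC.
have := card_half_touched; have := card_half; have : (#|active :&: touched| <= #|active|)%N.
  by apply: subset_leq_card; exact: finset.subsetIl.
lia.
Qed.
End Minimal.

(** No edge of [Z] leaves a class of the contraction, so the cut around an active class falls under
    the second alternative. *)
Lemma active_edges :
  (forall A : {set T}, (exists u v, [/\ u \in A, v \notin A & dm u v]) ->
    (exists u v, [/\ u \in A, v \notin A & (u, v) \in Z]) \/
    (k <= #|[set p in edges | (p.1 \in A) && (p.2 \notin A)]|)%N) ->
  (k * #|active| <= \sum_(c in active) cdeg edges c)%N.
Proof.
move=> hcut; rewrite mulnC -sum_nat_const; apply: leq_sum => c.
rewrite inE => /existsP[u /existsP[v /and3P[uc vc uv]]].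
have := hcut [set x | r x == c]; case.
  by exists u, v; rewrite !inE.
  move=> [a [b]]; rewrite !inE => -[ac bc abZ].
  have : r a == r b by rewrite rE; exact: connect1.
  by rewrite (eqP ac) eq_sym (negbTE bc).
move=> h; apply: leq_trans h _; apply: subset_leq_card; apply/fintype.subsetP => p.
by rewrite !inE.
Qed.
End Contracted.

Lemma minimal_feasible_exists (Z F : {set T * T}) : sym_set F -> feasible Z F ->
  exists2 F' : {set T * T}, F' \subset F & minimal_feasible Z F'.
Proof.
move=> sF hF; pose Q (F' : {set T * T}) := [&& F' \subset F, [forall p, (swap p \in F') == (p \in F')] &
  [forall u, forall v, dm u v ==> joined (F' :|: Z) u v]].
have QE (F' : {set T * T}) : Q F' <-> [/\ F' \subset F, sym_set F' & feasible Z F'].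
  split=> [/and3P[h1 /forallP h2 /forallP h3]|[h1 h2 h3]].
    split=> // [p|u v]; first exact/eqP.
    by move: (h3 u) => /forallP/(_ v)/implyP.
  apply/and3P; split=> //; first by apply/forallP => p; rewrite h2.
  by apply/forallP => u; apply/forallP => v; apply/implyP; exact: h3.
have QF : Q F by apply/QE.
have [F' /QE[h1 h2 h3] hmin] := @arg_minnP _ F Q (fun F' : {set T * T} => #|F'|) QF.
exists F' => //; split=> // p pF hp.
have : Q (F' :\: [set p; swap p]).
  apply/QE; split=> //; first by apply: fintype.subset_trans h1; exact: finset.subsetDl.
  move=> q; rewrite !inE h2; congr (~~ _ && _).
  by rewrite (inv_eq swapK) (inj_eq (inv_inj swapK)) orbC.
move=> /hmin; rewrite leqNgt => /negP; apply; apply: proper_card.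
apply/properP; split; first exact: finset.subsetDl.
by exists p => //; rewrite !inE eqxx.
Qed.

(* Local ratio: subtract a multiple of [cweight] from the weights until one more
   edge becomes free; minimal solutions satisfy the bound for [cweight] itself. *)
Lemma steiner_forest w :
  (forall p, 0 <= w p) -> (forall p, w (swap p) = w p) ->
  (forall A : {set T}, (exists u v, [/\ u \in A, v \notin A & dm u v]) ->
    (exists u v, [/\ u \in A, v \notin A & e u v && (w (u, v) == 0)]) \/
    (k <= #|[set p in edges | (p.1 \in A) && (p.2 \notin A)]|)%N) ->
  exists F : {set T * T}, [/\ F \subset edges, sym_set F,
    (forall u v, dm u v -> joined F u v) &
    k%:R * \sum_(p in F) w p <= 2 * \sum_(p in edges) w p].
Proof.
have [n] := ubnP #|[set p in edges | w p != 0]|.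
elim: n w => // n ih w hn w0 wsym hcut.
pose Z := [set p in edges | w p == 0].
have Zsym : sym_set Z by move=> p; rewrite !inE wsym /= esym.
have Ze : Z \subset edges by apply/fintype.subsetP => p; rewrite inE => /andP[].
have hcutZ (A : {set T}) : (exists u v, [/\ u \in A, v \notin A & dm u v]) ->
    (exists u v, [/\ u \in A, v \notin A & (u, v) \in Z]) \/
    (k <= #|[set p in edges | (p.1 \in A) && (p.2 \notin A)]|)%N.
  by move=> /hcut[[u [v [h1 h2 h3]]]|]; [left; exists u, v; rewrite !inE|right].
have [hZ|] := boolP [forall u, forall v, dm u v ==> joined Z u v].
  exists Z; split=> // [u v|].
    by move/forallP: hZ => /(_ u)/forallP/(_ v)/implyP.
  rewrite big1 ?mulr0 ?mulr_ge0 ?sumr_ge0 // => p; by rewrite inE => /andP[_ /eqP].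
rewrite negb_forall => /existsP[u0]; rewrite negb_forall => /existsP[v0].
rewrite negb_imply => /andP[dm0 nj0].
pose cw p := cweight Z p.
have cw_act : (0 < #|active Z|)%N.
  rewrite card_gt0; apply/set0Pn; exists (fingraph.root [rel u v | (u, v) \in Z] u0).
  rewrite inE; apply/existsP; exists u0; apply/existsP; exists v0.
  rewrite eqxx dm0 andbT /= eq_sym root_connect //; exact: joined_sym.
have cwE : (0 < \sum_(p in edges) cw p)%N.
  rewrite sum_cweight ?double_gt0; last exact: edges_sym.
  by apply: leq_trans (active_edges Zsym hcutZ); rewrite muln_gt0 k_gt0.
have [p0 p0e cwp0] : exists2 p, p \in edges & (0 < cw p)%N.
  apply/exists_inP; apply: contraLR cwE; rewrite negb_exists_in => /forall_inP h.
  by rewrite -eqn0Ngt sum_nat_eq0; apply/forall_inP => p /h; rewrite -eqn0Ngt.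
pose Q p := (p \in edges) && (0 < cw p)%N.
have Q0 : Q p0 by rewrite /Q p0e.
(* The minimal ratio [eps] is the largest multiple of [cw] whose subtraction keeps the weights
   nonnegative, and [q] becomes free. *)
have [q /andP[qe cwq] hq] := @arg_minP _ _ _ p0 Q (fun p => w p / (cw p)%:R) Q0.
pose eps := w q / (cw q)%:R.
have cwsym p : cw (swap p) = cw p.
  by rewrite /cw /cweight /= eq_sym addnC.
have cwZ p : p \in Z -> cw p = 0%N.
  move=> pZ; rewrite /cw /cweight; case: ifP => // /negP[].
  rewrite root_connect; last exact: joined_sym.
  by apply: connect1; rewrite /= -surjective_pairing.
pose w' p := if p \in edges then w p - eps * (cw p)%:R else w p.
have w'0 p : 0 <= w' p.
  rewrite /w'; case: ifPn => // pe; rewrite subr_ge0.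
  have [->|cwp] := posnP (cw p); first by rewrite mulr0.
  rewrite -ler_pdivlMr ?ltr0n //; apply: hq; by rewrite /Q pe.
have w'Z p : p \in Z -> w' p = 0.
  move=> pZ; rewrite /w' (fintype.subsetP Ze _ pZ) cwZ // mulr0 subr0.
  by move: pZ; rewrite inE => /andP[_ /eqP].
have [||||F0 [F0e F0s F0j F0w]] := ih w'.
- rewrite -ltnS; apply: leq_trans hn; rewrite ltnS; apply: proper_card.
  apply/properP; split.
    apply/fintype.subsetP => p; rewrite !inE => /andP[pe w'p]; rewrite pe /=.
    by apply: contra w'p => wp; rewrite w'Z // !inE pe wp.
  exists q; rewrite !inE; move: (qe); rewrite inE => -> /=.
    by apply/eqP => wq; move: cwq; rewrite cwZ // inE qe wq eqxx.
  by rewrite negbK /w' qe /eps divfK ?subrr // pnatr_eq0 -lt0n.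
- exact: w'0.
- by move=> p; rewrite /w' edges_sym wsym cwsym.
- move=> A /hcutZ[[u [v [h1 h2 h3]]]|h]; last by right.
  left; exists u, v; split=> //; rewrite w'Z // eqxx andbT.
  by have := fintype.subsetP Ze _ h3; rewrite inE.
(* The solution for the reduced weights is pruned to one that is minimal modulo [Z]; the edges of
   [Z] are then added back at no cost. *)
have [|F FF0 Fmin] := @minimal_feasible_exists Z F0 F0s.
  by move=> u v /F0j; apply: joined_mono; exact: finset.subsetUl.
have [Fs Ff _] := Fmin.
exists (F :|: Z); split=> //.
- by rewrite finset.subUset Ze (fintype.subset_trans FF0).
- by move=> p; rewrite !(finset.in_setU) Fs Zsym.
have -> : \sum_(p in F :|: Z) w p = \sum_(p in F) w p.
  rewrite (big_setID F) /= finset.setUK [X in _ + X]big1 ?addr0 // => p.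
  by rewrite !inE => /andP[/negbTE -> /= /andP[_ /eqP]].
have FE : F \subset edges by exact: fintype.subset_trans FF0 F0e.
have wE (S : {set T * T}) : S \subset edges ->
    \sum_(p in S) w p = \sum_(p in S) w' p + eps * (\sum_(p in S) cw p)%:R.
  move=> /fintype.subsetP Se; rewrite natr_sum mulr_sumr -big_split; apply: eq_bigr => p pS.
  by rewrite /w' Se //= subrK.
rewrite (wE F FE) (wE edges (fintype.subxx _)) !mulrDr; apply: lerD.
  apply: le_trans F0w; rewrite ler_wpM2l ?ler0n //.
  rewrite [leRHS](big_setID F) /= (finset.setIidPr FF0) lerDl sumr_ge0 // => p _; exact: w'0.
(* In the subtracted part both sides are degree sums over active classes, at most [2 * #|active Z|]
   for [F] and at least [k * #|active Z|] for all edges. *)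
rewrite ![_ * (eps * _)]mulrCA ler_wpM2l ?divr_ge0 ?ler0n // -!natrM ler_nat.
rewrite !sum_cweight //; last exact: edges_sym.
have := sum_cdeg_active Zsym Fmin; have := active_edges Zsym hcutZ.
set a := #|_|; set b := (\sum_(c in _) _)%N; set c := (\sum_(c in _) _)%N => h1 h2.
nia.
Qed.

End SteinerForest.
Local Open Scope classical_set_scope.

(** * Small bonds in one-ended graphs *)

Section Bonds.
Context {T : choiceType}.
Implicit Types (E G : set (T * T)) (A B F : set T).

Definition crossing E A (p : T * T) := [/\ E p, A p.1 & ~ A p.2].

Definition cut_le E A (k : nat) := forall s : seq (T * T), uniq s ->
  (forall p, p \in s -> crossing E A p) -> (size s <= k)%N.

Definition bond_at E u v A (k : nat) :=
  [/\ E (u, v), A u, ~ A v, (forall y, A y -> path_in E A u y) &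
    (forall y, connR E u y -> ~ A y -> path_in E (~` A) v y)] /\ cut_le E A k.

Lemma path_in_edges E G A x y :
  (forall a b, A a -> A b -> E (a, b) -> G (a, b)) -> path_in E A x y -> path_in G A x y.
Proof.
move=> EG; move: y; apply: path_in_ind => [Ax|y z xy ih yz Az]; first exact: path_in_refl.
by apply: (path_in_rcons ih) => //; apply: EG => //; exact: path_in_target xy.
Qed.

(** Delete the edge between [u] and [v]. If these stay connected, a fixed path between them crosses
    the bond, which becomes a smaller bond of the remaining graph, marked at one of the finitely
    many edges of that path. Otherwise [A] can only be the remaining component of [u]. *)
Lemma finite_bonds E (k : nat) u v : symmetric_graph E -> finite_set [set A | bond_at E u v A k].
Proof.
elim: k E u v => [|k ih] E u v sE.
  rewrite (_ : [set _ | _] = set0) //; rewrite -subset0 => A [[uv Au nAv _ _] hk].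
  by have /(hk [:: (u, v)] isT) : forall p, p \in [:: (u, v)] -> crossing E A p by move=> p; rewrite inE => /eqP ->.
pose E' := E `\` [set (u, v); (v, u)].
have sE' : symmetric_graph E'.
  move=> a b [ab /not_orP[n1 n2]]; split; first exact: sE.
  by move=> [/= [E1 E2]|/= [E1 E2]]; [apply: n2|apply: n1]; rewrite E1 E2.
have E'E : E' `<=` E by move=> p [].
have inE' A x y : ~ A v -> path_in E A x y -> path_in E' A x y.
  move=> nAv; apply: path_in_edges => a b Aa Ab ab; split=> //.
  by move=> [/= [E1 E2]|/= [E1 E2]]; apply: nAv; [rewrite -E2|rewrite -E1].
have outE' A x y : A u -> path_in E (~` A) x y -> path_in E' (~` A) x y.
  move=> Au; apply: path_in_edges => a b Aa Ab ab; split=> //.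
  by move=> [/= [E1 E2]|/= [E1 E2]]; [apply: Aa; rewrite E1|apply: Ab; rewrite E2].
have [[n [p [p0 pn _ pE]]]|nuv] := pselect (connR E' u v).
  apply: (@sub_finite_set _ _ (\bigcup_(i in `I_n) [set A | bond_at E' (p i) (p i.+1) A k])).
    move=> A [[uv Au nAv hA hnA] hk].
    have [i [ni Api nApi]] : exists i, [/\ (i < n)%N, A (p i) & ~ A (p i.+1)].
      apply: contrapT => h; apply: nAv; rewrite -pn.
      suff H i : (i <= n)%N -> A (p i) by exact: H.
      elim: i => [|i IH] hi; first by rewrite p0.
      by apply: contrapT => nA; apply: h; exists i; split=> //; exact/IH/ltnW.
    exists i => //; split; first split=> //.
    - exact: pE.
    - move=> y Ay; apply: (@path_in_trans _ _ _ u); first apply: path_in_sym => //.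
        by apply: inE' => //; exact: hA.
      by apply: inE' => //; exact: hA.
    - have up : connR E u (p i) by exact: path_in_connR (hA _ Api).
      move=> y piy nAy.
      have uy : connR E u y by apply: path_in_trans up _; exact: path_in_mono piy.
      apply: (@path_in_trans _ _ _ v); last by apply: outE' => //; exact: hnA.
      apply: path_in_sym => //; apply: outE' => //; apply: hnA => //.
      by apply: path_in_trans up _; apply: connR_edge; exact: (E'E _ (pE _ ni)).
    - move=> s us hs; rewrite -ltnS -/(size ((u, v) :: s)); apply: hk.
        rewrite /= us andbT; apply/negP => /hs[[_ /=]]; by move=> + _ _; apply; left.
      move=> q; rewrite inE => /orP[/eqP -> //|/hs[Eq ? ?]].
      by split=> //; exact: E'E.
  apply: bigcup_finite; first exact: finite_II.
  by move=> i _; exact: ih.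
apply: (@sub_finite_set _ _ [set [set y | connR E' u y]]); last exact: finite_set1.
move=> A [[uv Au nAv hA hnA] hk]; apply/seteqP; split=> y.
  by move=> Ay; apply: (@path_in_connR _ _ A); apply: inE' => //; exact: hA.
move=> uy; apply: contrapT => nAy; apply: nuv.
have vy : connR E' v y.
  apply: (@path_in_connR _ _ (~` A)); apply: outE' => //; apply: hnA => //.
  exact: path_in_mono uy.
by apply: path_in_trans uy _; exact: path_in_sym.
Qed.

Lemma cut_le_finite E A k : cut_le E A k -> finite_set [set p | crossing E A p].
Proof.
move=> hk; apply: contrapT => /(@infinite_set_fset _ _ k.+1)[B BA kB].
have := hk (finmap.enum_fset B) (finmap.fset_uniq B).
rewrite leqNgt kB => /(_ _)/negP; case => // p pB; exact: BA.
Qed.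

Lemma eventually_finite (S : Type) (D : set S) (Q : S -> nat -> Prop) : finite_set D ->
  (forall s, D s -> exists m, forall n, (m <= n)%N -> Q s n) ->
  exists m, forall n, (m <= n)%N -> forall s, D s -> Q s n.
Proof.
elim/Pchoice: S => S in D Q *.
move=> /finite_seqP[l ->]; elim: l => [|a l ih] h; first by exists 0%N => n _ s.
have [m1 h1] := h a (mem_head _ _).
have [|m2 h2] := ih; first by move=> s sl; apply: h; rewrite /= inE sl orbT.
exists (maxn m1 m2) => n; rewrite geq_max => /andP[n1 n2] s; rewrite /= inE => /orP[/eqP ->|sl].
  exact: h1.
exact: h2.
Qed.

(** Unless [F] misses the connected set [A], every component left in it is adjacent to [F]. Local
    finiteness allows only finitely many of these, so one is infinite. *)
Lemma infinite_component E A F a : symmetric_graph E -> locally_finite E ->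
  infinite_set A -> (forall y, A y -> path_in E A a y) -> finite_set F ->
  exists z, (A `\` F) z /\ infinite_set [set y | path_in E (A `\` F) z y].
Proof.
move=> sE lE infA hA finF.
have infAF : infinite_set (A `\` F) by exact: infinite_setD.
have [y0 Ay0] := infinite_setN0 infA.
have Aa : A a := path_in_source (hA _ Ay0).
have [AF0|[b [Ab Fb]]] : A `&` F = set0 \/ exists b, A b /\ F b.
- have [h|/set0P[b]] := eqVneq (A `&` F) set0; first by left.
  by right; exists b.
- have EAF : A `\` F = A by rewrite setDE; apply/setIidPl; rewrite -disjoints_subset.
  exists a; rewrite EAF; split=> //.
  by apply: contra_not infA; apply: sub_finite_set.
apply: contrapT => h; apply: infAF.
apply: (@sub_finite_set _ _ (\bigcup_(z in (\bigcup_(f in F) [set z | E (f, z)]) `&` (A `\` F))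
   [set y | path_in E (A `\` F) z y])).
  move=> y [Ay nFy].
  have yb : path_in E A y b.
    by apply: (@path_in_trans _ _ _ a); [apply: path_in_sym => //|]; exact: hA.
  have [c [e [yc _ Fe _ ce]]] := path_in_cross yb (B := ~` F) nFy (fun n : (~` F) b => n Fb).
  have yc' : path_in E (A `\` F) y c by rewrite setDE.
  exists c; last by apply: path_in_sym => //.
  split; last exact: path_in_target yc'.
  by exists e; [exact: contrapT|exact: sE].
apply: bigcup_finite.
  apply: (@sub_finite_set _ _ (\bigcup_(f in F) [set z | E (f, z)])); first by move=> ? [].
  by apply: bigcup_finite => // f _; exact: lE.
by move=> z [_ Az]; apply: contrapT => inf; apply: h; exists z.
Qed.

(** Remove the finitely many ends in [A] of the crossing edges. If both sides were infinite, each
    would keep an infinite component; one-endedness joins the two by a path, which has to leave [A]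
    at a removed vertex. *)
Lemma one_ended_finite_side E u A k v : symmetric_graph E -> locally_finite E ->
  one_ended_at E u -> bond_at E u v A k ->
  finite_set A \/ finite_set (Defs.comp E u `\` A).
Proof.
move=> sE lE [_ oneE] [[uv Au nAv hA hnA] hk].
apply: contrapT => /not_orP[infA infnA].
pose F := [set a | exists b, crossing E A (a, b)].
have finF : finite_set F.
  apply: sub_finite_set (finite_image fst (cut_le_finite hk)) => a [b ab].
  by exists (a, b).
have AC : A `<=` Defs.comp E u by move=> y /hA h; exact: path_in_connR h.
have hnA' y : (Defs.comp E u `\` A) y -> path_in E (Defs.comp E u `\` A) v y.
  move=> [uy nAy]; have vy := hnA _ uy nAy.
  apply: path_in_mono (path_in_restrict vy) => // z vz; split.
    apply: (@path_in_cons _ _ _ _ v) => //; exact: path_in_connR vz.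
  exact: path_in_target vz.
have [z [[Az nFz] infz]] := infinite_component sE lE infA hA finF.
have [z' [[[Cz' nAz'] nFz'] infz']] := infinite_component sE lE infnA hnA' finF.
have AFC : A `\` F `<=` Defs.comp E u `\` F by move=> y [/AC].
have CAF : Defs.comp E u `\` A `\` F `<=` Defs.comp E u `\` F by move=> y [[? _]].
have zz' : path_in E (Defs.comp E u `\` F) z z'.
  apply: oneE => //; first exact: AFC.
  - by apply: contra_not infz; apply: sub_finite_set => y; exact: path_in_mono.
  - by apply: contra_not infz'; apply: sub_finite_set => y; exact: path_in_mono.
have [a [b [za Aa nAb _ ab]]] := path_in_cross zz' Az nAz'.
by have [[_ nFa] _] := path_in_target za; apply: nFa; exists b.
Qed.

End Bonds.

(** * Small bonds not resolved by the classes of [Gn n] *)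

Section Theta.
Context {T : choiceType}.
Variables (G : set (T * T)) (Gn : nat -> set (T * T)).
Hypothesis sG : symmetric_graph G.
Hypothesis lG : locally_finite G.
Hypothesis sGn : forall n, symmetric_graph (Gn n).
Hypothesis Gnmono : forall n, Gn n `<=` Gn n.+1.
Hypothesis GnG : \bigcup_n Gn n = G.
Implicit Types (A : set T).

Lemma Gn_sub n : Gn n `<=` G.
Proof. by rewrite -GnG => p h; exists n. Qed.

Lemma Gn_mono m n : (m <= n)%N -> Gn m `<=` Gn n.
Proof. by move=> /subnK <-; elim: (n - m)%N => //= i ih p /ih; exact: Gnmono. Qed.

Lemma connR_Gn x y : connR G x y -> exists m, forall n, (m <= n)%N -> connR (Gn n) x y.
Proof.
move: y; apply: path_in_ind => [_|y z _ [m hm]]; first by exists 0%N => n _; exact: connR_refl.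
rewrite -{1}GnG => -[i _ yz] _; exists (maxn m i) => n; rewrite geq_max => /andP[h1 h2].
by apply: path_in_rcons (hm n h1) _ _ => //; exact: Gn_mono yz.
Qed.

Definition frontier n x := exists y, G (x, y) /\ ~ connR (Gn n) x y.

(* In a one-ended graph every bond has a finite side, and each vertex lies on finitely many
   bonds of bounded size; hence every vertex eventually leaves [theta n k]. *)
Definition theta n k x := frontier n x \/ exists u v A, [/\ x = u \/ x = v, bond_at G u v A k,
  ~ (A `<=` Defs.comp (Gn n) u) & ~ (Defs.comp G u `\` A `<=` Defs.comp (Gn n) v)].

Lemma theta_vanish k x : (forall y, connR G x y -> one_ended_at G y) ->
  exists m, forall n, (m <= n)%N -> ~ theta n k x.
Proof.
move=> oneG.
have finC (u : T) (A : set T) : finite_set A -> (forall y, A y -> connR G u y) ->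
    exists m, forall n, (m <= n)%N -> A `<=` Defs.comp (Gn n) u.
  move=> finA hA; have [|m hm] := @eventually_finite _ A (fun y n => connR (Gn n) u y) finA.
    by move=> y /hA /connR_Gn.
  by exists m => n mn y; exact: hm.
have [m1 h1] := finC x _ (lG x) (fun y => @connR_edge _ _ _ _).
pose Q (t : T * T * set T) n := ~ [/\ ~ (t.2 `<=` Defs.comp (Gn n) t.1.1) &
   ~ (Defs.comp G t.1.1 `\` t.2 `<=` Defs.comp (Gn n) t.1.2)].
have one u v A : (x = u \/ x = v) -> bond_at G u v A k ->
    exists m, forall n, (m <= n)%N -> Q (u, v, A) n.
  move=> xuv hb; have [[uv Au nAv hA hnA] hk] := hb.
  have xu : connR G x u.
    by case: xuv => ->; [exact: connR_refl|apply/connR_edge/sG].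
  have [finA|finA] := one_ended_finite_side sG lG (oneG u xu) hb.
    have [y /hA h|m hm] := finC u A finA; first exact: path_in_connR h.
    by exists m => n /hm h [].
  have [y [uy /(hnA _ uy) h]|m hm] := finC v _ finA; first exact: path_in_connR h.
  by exists m => n /hm h [].
have [|t|m2 h2] := @eventually_finite _
  ((\bigcup_(v in [set v | G (x, v)]) (pair (x, v)) @` [set A | bond_at G x v A k]) `|`
   (\bigcup_(u in [set u | G (x, u)]) (pair (u, x)) @` [set A | bond_at G u x A k])) Q.
- rewrite finite_setU; split; apply: bigcup_finite => //= v _; apply: finite_image;
    exact: finite_bonds.
- by move=> [[v _ [A hA <-]]|[v _ [A hA <-]]]; apply: one => //; [left|right].
exists (maxn m1 m2) => n; rewrite geq_max => /andP[n1 n2].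
case=> [[y [xy]]|[u [v [A [xuv hb]]]] H1 H2]; first by apply; exact: h1.
have [[uv _ _ _ _] _] := hb.
apply: (h2 n n2 (u, v, A)) => //; case: xuv => E; subst.
  by left; exists v => //; exists A.
by right; exists u; [exact: sG|exists A].
Qed.

(** If an edge leaving the class at [u] or at [v] crosses [A], its ends are frontier vertices.
    Otherwise the cut is refined to a bond: [A0] is the component of [u] in [A], and [B] consists of
    [A0] and all that it cuts off from [v]. Every edge leaving [B] also leaves [A]. One side
    contains [u] and a neighbour outside its class, the other contains [v] and a neighbour outside
    its class, so neither side lies within one class. *)
Lemma cut_theta n k u v A : frontier n u -> frontier n v -> connR (Gn n) u v ->
  A u -> ~ A v -> cut_le G A k ->
  exists a b, [/\ crossing G A (a, b), theta n k a, theta n k b & connR G u a].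
Proof.
move=> fu fv uv Au nAv hk; apply: contrapT => none.
have [u' [uu' nuu']] := fu; have [v' [vv' nvv']] := fv.
have fr a b : G (a, b) -> ~ connR (Gn n) a b -> theta n k a /\ theta n k b.
  move=> ab nab; split; left; first by exists b.
  by exists a; split; [exact: sG|apply: contra_not nab; apply: path_in_sym].
have uvG : connR G u v by apply: path_in_mono uv => //; exact: Gn_sub.
have Au' : A u'.
  apply: contrapT => nA; apply: none; exists u, u'.
  by have [? ?] := fr _ _ uu' nuu'; split=> //; exact: connR_refl.
have nAv' : ~ A v'.
  move=> Av'; apply: none; exists v', v.
  have [? ?] := fr _ _ vv' nvv'; split=> //; first by split=> //; exact: sG.
  by apply: path_in_rcons uvG vv' _.
pose A0 := [set y | path_in G A u y].
have A0A : A0 `<=` A by move=> y h; exact: path_in_target h.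
pose Y := [set y | path_in G (~` A0) v y].
have YA0 y : Y y -> ~ A0 y by move=> h; exact: path_in_target h.
have vY : Y v by apply: path_in_refl => h; exact/nAv/A0A.
have Ystep a b : Y a -> G (a, b) -> ~ A0 b -> Y b by move=> Ya ab nb; exact: path_in_rcons Ya ab nb.
pose B := Defs.comp G u `\` Y.
have A0B : A0 `<=` B by move=> y A0y; split; [exact: path_in_connR A0y|move=> /YA0].
have uA0 : A0 u by exact: path_in_refl.
have BY a b : B a -> G (a, b) -> ~ B b -> [/\ A0 a, Y b & ~ A b].
  move=> [ua nYa] ab nBb.
  have Yb : Y b by apply: contrapT => nY; apply: nBb; split=> //; exact: path_in_rcons ua ab _.
  have A0a : A0 a by apply: contrapT => nA0; apply/nYa/(Ystep b) => //; exact: sG.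
  split=> // Ab; apply: (YA0 b Yb); exact: path_in_rcons A0a ab _.
have [a [b [_ Ba nBb _ ab]]] := path_in_cross uvG (A0B _ uA0) (fun h : B v => h.2 vY).
have [A0a Yb nAb] := BY _ _ Ba ab nBb.
have ua : connR G u a by exact: path_in_connR A0a.
have au : connR G a u by exact: path_in_sym.
have A0path y : A0 y -> path_in G B u y.
  by move=> A0y; apply: path_in_mono (path_in_restrict A0y).
have bond : bond_at G a b B k.
  split; first split=> //.
  - move=> y [uy nYy]; apply: (@path_in_trans _ _ _ u); first exact/path_in_sym/A0path.
    have [A0y|nA0y] := pselect (A0 y); first exact: A0path.
    have yu : connR G y u by exact: path_in_sym.
    have [c [e [yc _ A0e _ ce]]] := path_in_cross yu (B := ~` A0) nA0y (fun h => h uA0).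
    have {}A0e := contrapT A0e.
    apply: (@path_in_trans _ _ _ e); first exact: A0path.
    have yc' : path_in G B y c.
      apply: path_in_mono (path_in_restrict yc) => // z yz; split.
        by apply: path_in_trans uy _; exact: path_in_connR yz.
      move=> Yz; apply: nYy; apply: path_in_trans Yz _; apply: path_in_sym => //.
      by apply: path_in_mono yz => // ? [].
    apply: path_in_sym => //; apply: path_in_rcons yc' ce _; exact: A0B.
  - move=> y ay nBy.
    have Yy : Y y.
      by apply: contrapT => nY; apply: nBy; split=> //; exact: path_in_trans ua ay.
    have Ypath z : Y z -> path_in G (~` B) v z.
      by move=> Yz; apply: path_in_mono (path_in_restrict Yz) => // t Yt [_]; apply.
    by apply: (@path_in_trans _ _ _ v); [exact/path_in_sym/Ypath|exact: Ypath].
  - move=> s us hs; apply: hk us _ => -[p q] /hs[/= pq Bp nBq].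
    have [A0p _ nAq] := BY _ _ Bp pq nBq.
    by split=> //; exact: A0A.
have comp_bad x c c' : Defs.comp (Gn n) x c -> Defs.comp (Gn n) x c' -> connR (Gn n) c c'.
  by move=> xc xc'; apply: path_in_trans xc'; exact: path_in_sym.
have n1 : ~ (B `<=` Defs.comp (Gn n) a).
  move=> h; apply: nuu'; apply: (comp_bad a); apply/h/A0B => //.
  exact: path_in_edge.
have n2 : ~ (Defs.comp G a `\` B `<=` Defs.comp (Gn n) b).
  move=> h; apply: nvv'; apply: (comp_bad b); apply: h.
    split; first exact: path_in_trans au uvG.
    by move=> [_]; apply.
  split.
    by apply: path_in_trans au _; exact: path_in_rcons uvG vv' _.
  by move=> [_]; apply; apply: Ystep vY vv' _ => /A0A.
apply: none; exists a, b; split=> //.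
- by split=> //; exact: A0A.
- by right; exists a, b, B; split=> //; left.
- by right; exists a, b, B; split=> //; right.
Qed.

Lemma bond_atC u v A k : bond_at G u v A k -> bond_at G v u (Defs.comp G u `\` A) k.
Proof.
move=> [[uv Au nAv hA hnA] hk].
have inC y : path_in G (~` A) v y -> connR G u y.
  by move=> vy; apply: (@path_in_cons _ _ _ _ v) => //; exact: path_in_connR vy.
split; first split.
- exact: sG.
- by split=> //; exact: connR_edge.
- by case.
- move=> y [uy nAy]; apply: path_in_mono (path_in_restrict (hnA _ uy nAy)) => // z vz.
  by split; [exact: inC vz|exact: path_in_target vz].
- move=> y vy nBy.
  have uy : connR G u y by apply: (@path_in_cons _ _ _ _ v).
  have Ay : A y by apply: contrapT => nAy; apply: nBy.
  by apply: path_in_mono (hA _ Ay) => // z Az [].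
- move=> s us hs; have := hk [seq (p.2, p.1) | p <- s]; rewrite size_map; apply.
    by rewrite map_inj_uniq // => -[a b] [c e] [-> ->].
  move=> _ /mapP[[a b] /hs[/= ab [ua nAa] nb] ->]; split=> //=; first exact: sG.
  by apply: contrapT => nAb; apply: nb; split=> //; exact: path_in_rcons ua ab _.
Qed.

(** A bond is given by a list of its finite side, so that the quantifier ranges over lists of words
    once measurability is at stake. *)
Definition theta_fin n k x := frontier n x \/ exists u v (l : seq T), [/\ x = u \/ x = v,
  bond_at G u v [set` l] k,
  ~ ([set` l] `<=` Defs.comp (Gn n) u) & ~ (Defs.comp G u `\` [set` l] `<=` Defs.comp (Gn n) v)].

Lemma theta_finE n k x : (forall y, connR G x y -> one_ended_at G y) ->
  theta n k x <-> theta_fin n k x.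
Proof.
move=> oneG; split; last first.
  by case=> [h|[u [v [l hl]]]]; [left|right; exists u, v, [set` l]].
case=> [h|[u [v [A [xuv hb nA nC]]]]]; [by left|right].
have [[uv Au nAv hA hnA] hk] := hb.
have xu : connR G x u.
  by case: xuv => ->; [exact: connR_refl|apply/connR_edge/sG].
have AC : A `<=` Defs.comp G u by move=> y /hA h; exact: path_in_connR h.
have [/finite_seqP[l lA]|/finite_seqP[l lA]] := one_ended_finite_side sG lG (oneG u xu) hb.
  by exists u, v, l; rewrite -lA.
exists v, u, l; rewrite -lA.
have Cuv : Defs.comp G v = Defs.comp G u.
  apply/seteqP; split=> y h; first exact: path_in_cons uv h.
  by apply: path_in_cons h => //; exact: sG.
split; [tauto|exact: bond_atC hb|by []|].
by rewrite Cuv setDD; have -> : Defs.comp G u `&` A = A by exact/setIidPr.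
Qed.

(* The cut condition under which the local-ratio bound of [steiner_forest] applies: every cut
   is crossed by an edge with both ends in [Th], which costs nothing, or by many edges. *)
Definition well_linked (Th : set T) k M u v := forall l : seq T, (forall y, y \in l -> connR (Gn M) u y) ->
  u \in l -> v \notin l ->
  (exists a b, [/\ connR (Gn M) u a /\ connR (Gn M) u b, G (a, b), a \in l, b \notin l &
     Th a /\ Th b]) \/
  (exists s : seq (T * T), [/\ uniq s, (k < size s)%N &
     forall p, p \in s -> [/\ connR (Gn M) u p.1, connR (Gn M) u p.2, G p, p.1 \in l & p.2 \notin l]]).

(** By compactness: if bad cuts occur for arbitrarily large [M], their limit [A] along an
    ultrafilter separates [u] from [v]. It has at most [k] edges, since any larger finite set of its
    edges would cross one of the bad cuts simultaneously. Hence some edge of [A] has both ends in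
    [theta], so in [Th], and this edge crosses a bad cut as well. *)
Lemma well_linked_eventually (Th : set T) n k u v :
  frontier n u -> frontier n v -> connR (Gn n) u v ->
  (forall a, connR G u a -> theta n k a -> Th a) ->
  exists m, forall M, (m <= M)%N -> well_linked Th k M u v.
Proof.
move=> fu fv uv hTh; apply: contrapT => H.
have /choice[t ht] : forall m, exists Ml : nat * seq T, (m <= Ml.1)%N /\
  ~ ((forall y, y \in Ml.2 -> connR (Gn Ml.1) u y) -> u \in Ml.2 -> v \notin Ml.2 ->
  (exists a b, [/\ connR (Gn Ml.1) u a /\ connR (Gn Ml.1) u b, G (a, b), a \in Ml.2, b \notin Ml.2 &
     Th a /\ Th b]) \/
  (exists s : seq (T * T), [/\ uniq s, (k < size s)%N &
     forall p, p \in s -> [/\ connR (Gn Ml.1) u p.1, connR (Gn Ml.1) u p.2, G p,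
       p.1 \in Ml.2 & p.2 \notin Ml.2]])).
  move=> m; have /existsNP[M /not_implyP[mM /existsNP[l hl]]] := (forallNP _).2 H m.
  by exists (M, l).
have [U [Uu Uoo]] := ultraFilterLemma (F := \oo) _.
have Uev (S : set nat) (m : nat) : (forall j, (m <= j)%N -> S j) -> U S.
  by move=> h; apply: Uoo; exists m.
have UT : ~ U set0 by exact: filter_not_empty.
pose A := [set y | U [set j | y \in (t j).2]].
have nA y : ~ A y -> U [set j | y \notin (t j).2].
  move=> h; have [//|h'] := in_ultra_setVsetC [set j | y \in (t j).2] Uu.
  by apply: filterS h' => j /= /negP.
have inH y : connR G u y -> U [set j | connR (Gn (t j).1) u y].
  move=> /connR_Gn[m hm]; apply: (Uev _ m) => j mj; apply: hm.
  by apply: leq_trans mj _; case: (ht j).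
have hu j : u \in (t j).2.
  by apply: contrapT => h; have [_ []] := ht j => _ /h.
have hv j : v \notin (t j).2.
  by apply: contrapT => h; have [_ []] := ht j => _ _ /h.
have hl j y : y \in (t j).2 -> connR (Gn (t j).1) u y.
  by move=> hy; apply: contrapT => h; have [_ []] := ht j => h'; exfalso; exact/h/h'.
have Au : A u by apply: filterS filterT => j _; exact: hu.
have nAv : ~ A v.
  by move=> Av; apply: UT; apply: filterS Av => j /=; rewrite (negbTE (hv j)).
have AC y : A y -> connR G u y.
  move=> Ay; apply: contrapT => nuy; apply: UT; apply: filterS Ay => j /= /hl h.
  by apply: nuy; apply: path_in_mono h => //; exact: Gn_sub.
have edgeU a b : crossing G A (a, b) -> U [set j | [/\ connR (Gn (t j).1) u a,
    connR (Gn (t j).1) u b, a \in (t j).2 & b \notin (t j).2]].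
  move=> [/= ab Aa nAb]; have ua := AC _ Aa.
  have ub : connR G u b by exact: path_in_rcons ua ab _.
  apply: filterS (filterI (filterI (inH _ ua) (inH _ ub)) (filterI Aa (nA _ nAb))).
  by move=> j [[? ?] [? ?]].
have hk : cut_le G A k.
  move=> s us hs; rewrite leqNgt; apply/negP => ks.
  have : U [set j | forall p, p \in s -> [/\ connR (Gn (t j).1) u p.1,
      connR (Gn (t j).1) u p.2, G p, p.1 \in (t j).2 & p.2 \notin (t j).2]].
    elim: s {us ks} hs => [|p s ih] hs; first by apply: filterS filterT.
    have h1 := ih (fun q qs => hs q (@mem_behead _ (p :: s) _ qs)).
    have hp := hs p (mem_head _ _); have Gp : G p by case: hp.
    rewrite (surjective_pairing p) in hp.
    apply: filterS (filterI h1 (edgeU _ _ hp)) => j [h2 [? ? ? ?]] q.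
    by rewrite inE => /orP[/eqP ->|/h2].
  move=> /filter_ex[j hj]; have [_ []] := ht j => _ _ _; right; exists s; split=> //.
have [a [b [ab ta tb ua]]] := cut_theta fu fv uv Au nAv hk.
have /filter_ex[j [h1 h2 h3 h4]] := edgeU _ _ ab.
have [_ []] := ht j => _ _ _; left; exists a, b; have [Gab _ _] := ab; split=> //.
split; apply: hTh => //; exact: path_in_rcons ua Gab _.
Qed.

End Theta.

(** * Measurable selection on finite classes *)

Section MeasurableChoice.
Context {d : measure_display} {X : measurableType d}.

Lemma measurable_choice (I : countType) (i0 : I) (Q : I -> X -> Prop) :
  (forall i, mpred (Q i)) -> exists c : X -> I,
    (forall x, (exists i, Q i x) -> Q (c x) x) /\ forall i, mpred (fun x => c x = i).
Proof.
move=> mQ; pose Qn n x := exists2 i : I, unpickle n = Some i & Q i x.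
have mQn n : mpred (Qn n).
  rewrite /Qn; case: (unpickle n) => [i|].
    by apply: eq_mpred (mQ i) => x; split=> [h|[j [->]]]; first by exists i.
  by apply: eq_mpred (mpred_cst False) => x; split=> // -[].
pose least n x := Qn n x /\ forall m : nat, (m < n)%N -> ~ Qn m x.
have mleast n : mpred (least n).
  apply: mpredI => //; apply: mpred_all => m; apply: mpred_imp; first exact: mpred_cst.
  exact: mpredN.
have uniq n m x : least n x -> least m x -> n = m.
  move=> [h1 h2] [h3 h4]; apply/eqP; rewrite eqn_leq.
  apply/andP; split; rewrite leqNgt; apply/negP => lt; first exact: h2 lt h3.
  exact: h4 lt h1.
have ex_least x : (exists i, Q i x) -> exists n, least n x.
  move=> [i Qi]; have /asboolP ex : exists n, `[< Qn n x >].
    by exists (pickle i); apply/asboolP; exists i => //; rewrite pickleK.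
  move/asboolP: ex => ex; exists (ex_minn ex); case: ex_minnP => n /asboolP Qnx hn.
  by split=> // m mn /asboolP /hn; rewrite leqNgt mn.
have /choice[c hc] : forall x, exists i, ((exists n, least n x) ->
    exists2 n, least n x & unpickle n = Some i) /\ (~ (exists n, least n x) -> i = i0).
  move=> x; have [[n hn]|h] := pselect (exists n, least n x); last by exists i0.
  by have [[i ni Qi] _] := hn; exists i; split=> [_|h]; [exists n|case: h; exists n].
exists c; split.
  move=> x /ex_least h; have [/(_ h)[n [[i ni Qi] _] nc] _] := hc x.
  by move: nc; rewrite ni => -[<-].
move=> i; apply: (@eq_mpred _ _ (fun x => (exists n : nat, least n x /\ unpickle n = Some i) \/
    (~ (exists n : nat, least n x) /\ i0 = i))).
  move=> x; have [h1 h2] := hc x; split.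
    case=> [[n [ln ni]]|[h <-]]; last exact: h2.
    have [m lm mc] := h1 (ex_intro _ n ln).
    by move: mc; rewrite (uniq _ _ _ lm ln) ni => -[].
  move=> <-; have [h|h] := pselect (exists n, least n x).
    by have [m lm mc] := h1 h; left; exists m.
  by right; rewrite h2.
apply: mpredU.
  by apply: mpred_ex => n; apply: mpredI => //; exact: mpred_cst.
by apply: mpredI; [apply/mpredN/mpred_ex|exact: mpred_cst].
Qed.

Lemma measurable_fun_glue (d' : measure_display) (Y : measurableType d')
    (I : countType) (c : X -> I) (h : I -> X -> Y) :
  (forall i, mpred (fun x => c x = i)) -> (forall i, measurable_fun setT (h i)) ->
  measurable_fun setT (fun x => h (c x) x).
Proof.
move=> mc mh _ A mA; rewrite setTI.
have : mpred (fun x => exists i, c x = i /\ A (h i x)).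
  apply: mpred_ex => i; apply: mpredI => //.
  exact: (@mpred_comp _ _ _ _ A (h i)).
by congr measurable; apply/seteqP; split=> [x [i [<-]]|x]; last by exists (c x).
Qed.

Lemma measure_seq_bigcup (R : realType) (mu : {measure set X -> \bar R})
    (I : eqType) (s : seq I) (F : I -> set X) : uniq s ->
  (forall i, measurable (F i)) ->
  (forall i j, i \in s -> j \in s -> i <> j -> F i `&` F j = set0) ->
  (mu (\bigcup_(i in [set` s]) F i) = \sum_(i <- s) mu (F i))%E.
Proof.
move=> us mF; elim: s us => [|i s ih] /=; first by rewrite set_nil bigcup_set0 big_nil measure0.
move=> /andP[i_s us] dF; rewrite big_cons -ih //; last first.
  by move=> a b as_ bs; apply: dF; rewrite inE ?as_ ?bs orbT.
have -> : \bigcup_(j in [set` i :: s]) F j = F i `|` \bigcup_(j in [set` s]) F j.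
  apply/seteqP; split=> x; last by case=> [h|[j /= js h]]; [exists i|exists j] => //=; rewrite inE ?eqxx ?js ?orbT.
  by move=> [j /=]; rewrite inE => /orP[/eqP ->|js] h; [left|right; exists j].
rewrite measureU //.
  by apply: fin_bigcup_measurable => //; exact: finite_seq.
rewrite -subset0 => x [Fi [j /= js Fj]].
have : (F i `&` F j) x by [].
rewrite dF //; try exact: mem_head.
  by rewrite inE js orbT.
by move=> E; move: i_s; rewrite E js.
Qed.

End MeasurableChoice.

Lemma uniq_map_inj (T1 T2 : eqType) (h : T1 -> T2) (s : seq T1) :
  uniq (map h s) -> {in s &, injective h}.
Proof.
elim: s => //= a s ih /andP[as_ us] x y; rewrite !inE.
case/orP=> [/eqP ->|xs]; case/orP=> [/eqP ->|ys] // E.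
- by move: as_; rewrite E map_f.
- by move: as_; rewrite -E map_f.
- exact: ih.
Qed.

(** * Selections of small measure on finite classes *)

Section Selection.
Context {d : measure_display} {X : measurableType d} {R : realType}.
Variables (P : probability X R) (G : set (X * X)) (f : X -> R) (g : nat -> X -> X).
Hypothesis finj : injective f.
Hypothesis mf : measurable_fun setT f.
Hypothesis mg : forall n, measurable_fun setT (g n).
Hypothesis Gg : forall x y, G (x, y) -> exists n, y = g n x.
Hypothesis eqX : forall (d' : measure_display) (Y : measurableType d') (u v : Y -> X),
  measurable_fun setT u -> measurable_fun setT v -> mpred (fun x => u x = v x).
Variables (E : set (X * X)) (X0 : set X).
Hypothesis mE : measurable E.
Hypothesis sE : symmetric_graph E.
Hypothesis EG : E `<=` G.
Hypothesis mX0 : measurable X0.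
Hypothesis X0inv : forall x y, X0 x -> connR G x y -> X0 y.
Hypothesis finE : forall x, X0 x -> finite_set (Defs.comp E x).

Notation act := (act g).

Lemma mpred_connR (Y : measurableType d) (phi psi : Y -> X) :
  measurable_fun setT phi -> measurable_fun setT psi ->
  mpred (fun x => connR E (phi x) (psi x)).
Proof.
move=> mphi mpsi; apply: (@mpred_path _ _ G g mg Gg _ Y E (fun=> setT)) => //.
- by move=> u v; exact: eqX.
- by move=> w; exact: mpred_cst.
Qed.

Let mact w : measurable_fun setT (act w).
Proof. exact: measurable_act. Qed.

Lemma E_word x y : connR E x y -> exists w, y = act w x.
Proof. by move=> xy; apply: (connR_word Gg); exact: path_in_mono xy. Qed.

(** The point of least [f]-value in a finite class serves as its representative. *)
Lemma base_point : exists b : X -> X, [/\ measurable_fun setT b,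
  forall x, X0 x -> connR E x (b x) & forall x y, X0 x -> connR E x y -> b x = b y].
Proof.
pose Q w x := connR E x (act w x) /\ forall v, connR E x (act v x) -> f (act w x) <= f (act v x).
have mQ w : mpred (Q w).
  apply: mpredI; first exact: mpred_connR.
  apply: mpred_all => v; apply: mpred_imp; first exact: mpred_connR.
  have := measurable_fun_ler (measurableT_comp mf (mact w)) (measurableT_comp mf (mact v)).
  move=> /(_ measurableT [set true] I); rewrite setTI.
  by congr measurable; apply/seteqP; split=> x /=.
have [c [hc mc]] := measurable_choice [::] mQ.
exists (fun x => act (c x) x).
have Qc x : X0 x -> Q (c x) x.
  move=> X0x; apply: hc.
  have /finite_seqP[l hl] := finE X0x.
  have lP y : (y \in l) = `[< connR E x y >].
    have -> : connR E x y = (y \in l) by rewrite -[RHS]/([set` l] y) -hl.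
    by rewrite asboolb.
  have xl : x \in l by rewrite lP; apply/asboolP; exact: connR_refl.
  have [y yl ymin] : exists2 y, y \in l & forall z, z \in l -> f y <= f z.
    elim: (l) x xl {hl lP X0x} => // a s ih x _.
    case: s ih => [|a' s] ih; first by exists a; rewrite ?inE // => z; rewrite inE => /eqP ->.
    have [y ys hy] := ih a' (mem_head _ _).
    have [h|h] := lerP (f a) (f y).
      exists a; first exact: mem_head.
      by move=> z; rewrite inE => /orP[/eqP -> //|/hy]; exact: le_trans.
    exists y; first by rewrite inE ys orbT.
    by move=> z; rewrite inE => /orP[/eqP ->|/hy //]; exact: ltW.
  have /E_word[w yw] : connR E x y by apply/asboolP; rewrite -lP.
  exists w; rewrite /Q -yw; split; first by apply/asboolP; rewrite -lP.
  by move=> v xv; apply: ymin; rewrite lP; apply/asboolP.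
split.
- exact: (@measurable_fun_glue _ _ _ _ _ c act).
- by move=> x /Qc[].
- move=> x y X0x xy; have X0y : X0 y by apply: X0inv X0x _; exact: path_in_mono xy.
  have yx : connR E y x by exact: path_in_sym.
  have [h1 h2] := Qc x X0x; have [h3 h4] := Qc y X0y.
  have [v Ev] := E_word (path_in_trans xy h3).
  have [u Eu] := E_word (path_in_trans yx h1).
  have xv := path_in_trans xy h3; have yu := path_in_trans yx h1.
  rewrite Ev in xv; rewrite Eu in yu.
  have := h2 _ xv; have := h4 _ yu; rewrite -Ev -Eu => le1 le2.
  by apply: finj; apply/eqP; rewrite eq_le le1 le2.
Qed.

(* On the set where the isomorphism type of the class is fixed, the same selection is
   used everywhere; applying the weighted bound to the masses of the slices of that set
   makes the selection small in measure, without any Radon-Nikodym cocycle. *)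
Lemma selection (V : X -> set X -> Prop) (D : set X) (c : R) :
  measurable D -> 0 <= c ->
  (forall ws : seq (seq nat), mpred (fun x => V x [set` [seq act w x | w <- ws]])) ->
  (forall x A B, (forall y, connR E x y -> (A y <-> B y)) -> V x A -> V x B) ->
  (forall x (m : X -> R), X0 x -> (forall y, 0 <= m y) -> (forall y, ~ D y -> m y = 0) ->
    exists2 A, V x A & forall l : seq X, uniq l -> (forall y, y \in l <-> connR E x y) ->
      \sum_(y <- l | `[< A y >]) m y <= c * \sum_(y <- l) m y) ->
  exists I : set X, [/\ measurable I, (P (I `&` D) <= c%:E)%E &
    forall x, X0 x -> exists2 b, connR E x b & V b I].
Proof.
move=> mD c0 mV extV hV; have [b [mb hb bE]] := base_point.
(* A type records words that list the class, those sublists whose points satisfy [V], and the words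
   that lead into [D]. There are countably many types. *)
pose Ty := (seq (seq nat) * seq (seq (seq nat)) * seq (seq nat))%type.
pose pts (ws : seq (seq nat)) x := [seq act w x | w <- ws].
pose Q (t : Ty) x := [/\ uniq (pts t.1.1 x), forall w, connR E x (act w x) <-> act w x \in pts t.1.1 x,
  (forall vs, subseq vs t.1.1 -> (vs \in t.1.2 <-> V x [set` pts vs x])) &
  forall w, w \in t.1.1 -> (w \in t.2 <-> D (act w x))].
have mmem w (ws : seq (seq nat)) : mpred (fun x => act w x \in pts ws x).
  apply: (@eq_mpred _ _ (fun x => exists v, v \in ws /\ act w x = act v x)).
    move=> x; split=> [[v [vs ->]]|/mapP[v vs ->]]; last by exists v.
    exact: map_f.
  by apply: mpred_ex => v; apply: mpredI; [exact: mpred_cst|exact: eqX].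
have muniq (ws : seq (seq nat)) : mpred (fun x => uniq (pts ws x)).
  elim: ws => [|w ws ih] /=; first exact: mpred_cst.
  apply: (@eq_mpred _ _ (fun x => ~ (act w x \in pts ws x) /\ uniq (pts ws x))).
    by move=> x; split=> [[/negP -> ->]|/andP[/negP]].
  by apply: mpredI => //; exact: mpredN.
have mQ t : mpred (Q t).
  apply: (@eq_mpred _ _ (fun x => uniq (pts t.1.1 x) /\
    (forall w, connR E x (act w x) <-> act w x \in pts t.1.1 x) /\
    (forall vs, subseq vs t.1.1 -> (vs \in t.1.2 <-> V x [set` pts vs x])) /\
    (forall w, w \in t.1.1 -> (w \in t.2 <-> D (act w x))))).
    by move=> x; split=> [[? [? []]]|[]].
  apply: mpredI => //; apply: mpredI.
    by apply: mpred_all => w; apply: mpred_iff => //; exact: mpred_connR.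
  apply: mpredI; [apply: mpred_all => vs|apply: mpred_all => w]; apply: mpred_imp;
    try (exact: mpred_cst); apply: mpred_iff; try exact: mpred_cst; first exact: mV.
  exact: (@mpred_comp _ _ _ _ D (act w)).
have [tc [htc mtc]] := measurable_choice (([::], [::], [::]) : Ty) mQ.
have exQ x : X0 x -> Q (tc x) x.
  move=> X0x; apply: htc.
  have /finite_seqP[l hl] := finE X0x.
  have /choice[wd hwd] : forall y, exists w, connR E x y -> y = act w x.
    move=> y; have [/E_word[w ->]|n] := pselect (connR E x y); first by exists w.
    by exists [::].
  have lP y : y \in undup l <-> connR E x y.
    by rewrite mem_undup -/([set` l] y) -hl.
  pose ws := [seq wd y | y <- undup l].
  have Ews : pts ws x = undup l.
    rewrite /pts -map_comp -[RHS]map_id; apply/eq_in_map => y /lP /hwd E'.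
    by rewrite /= -E'.
  (* All sublists of [ws] are enumerated by Boolean masks. *)
  exists (ws, [seq vs <- map (fun m : (size ws).-tuple bool => mask m ws) (enum {: (size ws).-tuple bool}) | `[< V x [set` pts vs x] >]],
    [seq w <- ws | `[< D (act w x) >]]); split=> /=.
  - by rewrite Ews undup_uniq.
  - by move=> w; rewrite Ews; split=> /lP.
  - move=> vs /subseqP[m sm ->]; rewrite mem_filter; split=> [/andP[/asboolP]//|h].
    apply/andP; split; first exact/asboolP.
    apply/mapP; exists (Tuple (introT eqP sm)) => //; exact: mem_enum.
  - by move=> w wws; rewrite mem_filter wws andbT; split=> /asboolP.
pose slice (t : Ty) (w : seq nat) : set X := [set y | [/\ X0 y, tc (b y) = t & y = act w (b y)]].
have mslice t w : measurable (slice t w).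
  have : mpred (fun y => X0 y /\ (tc (b y) = t /\ y = act w (b y))).
    apply: mpredI => //; apply: mpredI; first exact: (@mpred_comp _ _ _ _ (fun x => tc x = t) b).
    by apply: eqX; [exact: measurable_id|exact: measurableT_comp].
  by congr measurable; apply/seteqP; split=> y; [case=> ? []|case].
pose Mw t w : R := fine (P (slice t w `&` D)).
have MwE t w : (P (slice t w `&` D) = (Mw t w)%:E)%E.
  rewrite fineK // fin_num_measure //; exact: measurableI.
have Mw0 t w : 0 <= Mw t w by exact: fine_ge0.
have bb y : X0 y -> b (b y) = b y by move=> X0y; exact/esym/bE/hb.
have X0b y : X0 y -> X0 (b y).
  by move=> X0y; apply: (X0inv X0y); exact: path_in_mono (hb _ X0y).
(* For each type a single sublist is fixed, found at an arbitrary base point of that type; the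
   weight of the point reached by [w] is the mass within [D] of the slice of [w]. The sublist
   satisfies [V] at every base point of the same type, since the type records this. *)
have /choice[sel hsel] : forall t : Ty, exists vs, (exists2 x, X0 x & b x = x /\ tc x = t) ->
    [/\ subseq vs t.1.1, vs \in t.1.2 & \sum_(w <- vs) Mw t w <= c * \sum_(w <- t.1.1) Mw t w].
  move=> t; have [[x X0x [bx tx]]|n] := pselect (exists2 x, X0 x & b x = x /\ tc x = t); last first.
    by exists [::].
  have [uws hws hvs hq] := exQ x X0x; rewrite tx in uws hws hvs hq.
  have inj := uniq_map_inj uws.
  have ut : uniq t.1.1 by exact: map_uniq uws.
  pose m y : R := \sum_(w <- t.1.1 | act w x == y) Mw t w.
  have mE' w : w \in t.1.1 -> m (act w x) = Mw t w.
    move=> wt; rewrite /m -big_filter.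
    rewrite (_ : [seq v <- t.1.1 | act v x == act w x] = [:: w]) ?big_seq1 //.
    rewrite -(filter_pred1_uniq ut wt); apply: eq_in_filter => v vt /=.
    by apply/eqP/eqP => [/inj ->|->].
  have [y|y nDy|A VA hA] := hV x m X0x.
  - by rewrite /m sumr_ge0.
  - rewrite /m big1_seq // => w /andP[/eqP yw wt].
    rewrite /Mw (_ : slice t w `&` D = set0) ?measure0 //.
    rewrite -subset0 => z [[X0z tz zw] Dz]; apply: nDy; rewrite -yw.
    have [_ _ _ hqz] := exQ _ (X0b _ X0z); rewrite tz in hqz.
    by apply/(hq w wt)/(hqz w wt); rewrite -zw.
  pose vs := [seq w <- t.1.1 | `[< A (act w x) >]].
  have svs : subseq vs t.1.1 by exact: filter_subseq.
  exists vs => _; split=> //.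
    apply/(hvs vs svs); apply: extV VA => y xy; have [w yw] := E_word xy.
    split=> [Ay|/mapP[v]]; last by rewrite mem_filter => /andP[/asboolP Av _] ->.
    have /hws/mapP[v vt yv] : connR E x (act w x) by rewrite -yw.
    rewrite yw yv; apply: map_f; rewrite mem_filter vt andbT; apply/asboolP.
    by rewrite -yv -yw.
  have -> : \sum_(w <- vs) Mw t w = \sum_(w <- t.1.1 | `[< A (act w x) >]) m (act w x).
    rewrite /vs big_filter big_seq_cond [RHS]big_seq_cond; apply: eq_bigr => w /andP[wt _].
    by rewrite mE'.
  have -> : \sum_(w <- t.1.1) Mw t w = \sum_(w <- t.1.1) m (act w x).
    by rewrite big_seq [RHS]big_seq; apply: eq_bigr => w wt; rewrite mE'.
  have := hA (pts t.1.1 x) uws; rewrite /pts !big_map; apply => y.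
  split=> [/mapP[w wt ->]|xy]; first by apply/hws; exact: map_f.
  by have [w yw] := E_word xy; rewrite yw; apply/hws; rewrite -yw.
pose I := [set y | exists w, [/\ X0 y, w \in sel (tc (b y)) & y = act w (b y)]].
have mI : measurable I.
  have : mpred (fun y => exists tw : Ty * seq nat, tw.2 \in sel tw.1 /\ slice tw.1 tw.2 y).
    by apply: mpred_ex => tw; apply: mpredI; [exact: mpred_cst|exact: mslice].
  congr measurable; apply/seteqP; split=> y.
    by move=> [[t w] /= [ws [X0y ty yw]]]; exists w; rewrite ty.
  by move=> [w [X0y ws yw]]; exists (tc (b y), w).
exists I; split=> //; last first.
  move=> x X0x; exists (b x); first exact: hb.
  have X0bx := X0b _ X0x; have [uws hws hvs _] := exQ _ X0bx.
  have [|svs vsv _] := hsel (tc (b x)); first by exists (b x) => //; split=> //; exact: bb.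
  have /(hvs _ svs) := vsv; apply: extV => y by_.
  have X0y : X0 y by apply: X0inv X0bx _; exact: path_in_mono by_.
  have Eb : b y = b x by rewrite -(bE _ _ X0bx by_) bb.
  split=> [/mapP[w ws yw]|[w [_ ws yw]]]; first by exists w; rewrite Eb.
  by rewrite Eb in ws yw; rewrite yw; exact: map_f.
pose An n : set X := if (pickle_inv n : option Ty) is Some t then
   [set y | X0 y /\ tc (b y) = t] else set0.
have mAn n : measurable (An n).
  rewrite /An; case: (pickle_inv n) => [t|]; last exact: measurable0.
  by apply: mpredI => //; exact: (@mpred_comp _ _ _ _ (fun x => tc x = t) b).
have An_pickle n y : An n y -> n = pickle (tc (b y)).
  rewrite /An; case En: (pickle_inv n) => [t|] // [_ ->].
  by have := @pickle_invK Ty n; rewrite En.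
have tAn : trivIset setT (fun n => An n `&` D).
  by apply/trivIsetP => i j _ _ /eqP ij; rewrite -subset0 => y
    [[/An_pickle Ei _] [/An_pickle Ej _]]; apply: ij; rewrite Ei.
have IA : I `&` D = \bigcup_n (I `&` (An n `&` D)).
  apply/seteqP; split=> [y [Iy Dy]|y [n _ [Iy [_ Dy]]]]; last by split.
  exists (pickle (tc (b y))) => //; split=> //; split=> //; rewrite /An pickleK_inv.
  by split=> //; case: Iy => w [].
have mAD n : measurable (An n `&` D) by exact: measurableI.
have step n : (P (I `&` (An n `&` D)) <= c%:E * P (An n `&` D))%E.
  rewrite /An; case En: (pickle_inv n) => [t|]; last by rewrite !set0I setI0 !measure0 mule0.
  have [[x X0x [bx tx]]|nt] := pselect (exists2 x, X0 x & b x = x /\ tc x = t); last first.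
    rewrite (_ : [set y | X0 y /\ tc (b y) = t] = set0) ?set0I ?setI0 ?measure0 ?mule0 //.
    rewrite -subset0 => y [X0y ty]; apply: nt; exists (b y); first exact: X0b.
    by split=> //; exact: bb.
  have [|svs vsv hsum] := hsel t; first by exists x.
  have [uws _ _ _] := exQ _ X0x; rewrite tx in uws.
  have ut : uniq t.1.1 by exact: map_uniq uws.
  have disj w w' : w \in t.1.1 -> w' \in t.1.1 -> w <> w' ->
      (slice t w `&` D) `&` (slice t w' `&` D) = set0.
    move=> wt wt' ww'; rewrite -subset0 => y [[[X0y ty yw] _] [[_ _ yw'] _]].
    have [uws' _ _ _] := exQ _ (X0b _ X0y); rewrite ty in uws'.
    by apply: ww'; apply: (uniq_map_inj uws') => //; rewrite -yw.
  have ge : (\sum_(w <- t.1.1) P (slice t w `&` D) <= P ([set y | X0 y /\ tc (b y) = t] `&` D))%E.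
    rewrite -(measure_seq_bigcup P ut _ disj); last by move=> w; exact: measurableI.
    apply: le_measure; rewrite ?inE.
    - by apply: fin_bigcup_measurable; [exact: finite_seq|move=> w _; exact: measurableI].
    - by have := mAD n; rewrite /An En.
    - by move=> y [w /= wt [[X0y ty yw] Dy]].
  have le : (P (I `&` ([set y | X0 y /\ tc (b y) = t] `&` D)) <= \sum_(w <- sel t) P (slice t w `&` D))%E.
    rewrite -(@measure_seq_bigcup _ _ _ P _ (sel t)).
    - apply: le_measure; rewrite ?inE.
      + by have := measurableI _ _ mI (mAD n); rewrite /An En.
      + by apply: fin_bigcup_measurable; [exact: finite_seq|move=> w _; exact: measurableI].
      + move=> y [[w [X0y ws yw]] [[_ ty] Dy]]; exists w; first by rewrite /= -ty.
        by split.
    - exact: subseq_uniq svs ut.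
    - by move=> w; exact: measurableI.
    - by move=> w w' ws ws'; apply: disj; exact: (mem_subseq svs).
  apply: (le_trans le); apply: (@le_trans _ _ (c%:E * \sum_(w <- t.1.1) P (slice t w `&` D))%E).
    under eq_bigr => w _ do rewrite MwE.
    under [X in (_ <= _ * X)%E]eq_bigr => w _ do rewrite MwE.
    by rewrite !sumEFin -EFinM lee_fin.
  by apply: lee_wpmul2l.
rewrite IA measure_bigcup //; last 2 first.
- by move=> n _; exact: measurableI.
- apply/trivIsetP => i j _ _ ij; move/trivIsetP: tAn => /(_ i j Logic.I Logic.I ij) h.
  by rewrite -subset0 -h => y [[_ ?] [_ ?]].
apply: (@le_trans _ _ (\sum_(n <oo) (c%:E * P (An n `&` D)))%E).
  rewrite [X in (X <= _)%E](_ : _ = \sum_(n <oo) P (I `&` (An n `&` D)))%E; last first.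
by apply: eq_eseriesl => n /=; rewrite in_setT.
  by apply: lee_nneseries => // n _; exact: step.
rewrite nneseriesZl //.
rewrite (_ : (\sum_(n <oo) P (An n `&` D))%E = P (\bigcup_n (An n `&` D))).
  rewrite -[leRHS]mule1; apply: lee_wpmul2l; rewrite ?lee_fin //.
  by apply: probability_le1; exact: bigcupT_measurable.
rewrite measure_bigcup //.
by apply: eq_eseriesl => n /=; rewrite in_setT.
Qed.

End Selection.

(** * Joining sets inside one finite class *)

Section SteinerClass.
Context {R : realFieldType} {T : choiceType}.
Variables (G : set (T * T)) (Th : set T) (Dm : T -> T -> Prop) (k dl : nat).
Hypothesis sG : symmetric_graph G.
Hypothesis sDm : forall u v, Dm u v -> Dm v u.
Hypothesis DmTh : forall u v, Dm u v -> Th u.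

Definition cut_linked (H : seq T) u v := forall l : seq T, (forall y, y \in l -> y \in H) ->
  u \in l -> v \notin l ->
  (exists a b, [/\ a \in H /\ b \in H, G (a, b), a \in l, b \notin l & Th a /\ Th b]) \/
  (exists s : seq (T * T), [/\ uniq s, (k < size s)%N &
     forall p, p \in s -> [/\ p.1 \in H, p.2 \in H, G p, p.1 \in l & p.2 \notin l]]).

(** Edges are weighted by the masses of their ends, those with both ends in [Th] being free, and [A]
    collects the ends of the other edges used by the forest. A point of [A] is paid for by an edge
    that starts at it, while all edges together weigh at most [2 * dl] times the total mass; with
    the approximation factor 2 this makes [4 * dl]. The denominator is [k.+1] because the cuts have
    more than [k] edges. *)
Lemma steiner_class (H : seq T) (m : T -> R) : uniq H ->
  (forall u v, u \in H -> v \in H -> Dm u v -> cut_linked H u v) ->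
  (forall y, 0 <= m y) ->
  (forall y, y \in H -> m y != 0 -> forall s : seq T, uniq s -> (forall z, z \in s -> G (y, z)) ->
     (size s <= dl)%N) ->
  exists2 A : set T, (forall u v, u \in H -> v \in H -> Dm u v ->
      path_in G ((Th `|` A) `&` [set` H]) u v) &
    \sum_(y <- H | `[< A y >]) m y <= (4 * dl%:R / k.+1%:R) * \sum_(y <- H) m y.
Proof.
move=> uH link m0 hdeg; pose S := seq_sub H.
pose e (u v : S) := `[< G (val u, val v) >].
pose dm (u v : S) := `[< Dm (val u) (val v) >].
pose fr (p : S * S) := `[< Th (val p.1) /\ Th (val p.2) >].
pose w (p : S * S) : R := if fr p then 0 else m (val p.1) + m (val p.2).
have esym : symmetric e by move=> u v; apply/asboolP/asboolP; exact: sG.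
have dmsym : symmetric dm by move=> u v; apply/asboolP/asboolP; exact: sDm.
have frsym p : fr (swap p) = fr p by apply/asboolP/asboolP => -[? ?]; split.
have w0 p : 0 <= w p by rewrite /w; case: ifP => // _; exact: addr_ge0.
have wsym p : w (swap p) = w p by rewrite /w frsym /= addrC.
have [A'|F [Fe Fs Fj Fw]] := @steiner_forest R S e dm k.+1 esym dmsym isT w w0 wsym.
  move=> [u [v [uA vA /asboolP uv]]].
  pose l := [seq val x | x <- enum A'].
  have lA x : (val x \in l) = (x \in A').
    by rewrite (mem_map val_inj) mem_enum.
  have [|||[a [b [[aH bH] ab al bl [ta tb]]]]|[s [us ks hs]]] := link _ _ (ssvalP u) (ssvalP v) uv l.
  - by move=> y /mapP[x _ ->]; exact: ssvalP.
  - by rewrite lA.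
  - by rewrite lA.
  - left; exists (SeqSub aH), (SeqSub bH); rewrite -!lA /=; split=> //.
    apply/andP; split; first exact/asboolP.
    by rewrite /w (_ : fr _) //; apply/asboolP.
  - right; apply: (leq_trans ks).
    pose h (p : S * S) := (val p.1, val p.2).
    rewrite cardE -(size_map h); apply: uniq_leq_size => // p ps.
    have [p1 p2 Gp pl pnl] := hs p ps.
    apply/mapP; exists (SeqSub p1, SeqSub p2); last by rewrite /h /= -surjective_pairing.
    rewrite mem_enum !inE /= -!lA /= pl pnl andbT; apply/andP; split=> //.
    by apply/asboolP; rewrite /= -surjective_pairing.
pose A : set T := [set y | exists2 p, p \in F & val p.1 = y /\ ~~ fr p].
exists A.
  move=> u v uH' vH' uv.
  have /Fj : dm (SeqSub uH') (SeqSub vH') by exact/asboolP.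
  move=> /connectP[s]; rewrite -[u]/(val (SeqSub uH')) -[v]/(val (SeqSub vH')).
  elim/last_ind: s (SeqSub vH') => [|s z ih] z' /=.
    by move=> _ ->; apply: path_in_refl; split=> //; left; exact: DmTh uv.
  rewrite rcons_path last_rcons => /andP[hs zF] ->.
  have {ih}ih := ih _ hs erefl; set y := last _ _ in ih zF.
  have ez : G (val y, val z).
    by have := fintype.subsetP Fe _ zF; rewrite inE => /asboolP.
  apply: (path_in_rcons ih ez).
  split; last exact: ssvalP.
  have [/asboolP[_ tz]|nfr] := boolP (fr (y, z)); first by left.
  right; exists (swap (y, z)); first by rewrite Fs.
  by rewrite frsym; split.
have sumS (h : T -> R) (Q : pred T) : \sum_(y <- H | Q y) h y = \sum_(x : S | Q (val x)) h (val x).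
  rewrite -(big_map val Q h); apply/perm_big; apply: uniq_perm => //.
    by rewrite (map_inj_uniq val_inj) index_enum_uniq.
  move=> y; apply/idP/mapP => [yH|[x _ ->]]; last exact: ssvalP.
  by exists (SeqSub yH); rewrite ?mem_index_enum.
have k0 : 0 < k.+1%:R :> R by rewrite ltr0n.
rewrite mulrAC ler_pdivlMr // [leLHS]mulrC.
apply: (@le_trans _ _ (k.+1%:R * \sum_(p in F) w p)).
  rewrite ler_wpM2l ?ler0n // sumS.
  rewrite [leRHS](partition_big (fun p : S * S => p.1) xpredT) //=.
  rewrite big_mkcond /=; apply: ler_sum => x _.
  case: asboolP => [[p pF [px nfr]]|_]; last by rewrite sumr_ge0.
  rewrite (bigD1 p) /=; last by rewrite pF; apply/eqP/val_inj.
  rewrite -px /w (negbTE nfr) -addrA lerDl addr_ge0 // sumr_ge0 // => q _; exact: w0.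
apply: (le_trans Fw).
have -> : 4 * dl%:R * (\sum_(y <- H) m y) = 2 * (2 * (dl%:R * \sum_(y <- H) m y)) by ring.
rewrite ler_wpM2l ?ler0n //.
apply: (@le_trans _ _ (\sum_(p in edges e) (m (val p.1) + m (val p.2)))).
  apply: ler_sum => p _; rewrite /w; case: ifP => // _; exact: addr_ge0.
rewrite big_split /=.
have -> : \sum_(p in edges e) m (val p.2) = \sum_(p in edges e) m (val p.1).
  rewrite (reindex_inj (inv_inj (@swapK S))) /=; apply: eq_bigl => p.
  exact: edges_sym.
rewrite -mulr2n -[leLHS]mulr_natl ler_wpM2l ?ler0n // (sumS m xpredT) mulr_sumr.
rewrite (partition_big (fun p : S * S => p.1) xpredT) //=; apply: ler_sum => x _.
have -> : \sum_(p in edges e | p.1 == x) m (val p.1) =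
    #|[set p in edges e | p.1 == x]|%:R * m (val x).
  rewrite -sum1_card natr_sum mulr_suml [LHS]big_mkcond [RHS]big_mkcond /=.
  by apply: eq_bigr => p _; rewrite [in RHS]inE; case: ifP => // /andP[_ /eqP ->]; rewrite mul1r.
have [->|mx] := eqVneq (m (val x)) 0; first by rewrite !mulr0.
rewrite ler_wpM2r // ler_nat.
have := hdeg _ (ssvalP x) mx [seq val p.2 | p <- enum [set p in edges e | p.1 == x]].
rewrite size_map -cardE; apply.
  rewrite map_inj_in_uniq ?enum_uniq // => p q; rewrite !mem_enum !inE.
  move=> /andP[_ /eqP p1] /andP[_ /eqP q1] /val_inj p2.
  by rewrite (surjective_pairing p) (surjective_pairing q) p1 q1 p2.
move=> z /mapP[p]; rewrite mem_enum !inE => /andP[/asboolP pe /eqP <-] -> //.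
Qed.

End SteinerClass.

(** * Measurability of combinatorial predicates *)

Section WordQuantifiers.
Context {d : measure_display} {X : measurableType d}.
Variables (G : set (X * X)) (g : nat -> X -> X).
Hypothesis mG : measurable G.
Hypothesis sG : symmetric_graph G.
Hypothesis mg : forall n, measurable_fun setT (g n).
Hypothesis gG : forall n x, g n x = x \/ G (x, g n x).
Hypothesis Gg : forall x y, G (x, y) -> exists n, y = g n x.
Hypothesis eqX : forall (d' : measure_display) (Y : measurableType d') (u v : Y -> X),
  measurable_fun setT u -> measurable_fun setT v -> mpred (fun x => u x = v x).

Notation act := (act g).
(** Finite subsets of a component are lists of words evaluated at one point, so quantifiers over
    them are countable. *)
Definition pts (ws : seq (seq nat)) (x : X) : seq X := [seq act w x | w <- ws].
Definition pts2 (ws : seq (seq nat * seq nat)) (x : X) : seq (X * X) :=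
  [seq (act w.1 x, act w.2 x) | w <- ws].

Lemma seq_word x (l : seq X) : (forall y, y \in l -> connR G x y) -> exists ws, l = pts ws x.
Proof.
elim: l => [|y l ih] h; first by exists [::].
have [w yw] := connR_word Gg (h y (mem_head _ _)).
have [|ws lw] := ih; first by move=> z zl; apply: h; rewrite inE zl orbT.
by exists (w :: ws); rewrite lw /pts /= -yw.
Qed.

Lemma seq_word2 x (l : seq (X * X)) :
  (forall p, p \in l -> connR G x p.1 /\ connR G x p.2) -> exists ws, l = pts2 ws x.
Proof.
elim: l => [|[y z] l ih] h; first by exists [::].
have [/= /(connR_word Gg)[w yw] /(connR_word Gg)[v zv]] := h _ (mem_head _ _).
have [|ws lw] := ih; first by move=> p pl; apply: h; rewrite inE pl orbT.
by exists ((w, v) :: ws); rewrite lw /pts2 /= -yw -zv.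
Qed.

Lemma pts_connR ws x y : y \in pts ws x -> connR G x y.
Proof. by move=> /mapP[w _ ->]; exact: connR_act. Qed.

Lemma mpred_seq_all (Q : X -> seq X -> Prop) :
  (forall ws, mpred (fun x => Q x (pts ws x))) ->
  mpred (fun x => forall l, (forall y, y \in l -> connR G x y) -> Q x l).
Proof.
move=> mQ; apply: eq_mpred (mpred_all mQ) => x; split=> h; last first.
  by move=> ws; apply: h => y; exact: pts_connR.
by move=> l /seq_word[ws ->].
Qed.

Lemma mpred_seq_ex (Q : X -> seq X -> Prop) :
  (forall ws, mpred (fun x => Q x (pts ws x))) ->
  mpred (fun x => exists l, (forall y, y \in l -> connR G x y) /\ Q x l).
Proof.
move=> mQ; apply: eq_mpred (mpred_ex mQ) => x; split.
  by move=> [ws h]; exists (pts ws x); split=> // y; exact: pts_connR.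
by move=> [l [/seq_word[ws ->]]]; exists ws.
Qed.

Lemma mpred_seq2_all (Q : X -> seq (X * X) -> Prop) :
  (forall ws, mpred (fun x => Q x (pts2 ws x))) ->
  mpred (fun x => forall l, (forall p, p \in l -> connR G x p.1 /\ connR G x p.2) -> Q x l).
Proof.
move=> mQ; apply: eq_mpred (mpred_all mQ) => x; split=> h; last first.
  by move=> ws; apply: h => y /mapP[w _ ->]; split; exact: connR_act.
by move=> l /seq_word2[ws ->].
Qed.

Lemma mpred_seq2_ex (Q : X -> seq (X * X) -> Prop) :
  (forall ws, mpred (fun x => Q x (pts2 ws x))) ->
  mpred (fun x => exists l, (forall p, p \in l -> connR G x p.1 /\ connR G x p.2) /\ Q x l).
Proof.
move=> mQ; apply: eq_mpred (mpred_ex mQ) => x; split.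
  by move=> [ws h]; exists (pts2 ws x); split=> // y /mapP[w _ ->]; split; exact: connR_act.
by move=> [l [/seq_word2[ws ->]]]; exists ws.
Qed.

Lemma mpred_mem (Z : eqType) (I : eqType) (z : X -> Z) (h : I -> X -> Z) (s : seq I) :
  (forall i, mpred (fun x => z x = h i x)) -> mpred (fun x => z x \in [seq h i x | i <- s]).
Proof.
move=> mz; elim: s => [|i s ih] /=; first exact: (mpred_cst false).
apply: (@eq_mpred _ _ (fun x => z x = h i x \/ z x \in [seq h i x | i <- s])).
  move=> x; rewrite inE; split=> [[->|->]|/orP[/eqP|]]; rewrite ?eqxx ?orbT //; tauto.
exact: mpredU.
Qed.

Lemma mpred_uniq (Z : eqType) (I : eqType) (h : I -> X -> Z) (s : seq I) :
  (forall i j, mpred (fun x => h i x = h j x)) -> mpred (fun x => uniq [seq h i x | i <- s]).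
Proof.
move=> mh; elim: s => [|i s ih] /=; first exact: (mpred_cst true).
apply: (@eq_mpred _ _ (fun x => ~ (h i x \in [seq h i x | i <- s]) /\ uniq [seq h i x | i <- s])).
  by move=> x; split=> [[/negP -> ->]|/andP[/negP]].
by apply: mpredI => //; apply/mpredN/mpred_mem.
Qed.

Lemma mact w : measurable_fun setT (act w).
Proof. exact: measurable_act. Qed.

Lemma mpred_pts u ws : mpred (fun x => act u x \in pts ws x).
Proof. by apply: mpred_mem => w; apply: eqX; exact: mact. Qed.

Lemma mpred_uniq_pts ws : mpred (fun x => uniq (pts ws x)).
Proof. by apply: mpred_uniq => w v; apply: eqX; exact: mact. Qed.

Lemma mpred_uniq_pts2 ws : mpred (fun x => uniq (pts2 ws x)).
Proof.
apply: mpred_uniq => -[a b] [a' b'].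
apply: (@eq_mpred _ _ (fun x => act a x = act a' x /\ act b x = act b' x)).
  by move=> x /=; split=> [[-> ->]|[]].
by apply: mpredI; apply: eqX; exact: mact.
Qed.

Lemma mpred_act_rel (E : set (X * X)) u v : measurable E -> mpred (fun x => E (act u x, act v x)).
Proof. by move=> mE; apply: mpred_rel => //; exact: mact. Qed.

Lemma mpred_act_set (A : set X) u : measurable A -> mpred (fun x => A (act u x)).
Proof. by move=> mA; apply: (@mpred_comp _ _ _ _ A (act u)) => //; exact: mact. Qed.

Lemma mpred_act_connR (E : set (X * X)) u v : measurable E -> E `<=` G ->
  mpred (fun x => connR E (act u x) (act v x)).
Proof.
move=> mE EG; apply: (@mpred_connR _ _ G g mg Gg _ E) => //; exact: mact.
Qed.

Lemma mpred_act_path (A : X -> set X) u v :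
  (forall w, mpred (fun x => A x (act w x))) ->
  mpred (fun x => path_in G (A x) (act u x) (act v x)).
Proof.
move=> mA; apply: (@mpred_path _ _ G g mg Gg _ X G A) => //; try exact: mact.
- by move=> *; exact: eqX.
- move=> w; have := mA (u ++ w); apply: eq_mpred => x; by rewrite act_cat.
Qed.

Lemma mpred_all_pts (Q : X -> X -> Prop) ws : (forall w, mpred (fun x => Q x (act w x))) ->
  mpred (fun x => forall y, y \in pts ws x -> Q x y).
Proof.
move=> mQ; apply: (@eq_mpred _ _ (fun x => forall w, w \in ws -> Q x (act w x))).
  move=> x; split=> [h y /mapP[w ww ->]|h w ww]; first exact: h.
  by apply: h; exact: map_f.
by apply: mpred_all => w; apply: mpred_imp => //; exact: mpred_cst.
Qed.

Lemma mpred_all_pts2 (Q : X -> X * X -> Prop) ws :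
  (forall w, mpred (fun x => Q x (act w.1 x, act w.2 x))) ->
  mpred (fun x => forall p, p \in pts2 ws x -> Q x p).
Proof.
move=> mQ; apply: (@eq_mpred _ _ (fun x => forall w, w \in ws -> Q x (act w.1 x, act w.2 x))).
  move=> x; split=> [h y /mapP[w ww ->]|h w ww]; first exact: h.
  by apply: h; apply/mapP; exists w.
by apply: mpred_all => w; apply: mpred_imp => //; exact: mpred_cst.
Qed.

Lemma mpred_comp_all (Q : X -> X -> Prop) : (forall w, mpred (fun x => Q x (act w x))) ->
  mpred (fun x => forall y, connR G x y -> Q x y).
Proof. exact: (@mpred_connR_all _ _ G g gG Gg _ _ Q id). Qed.

Lemma mpred_comp_ex (Q : X -> X -> Prop) : (forall w, mpred (fun x => Q x (act w x))) ->
  mpred (fun x => exists y, connR G x y /\ Q x y).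
Proof. exact: (@mpred_connR_ex _ _ G g gG Gg _ _ Q id). Qed.

Lemma mpred_bond u v ws (k : nat) :
  mpred (fun x => bond_at G (act u x) (act v x) [set` pts ws x] k).
Proof.
have cc x w y : connR G (act w x) y <-> connR G x y.
  split; first by apply: path_in_trans; exact: connR_act.
  by apply: path_in_trans; apply: path_in_sym => //; exact: connR_act.
apply: (@eq_mpred _ _ (fun x => (G (act u x, act v x) /\ act u x \in pts ws x) /\
  (~ (act v x \in pts ws x) /\ ((forall y, y \in pts ws x -> path_in G [set` pts ws x] (act u x) y) /\
  (forall y, connR G x y -> ~ (y \in pts ws x) -> path_in G (~` [set` pts ws x]) (act v x) y))) /\
  forall s : seq (X * X), (forall p, p \in s -> connR G x p.1 /\ connR G x p.2) -> uniq s ->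
    (forall p, p \in s -> crossing G [set` pts ws x] p) -> (size s <= k)%N)).
  move=> x; split.
    move=> [[uv us] [[vs [hA hnA]] hk]]; split.
      by split=> // y /cc; exact: hnA.
    move=> s us' hs; apply: hk => // -[a b] /hs[/= ab /pts_connR xa _].
    by split=> //; exact: path_in_rcons xa ab _.
  move=> [[uv us vs hA hnA] hk]; split=> //; split.
    by split=> //; split=> // y xy; apply: hnA; exact/cc.
  by move=> s _; exact: hk.
apply: mpredI; first by apply: mpredI; [exact: mpred_act_rel|exact: mpred_pts].
apply: mpredI.
  apply: mpredI; first exact/mpredN/mpred_pts.
  apply: mpredI.
    apply: mpred_all_pts => w; apply: mpred_act_path => w'; exact: mpred_pts.
  apply: mpred_comp_all => w; apply: mpred_imp; first exact/mpredN/mpred_pts.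
  by apply: mpred_act_path => w'; exact/mpredN/mpred_pts.
apply: mpred_seq2_all => qs; apply: mpred_imp; first exact: mpred_uniq_pts2.
apply: mpred_imp; last by rewrite /pts2; under eq_fun do rewrite size_map; exact: mpred_cst.
apply: mpred_all_pts2 => w.
apply: (@eq_mpred _ _ (fun x => G (act w.1 x, act w.2 x) /\ (act w.1 x \in pts ws x /\
   ~ (act w.2 x \in pts ws x)))); first by move=> x; split=> [[? []]|[]].
by apply: mpredI; [exact: mpred_act_rel|apply: mpredI; [exact: mpred_pts|exact/mpredN/mpred_pts]].
Qed.

End WordQuantifiers.

(** * Small connected sets *)

Section SmallConnectedSets.
Context {d : measure_display} {X : measurableType d} {R : realType}.
Variables (P : probability X R) (G : set (X * X)) (f : X -> R) (g : nat -> X -> X).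
Hypothesis finj : injective f.
Hypothesis mf : measurable_fun setT f.
Hypothesis mG : measurable G.
Hypothesis sG : symmetric_graph G.
Hypothesis lG : locally_finite G.
Hypothesis mg : forall n, measurable_fun setT (g n).
Hypothesis gG : forall n x, g n x = x \/ G (x, g n x).
Hypothesis Gg : forall x y, G (x, y) -> exists n, y = g n x.
Hypothesis eqX : forall (d' : measure_display) (Y : measurableType d') (u v : Y -> X),
  measurable_fun setT u -> measurable_fun setT v -> mpred (fun x => u x = v x).
Variables (Gn : nat -> set (X * X)) (X0 : set X).
Hypothesis mGn : forall n, measurable (Gn n).
Hypothesis sGn : forall n, symmetric_graph (Gn n).
Hypothesis Gnmono : forall n, Gn n `<=` Gn n.+1.
Hypothesis GnG : \bigcup_n Gn n = G.
Hypothesis mX0 : measurable X0.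
Hypothesis X0inv : forall x y, X0 x -> connR G x y -> X0 y.
Hypothesis X0null : P.-negligible (~` X0).
Hypothesis oneG : forall x, X0 x -> one_ended_at G x.
Hypothesis finGn : forall n x, X0 x -> finite_set (Defs.comp (Gn n) x).

Notation act := (act g).
Notation pts := (pts g).
Notation frontier := (frontier G Gn).

Let GnsubG n : Gn n `<=` G.
Proof. exact: Gn_sub. Qed.

Lemma mpred_frontier n w : mpred (fun x => frontier n (act w x)).
Proof.
apply: (@eq_mpred _ _ (fun x => exists y, connR G x y /\ (G (act w x, y) /\ ~ connR (Gn n) (act w x) y))).
  move=> x; split=> [[y [_ [? ?]]]|[y [wy nwy]]]; exists y => //; split=> //.
  exact: (path_in_rcons (connR_act gG w x) wy I).
apply: (mpred_comp_ex gG Gg (Q := fun x y => G (act w x, y) /\ ~ connR (Gn n) (act w x) y)) => v.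
apply: mpredI; first exact: mpred_act_rel.
by apply: mpredN; exact: (mpred_act_connR mg Gg eqX).
Qed.

Let oneG' x : X0 x -> forall y, connR G x y -> one_ended_at G y.
Proof. by move=> X0x y xy; apply: oneG; exact: X0inv xy. Qed.

Let mconn n u v : mpred (fun x => connR (Gn n) (act u x) (act v x)).
Proof. exact: (mpred_act_connR mg Gg eqX u v (mGn n) (@GnsubG n)). Qed.

Let mbnd u v ws k : mpred (fun x => bond_at G (act u x) (act v x) [set` pts ws x] k).
Proof. exact: (mpred_bond mG sG mg gG Gg eqX). Qed.

(** On [X0] every bond of bounded size has a finite side, so [theta] agrees with [theta_fin] there;
    measurability is obtained in this way. *)
Definition TH n k := [set x | X0 x /\ theta G Gn n k x].

Let mX0' w : mpred (fun x => X0 (act w x)).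
Proof. exact: mpred_act_set. Qed.

Lemma measurable_TH n k : measurable (TH n k).
Proof.
pose Q3 x u v (l : seq X) := (x = u \/ x = v) /\ (bond_at G u v [set` l] k /\
  (~ (forall y, y \in l -> connR (Gn n) u y) /\
   ~ (forall y, connR G x y -> ~ (y \in l) -> connR (Gn n) v y))).
pose Q2 x u v := exists l : seq X, (forall y, y \in l -> connR G x y) /\ Q3 x u v l.
pose Q1 x u := exists v, connR G x v /\ Q2 x u v.
apply: (@eq_mpred _ _ (fun x => X0 x /\ (frontier n x \/ exists u, connR G x u /\ Q1 x u))).
  move=> x; split=> -[X0x hx]; split=> //.
    apply/(theta_finE Gn sG lG n k (oneG' X0x)).
    case: hx => [h|[u [xu [v [xv [l [xl [xuv [hb [n1 n2]]]]]]]]]]; first by left.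
    right; exists u, v, l; split=> //; apply: contra_not n2 => n2.
    move=> y xy yl; apply: n2; split=> //; apply: path_in_trans xy; exact: path_in_sym.
  have /(theta_finE Gn sG lG n k (oneG' X0x)) [h|[u [v [l [xuv hb n1 n2]]]]] := hx; first by left.
  have [[uv _ _ hA _] _] := hb.
  have xu : connR G x u.
    by case: xuv => ->; [exact: connR_refl|apply/connR_edge/sG].
  right; exists u; split=> //; exists v; split; first exact: path_in_rcons xu uv _.
  exists l; split.
    by move=> y /hA h; apply: path_in_trans xu _; exact: path_in_connR h.
  split=> //; split=> //; split=> //; apply: contra_not n2 => n2.
  by move=> y [uy yl]; apply: n2 => //; exact: path_in_trans xu uy.
apply: mpredI => //; apply: mpredU; first exact: (mpred_frontier n [::]).
apply: (mpred_comp_ex gG Gg) => u; apply: (mpred_comp_ex gG Gg) => v.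
apply: (mpred_seq_ex gG Gg) => ws.
apply: mpredI; first by apply: mpredU; apply: (eqX (mact mg [::])); exact: mact.
apply: mpredI; first exact: mbnd.
apply: mpredI; apply: mpredN.
  by apply: (mpred_all_pts (Q := fun x y => connR (Gn n) (act u x) y)) => w; exact: mconn.
apply: (mpred_comp_all gG Gg) => w; apply: mpred_imp; last exact: mconn.
by apply: mpredN; exact: mpred_pts.
Qed.

Notation linked n k M := (well_linked G Gn (TH n k) k M).

Lemma mpred_linked n k M a b : mpred (fun x => linked n k M (act a x) (act b x)).
Proof.
pose Q1 x (l : seq X) := exists p, connR G x p /\ exists q, connR G x q /\
  ((connR (Gn M) (act a x) p /\ connR (Gn M) (act a x) q) /\ (G (p, q) /\
  ((p \in l /\ ~ (q \in l)) /\ (TH n k p /\ TH n k q)))).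
pose Q2 (x : X) (l : seq X) := exists s : seq (X * X),
  (forall p, p \in s -> connR G x p.1 /\ connR G x p.2) /\ (uniq s /\ ((k < size s)%N /\
    forall p, p \in s -> connR (Gn M) (act a x) p.1 /\ (connR (Gn M) (act a x) p.2 /\
      (G (p.1, p.2) /\ (p.1 \in l /\ ~ (p.2 \in l)))))).
have ax x y : connR (Gn M) (act a x) y -> connR G x y.
  move=> h; apply: (@path_in_trans _ _ _ (act a x)); first exact: connR_act.
  by apply: path_in_mono h.
apply: (@eq_mpred _ _ (fun x : X => forall l : seq X, (forall y, y \in l -> connR G x y) ->
   (forall y, y \in l -> connR (Gn M) (act a x) y) -> act a x \in l -> ~ (act b x \in l) ->
   Q1 x l \/ Q2 x l)).
  move=> x; split=> h l hl.
    move=> hl' /negP al.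
    have [[p [xp [q [xq [[ap aq] [pq [[pl ql] [tp tq]]]]]]]]|[s [xs [us [ks hs]]]]] :=
      h l (fun y yl => ax _ _ (hl y yl)) hl hl' al.
    - by left; exists p, q; split=> //; exact/negP.
    - right; exists s; split=> // p /hs[h1 [h2 [h3 [h4 h5]]]]; split=> //; last exact/negP.
      by rewrite (surjective_pairing p).
  move=> hl' al /negP bl.
  have [[p [q [[ap aq] pq pl /negP ql [tp tq]]]]|[s [us ks hs]]] := h l hl' al bl.
    by left; exists p; split; [exact: ax|exists q; split; [exact: ax|]].
  right; exists s; split; first by move=> p /hs[/ax ? /ax ? _ _ _].
  split=> //; split=> // p /hs[h1 h2 h3 h4 /negP h5]; split=> //; split=> //; split=> //.
  by rewrite -surjective_pairing.
apply: (mpred_seq_all gG Gg) => ws; apply: mpred_imp.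
  by apply: (mpred_all_pts (Q := fun x y => connR (Gn M) (act a x) y)) => w; exact: mconn.
apply: mpred_imp; first exact: mpred_pts.
apply: mpred_imp; first by apply: mpredN; exact: mpred_pts.
apply: mpredU.
  apply: (mpred_comp_ex gG Gg) => p; apply: (mpred_comp_ex gG Gg) => q.
  apply: mpredI; first by apply: mpredI; exact: mconn.
  apply: mpredI; first exact: mpred_act_rel.
  apply: mpredI; first by apply: mpredI; [exact: mpred_pts|apply: mpredN; exact: mpred_pts].
  by apply: mpredI; apply: mpred_act_set => //; exact: measurable_TH.
apply: (mpred_seq2_ex gG Gg) => qs.
apply: mpredI; first exact: mpred_uniq_pts2.
apply: mpredI; first by rewrite /pts2; under eq_fun do rewrite size_map; exact: mpred_cst.
apply: (mpred_all_pts2 (Q := fun x p => connR (Gn M) (act a x) p.1 /\ (connR (Gn M) (act a x) p.2 /\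
      (G (p.1, p.2) /\ (p.1 \in pts ws x /\ ~ (p.2 \in pts ws x)))))) => w /=.
apply: mpredI; first exact: mconn.
apply: mpredI; first exact: mconn.
apply: mpredI; first exact: mpred_act_rel.
by apply: mpredI; [exact: mpred_pts|apply: mpredN; exact: mpred_pts].
Qed.

(** The cut condition is built into the demand, in both directions, so that the Steiner bound
    applies to every demand and the relation is symmetric. Frontier pairs of a class that fail it
    are dealt with by [bad]. *)
Definition demand n k M u v := [/\ frontier n u /\ frontier n v, connR (Gn n) u v, X0 u,
  linked n k M u v & linked n k M v u].

Lemma demand_sym n k M u v : demand n k M u v -> demand n k M v u.
Proof.
move=> [[fu fv] uv X0u h1 h2]; split=> //; first exact: path_in_sym.
by apply: X0inv X0u _; apply: path_in_mono uv.
Qed.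

Lemma mpred_demand n k M a b : mpred (fun x => demand n k M (act a x) (act b x)).
Proof.
apply: (@eq_mpred _ _ (fun x => (frontier n (act a x) /\ frontier n (act b x)) /\
  (connR (Gn n) (act a x) (act b x) /\ (X0 (act a x) /\ (linked n k M (act a x) (act b x) /\
  linked n k M (act b x) (act a x)))))).
  by move=> x; split=> [[? [? [? []]]]|[]].
apply: mpredI; first by apply: mpredI; exact: mpred_frontier.
apply: mpredI; first exact: mconn.
by apply: mpredI => //; apply: mpredI; exact: mpred_linked.
Qed.

(** Whole classes are taken: a class of [Gn n] is connected, so including it joins all its frontier
    vertices at once. *)
Definition bad n k M := [set x | exists u v, [/\ connR (Gn n) x u, connR (Gn n) x v,
  frontier n u, frontier n v & ~ demand n k M u v]].

Lemma measurable_bad n k M : measurable (bad n k M).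
Proof.
pose Q1 x u v := (connR (Gn n) x u /\ connR (Gn n) x v) /\ ((frontier n u /\ frontier n v) /\ ~ demand n k M u v).
apply: (@eq_mpred _ _ (fun x => exists u, connR G x u /\ exists v, connR G x v /\ Q1 x u v)).
  move=> x; split; first by move=> [u [_ [v [_ [[? ?] [[? ?] ?]]]]]]; exists u, v.
  move=> [u [v [xu xv fu fv nd]]]; exists u; split; first by apply: path_in_mono xu.
  by exists v; split; first by apply: path_in_mono xv.
apply: (mpred_comp_ex gG Gg) => u; apply: (mpred_comp_ex gG Gg) => v.
apply: mpredI; first by apply: mpredI; exact: (mconn n [::]).
apply: mpredI; first by apply: mpredI; exact: mpred_frontier.
by apply: mpredN; exact: mpred_demand.
Qed.

Lemma bad_vanish n k x : X0 x -> exists m, forall M, (m <= M)%N -> ~ bad n k M x.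
Proof.
move=> X0x.
have [||m hm] := @eventually_finite _ (Defs.comp (Gn n) x `*` Defs.comp (Gn n) x)
   (fun p M => frontier n p.1 -> frontier n p.2 -> demand n k M p.1 p.2).
- by apply: finite_setX; exact: finGn.
- move=> [u v] [/= xu xv].
  have X0u : X0 u by apply: X0inv X0x _; apply: path_in_mono xu.
  have X0v : X0 v by apply: X0inv X0x _; apply: path_in_mono xv.
  have [fu|nfu] := pselect (frontier n u); last by exists 0%N.
  have [fv|nfv] := pselect (frontier n v); last by exists 0%N.
  have uv : connR (Gn n) u v by apply: path_in_trans xv; exact: path_in_sym.
  have th y : X0 y -> forall a, connR G y a -> theta G Gn n k a -> TH n k a.
    by move=> X0y a ya ta; split=> //; exact: X0inv ya.
  have [m1 h1] := well_linked_eventually sG sGn Gnmono GnG fu fv uv (th u X0u).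
  have [m2 h2] := well_linked_eventually sG sGn Gnmono GnG fv fu (path_in_sym (@sGn n) uv) (th v X0v).
  exists (maxn m1 m2) => M; rewrite geq_max => /andP[M1 M2] _ _.
  by split=> //; [exact: h1|exact: h2].
- exists m => M mM [u [v [xu xv fu fv]]]; apply; exact: (hm M mM (u, v)).
Qed.

Definition degree_le (dl : nat) := [set y : X | forall s : seq X, uniq s ->
  (forall z, z \in s -> G (y, z)) -> (size s <= dl)%N].

Lemma measurable_degree_le dl : measurable (degree_le dl).
Proof.
apply: (@eq_mpred _ _ (fun x => forall s : seq X, (forall z, z \in s -> connR G x z) -> uniq s ->
  (forall z, z \in s -> G (x, z)) -> (size s <= dl)%N)).
  by move=> x; split=> [h s us hs|h s _]; [apply: h => // z zs; apply/connR_edge/hs|exact: h].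
apply: (mpred_seq_all gG Gg) => ws; apply: mpred_imp; first exact: mpred_uniq_pts.
apply: mpred_imp; last by rewrite /pts; under eq_fun do rewrite size_map; exact: mpred_cst.
by apply: (mpred_all_pts (Q := fun x z => G (x, z))) => w; exact: (@mpred_act_rel _ _ g mg G [::]).
Qed.

Lemma degree_le_eventually x : exists m, forall dl, (m <= dl)%N -> degree_le dl x.
Proof.
have /finite_seqP[l hl] := lG x.
exists (size l) => dl ldl s us hs; apply: leq_trans ldl; apply: uniq_leq_size => // z /hs Gxz.
by have : [set` l] z by rewrite -hl.
Qed.

(** The selection is made on the classes of [Gn M], for masses carried by [degree_le dl];
    [steiner_class] asks for the degree bound only at points of nonzero mass. *)
Lemma connecting_set n k M dl : (n <= M)%N -> exists I : set X, [/\ measurable I,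
  (P (I `&` degree_le dl) <= (4 * dl%:R / k.+1%:R)%:E)%E &
  forall u v, demand n k M u v -> path_in G (TH n k `|` I) u v].
Proof.
move=> nM.
pose V x A := forall u, connR (Gn M) x u -> forall v, connR (Gn M) x v -> demand n k M u v ->
  path_in G ((TH n k `|` A) `&` Defs.comp (Gn M) x) u v.
have [|||||I [mI PI hI]] := @selection _ _ _ P G f g finj mf mg Gg eqX (Gn M) X0 (mGn M)
  (@sGn M) (@GnsubG M) mX0 X0inv (@finGn M) V (degree_le dl) (4 * dl%:R / k.+1%:R).
- exact: measurable_degree_le.
- by rewrite divr_ge0 ?mulr_ge0 ?ler0n.
- move=> ws.
  apply: (@eq_mpred _ _ (fun x => forall u, connR G x u -> connR (Gn M) x u -> forall v, connR G x v ->
     connR (Gn M) x v -> demand n k M u v ->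
     path_in G ((TH n k `|` [set` pts ws x]) `&` Defs.comp (Gn M) x) u v)).
    move=> x; split=> h u xu; last by move=> *; exact: h.
    by move=> v xv; apply: h => //; [apply: path_in_mono xu|apply: path_in_mono xv].
  have c0 w : mpred (fun x => connR (Gn M) x (act w x)).
    exact: (mconn M [::]).
  apply: (mpred_comp_all gG Gg) => u; apply: mpred_imp => //.
  apply: (mpred_comp_all gG Gg) => v; apply: mpred_imp => //.
  apply: mpred_imp; first exact: mpred_demand.
  apply: mpred_act_path => // w; apply: mpredI => //; apply: mpredU; last exact: mpred_pts.
  by apply: mpred_act_set => //; exact: measurable_TH.
- move=> x A B AB VA u xu v xv uv; apply: path_in_mono (VA u xu v xv uv) => // y [[ty|Ay] xy].
    by split=> //; left.
  by split=> //; right; exact/AB.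
- move=> x m X0x m0 mD.
  have /finite_seqP[l hl] := finGn M X0x.
  have lP y : y \in undup l <-> connR (Gn M) x y.
    by rewrite mem_undup -/([set` l] y) -hl.
  have [||||A hA sA] := @steiner_class R X G (TH n k) (demand n k M) k dl sG
     (@demand_sym n k M) _ (undup l) m (undup_uniq l).
  + by move=> u v [[fu fv] _ X0u _ _]; split=> //; left.
  + move=> u v /lP xu /lP xv [_ _ _ + _] s sl us vs.
    have ux : connR (Gn M) u x by exact: path_in_sym.
    have xuy y : connR (Gn M) u y -> y \in undup l by move=> uy; apply/lP; exact: path_in_trans xu uy.
    move=> /(_ s)[||//|[a [b [[ua ub] ab as_ bs tab]]]|[q [uq kq hq]]] //.
    * by move=> y /sl /lP xy; exact: path_in_trans ux xy.
    * by left; exists a, b; split=> //; split; exact: xuy.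
    * right; exists q; split=> // p /hq[/xuy ? /xuy ? ? ? ?]; split=> //.
  + exact: m0.
  + move=> y _ my s us hs; apply: contrapT => ns.
    by move/eqP: my; apply; apply: mD => /(_ s us hs).
  exists A.
    move=> u xu v xv uv; have := hA u v ((lP _).2 xu) ((lP _).2 xv) uv.
    by apply: path_in_mono => // y [? /lP].
  move=> l' ul' l'P.
  have pl : perm_eq l' (undup l).
    apply: uniq_perm => //; first exact: undup_uniq.
    by move=> y; apply/idP/idP => [/l'P/lP|/lP/l'P].
  by rewrite (perm_big _ pl) [X in _ * X](perm_big _ pl).
exists I; split=> // u v uv; have [_ uv' X0u _ _] := uv.
have [b ub hb] := hI u X0u.
have bu := path_in_sym (@sGn M) ub.
have : path_in G ((TH n k `|` I) `&` Defs.comp (Gn M) b) u v.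
  apply: hb => //; apply: path_in_trans bu _; apply: path_in_mono uv' => //.
  exact: Gn_mono.
by apply: path_in_mono => // y [].
Qed.

(** A path in [G] passes from one class of [Gn n] to another along an edge whose ends are both
    frontier vertices. Its stretch inside each class is replaced by a path in [W]. *)
Lemma frontier_connected n (W : set X) : (forall x, frontier n x -> X0 x -> W x) ->
  (forall u v, X0 u -> connR (Gn n) u v -> frontier n u -> frontier n v -> path_in G W u v) ->
  forall b c, X0 b -> frontier n b -> frontier n c -> connR G b c -> path_in G W b c.
Proof.
move=> fW hW b c X0b fb fc bc.
suff H y : connR G b y -> forall c, frontier n c -> connR (Gn n) y c -> path_in G W b c.
  by apply: H bc _ fc _; exact: connR_refl.
move: y; apply: path_in_ind => [_ e fe be|y z byc ih yz _ e fe ze]; first exact: hW.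
have X0y := X0inv X0b byc.
have [yzn|nyz] := pselect (connR (Gn n) y z).
  by apply: ih => //; exact: path_in_trans yzn ze.
have fy : frontier n y by exists z.
have fz : frontier n z.
  by exists y; split; [exact: sG|apply: contra_not nyz => h; exact: path_in_sym].
have X0z : X0 z by apply: X0inv X0y _; exact: connR_edge.
apply: (@path_in_trans _ _ _ z).
  apply: (path_in_rcons (ih _ fy (connR_refl _ _)) yz); exact: fW.
exact: hW.
Qed.

(** The set is covered by four sets of measure below [e / 4]: [TH n k], the joining set on the
    vertices of degree at most [dl], the vertices of larger degree, and [bad n k M]. The order of
    the choices is forced: [k] depends on [dl], [n] on [k], and [M] on both [n] and [k]. *)
Lemma small_connected_set (e : R) : 0 < e -> exists n (W : set X), [/\ measurable W, (P W < e%:E)%E, (forall x, X0 x -> frontier n x -> W x) &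
  forall x y, W x -> W y -> connR G x y -> X0 x /\ path_in G W x y].
Proof.
move=> e0; have e4 : 0 < e / 4 by rewrite divr_gt0.
have [dl hdl] := prob_eventually_small (P := P) (B := fun dl => ~` degree_le dl)
   (fun dl => measurableC (measurable_degree_le dl)) (negligible_set0 P)
   (fun x _ => let: ex_intro m hm := degree_le_eventually x in
      ex_intro _ m (fun n mn H => H (hm n mn))) e4.
have {}hdl := hdl dl (leqnn dl).
have [k hk] : exists k : nat, 4 * dl%:R / k.+1%:R < e / 4.
  (* [dl.+1] keeps the divisor positive when [dl] is zero. *)
  have [k hk] := @ltr_add_invr R 0 (e / 4 / (4 * dl.+1%:R)) ltac:(by rewrite divr_gt0 // mulr_gt0 ?ltr0n).
  exists k; rewrite add0r in hk; apply: (@le_lt_trans _ _ (4 * dl.+1%:R / k.+1%:R)).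
    by rewrite ler_wpM2r ?invr_ge0 ?ler0n // ler_wpM2l ?ler0n // ler_nat.
  by rewrite mulrC -ltr_pdivlMr ?mulr_gt0 ?ltr0n.
have [n hn] := prob_eventually_small (P := P) (B := fun n => TH n k)
   (fun n => measurable_TH n k) X0null
   (fun x nx => let: ex_intro m hm := theta_vanish sG lG Gnmono GnG k (oneG' (contrapT nx)) in
      ex_intro _ m (fun n mn H => hm n mn (proj2 H))) e4.
have hTH := hn n (leqnn n).
have [M1 hM1] := prob_eventually_small (P := P) (B := fun M => bad n k M)
   (fun M => measurable_bad n k M) X0null
   (fun x nx => bad_vanish n k (contrapT nx)) e4.
pose M := maxn n M1.
have hbad := hM1 M (leq_maxr _ _).
have [I [mI PI hI]] := @connecting_set n k M dl (leq_maxl _ _).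
pose W0 := (TH n k `|` I) `|` bad n k M.
have mW0 : measurable W0.
  apply: measurableU; [apply: measurableU => //; exact: measurable_TH|exact: measurable_bad].
have PW0 : (P W0 < e%:E)%E.
  have PI' : (P I <= P (I `&` degree_le dl) + P (~` degree_le dl))%E.
    apply: (@le_trans _ _ (P ((I `&` degree_le dl) `|` ~` degree_le dl))).
      apply: le_measure; rewrite ?inE //.
        by apply: measurableU; [apply: measurableI => //|apply: measurableC]; exact: measurable_degree_le.
      by move=> x Ix; have [h|h] := pselect (degree_le dl x); [left|right].
    apply: measureU2; [apply: measurableI => //|apply: measurableC]; exact: measurable_degree_le.
  apply: (@le_lt_trans _ _ (P (TH n k) + (P (I `&` degree_le dl) + P (~` degree_le dl)) + P (bad n k M))%E).
    apply: (@le_trans _ _ (P (TH n k `|` I) + P (bad n k M))%E).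
      apply: measureU2; last exact: measurable_bad.
      by apply: measurableU => //; exact: measurable_TH.
    rewrite leeD2r //; apply: (@le_trans _ _ (P (TH n k) + P I)%E); last by rewrite leeD2l.
    by apply: measureU2 => //; exact: measurable_TH.
  have -> : e%:E = ((e/4)%:E + ((e/4)%:E + (e/4)%:E) + (e/4)%:E)%E.
    by rewrite -!EFinD; congr EFin; field.
  apply: lteD => //; apply: lteD => //; apply: lteD => //.
  by apply: le_lt_trans PI _; rewrite lte_fin.
(* Pieces of [W0] that do not reach the frontier could be separate components, so they are
   dropped. *)
pose W := [set y | W0 y /\ exists b, connR G y b /\ (X0 b /\ (frontier n b /\ path_in G W0 y b))].
have mW : measurable W.
  apply: mpredI => //; apply: (mpred_comp_ex gG Gg (Q := fun y b => X0 b /\ (frontier n b /\ path_in G W0 y b))) => w.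
  apply: mpredI => //; apply: mpredI; first exact: mpred_frontier.
  by apply: (@mpred_act_path _ _ G g mG mg Gg eqX (fun=> W0) [::]) => v; exact: mpred_act_set.
have fW0 x : frontier n x -> X0 x -> W0 x by move=> fx X0x; left; left; split=> //; left.
have fW x : X0 x -> frontier n x -> W x.
  move=> X0x fx; split; first exact: fW0.
  by exists x; split; [exact: connR_refl|split=> //; split=> //; apply: path_in_refl; exact: fW0].
have dW0 u v : X0 u -> connR (Gn n) u v -> frontier n u -> frontier n v -> path_in G W0 u v.
  move=> X0u uv fu fv; have [du|ndu] := pselect (demand n k M u v).
    by apply: path_in_mono (hI u v du) => // y h; left.
  have bu : forall y, connR (Gn n) u y -> W0 y.
    move=> y uy; right; exists u, v; split=> //; first exact: path_in_sym.
    by apply: path_in_trans uv; exact: path_in_sym.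
  by apply: path_in_mono (path_in_restrict uv).
have W0W x y : W x -> path_in G W0 x y -> W y.
  move=> [_ [b [xb [X0b [fb xbW]]]]] xy; split; first exact: path_in_target xy.
  have yx := path_in_sym sG xy; exists b; split.
    by apply: path_in_trans xb; exact: path_in_connR yx.
  by split=> //; split=> //; exact: path_in_trans yx xbW.
exists n, W; split=> //.
  by apply: le_lt_trans PW0; apply: le_measure; rewrite ?inE // => y [].
move=> x y Wx Wy xy; have [_ [b [xb [X0b [fb xbW]]]]] := Wx.
have [_ [c [yc [X0c [fc ycW]]]]] := Wy.
split; first by apply: X0inv X0b _; exact: path_in_sym.
have bc : connR G b c.
  by apply: path_in_trans yc; apply: path_in_trans xy; exact: path_in_sym.
have bcW : path_in G W0 b c by exact: (frontier_connected fW0 dW0).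
have xyW : path_in G W0 x y.
  apply: path_in_trans xbW _; apply: path_in_trans bcW _; exact: path_in_sym.
by apply: path_in_mono (path_in_restrict xyW) => // z; exact: W0W.
Qed.

End SmallConnectedSets.

(** * Trees generated by a function *)

Section FunctionTree.
Context {T : choiceType}.
Variables (G : set (T * T)) (X1 : set T) (s : T -> T).
Hypothesis sG : symmetric_graph G.
Hypothesis X1inv : forall x y, X1 x -> connR G x y -> X1 y.
Hypothesis sE : forall x, X1 x -> G (x, s x).
Hypothesis aper : forall x n, X1 x -> iter n.+1 s x <> x.
Hypothesis back_fin : forall y, X1 y -> finite_set [set x | X1 x /\ exists n, iter n s x = y].
Hypothesis merge : forall x y, X1 x -> G (x, y) -> exists i j, iter i s x = iter j s y.

Definition function_graph := [set p : T * T | X1 p.1 /\ X1 p.2 /\ (p.2 = s p.1 \/ p.1 = s p.2)].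
Notation Tr := function_graph.

Let X1s x : X1 x -> X1 (s x).
Proof. by move=> X1x; apply: (X1inv X1x); exact/connR_edge/sE. Qed.

Lemma function_graph_sym : symmetric_graph Tr.
Proof. by move=> x y [/= ? [? [?|?]]]; split=> //; split=> //; [right|left]. Qed.

Lemma function_graph_sub : Tr `<=` G.
Proof. by move=> [x y] [/= X1x [X1y [->|->]]]; [exact: sE|apply: sG; exact: sE]. Qed.

Let X1iter n x : X1 x -> X1 (iter n s x).
Proof. by move=> X1x; elim: n => // n ih; rewrite iterS; exact: X1s. Qed.

Let edge_s x : X1 x -> Tr (x, s x).
Proof. by move=> X1x; split=> //; split; [exact: X1s|left]. Qed.

Lemma path_iter (A : set T) n x : X1 x -> (forall m, (m <= n)%N -> A (iter m s x)) ->
  path_in Tr A x (iter n s x).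
Proof.
move=> X1x; elim: n => [|n ih] hA; first by apply: path_in_refl; exact: (hA 0%N).
apply: path_in_rcons (ih _) _ _; [by move=> m mn; apply/hA/leqW| |exact: hA].
exact: edge_s (X1iter n X1x).
Qed.

Lemma iter_injective x : X1 x -> injective (fun n => iter n s x).
Proof.
move=> X1x; suff H i k : iter (i + k.+1) s x <> iter i s x.
  move=> i j /= ij; case: (ltngtP i j) => // h; exfalso.
    by apply: (H i (j - i).-1); rewrite -[RHS]/(iter i s x) ij; congr iter; lia.
  by apply: (H j (i - j).-1); rewrite -ij; congr iter; lia.
by rewrite addnC iterD; apply: aper; exact: X1iter.
Qed.

(** If one edge of a cycle points forward along [s], so does the preceding one, since otherwise both
    neighbours of the vertex between them would be its image under [s]. Going round, either all
    edges point forward or all point backward, and in both cases [s] has a periodic point. *)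
Lemma function_graph_acyclic : acyclic Tr.
Proof.
split=> [x [/= X1x [_ [|]]] /esym h|n v n3 vinj [vE vl]]; try exact: (aper (n := 0) X1x).
pose w i := v (i %% n)%N.
have n0 : (0 < n)%N by lia.
have wE i : Tr (w i, w i.+1).
  have im : (i %% n < n)%N by rewrite ltn_mod.
  have e : (i.+1 %% n)%N = if ((i %% n).+1 == n)%N then 0%N else (i %% n).+1.
    by rewrite -addn1 -modnDml addn1; case: eqP => [->|ne]; [rewrite modnn|rewrite modn_small //; lia].
  rewrite /w e; case: eqP => [e1|ne]; last by apply: vE; lia.
  by have -> : (i %% n)%N = n.-1 by lia.
have X1w i : X1 (w i) by have [] := wE i.
have wn i : w (i + n)%N = w i by rewrite /w modnDr.
have wback i : w i <> w i.+2.
  move=> h; have := vinj (i %% n)%N (i.+2 %% n)%N; rewrite !ltn_mod => /(_ n0 n0 h).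
  rewrite -addn2 -modnDml; have : (i %% n < n)%N by rewrite ltn_mod.
  move: (i %% n)%N => m mn h'; have [l|l] := leqP n (m + 2)%N.
    have e : (m + 2 = m + 2 - n + n)%N by lia.
    by move: h'; rewrite e modnDr modn_small; lia.
  by move: h'; rewrite modn_small; lia.
have fwd i : w i.+2 = s (w i.+1) -> w i.+1 = s (w i).
  move=> h; have [_ [_ /= [//|h']]] := wE i.
  by have := wback i; rewrite h' h.
have [[i hi]|h] := pselect (exists i, w i.+1 = s (w i)).
  have down j k : w (j + k).+1 = s (w (j + k)%N) -> w j.+1 = s (w j).
    by elim: k => [|k ih]; [rewrite addn0|rewrite addnS => /fwd].
  have hk k : w (i + k * n)%N = w i by elim: k => [|k ih]; rewrite ?addn0 // mulSn addnCA addnC wn.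
  have hk' k : w (i + k * n).+1 = w i.+1 by elim: k => [|k ih]; rewrite ?addn0 // mulSn addnCA addnC -addSn wn.
  have all j : w j.+1 = s (w j).
    apply: (down j (i + j * n - j)%N).
    have -> : (j + (i + j * n - j) = i + j * n)%N by nia.
    by rewrite hk hk'.
  have e m : iter m s (w 0%N) = w m by elim: m => //= m ->.
  by apply: (aper (n := n.-1) (X1w 0%N)); rewrite prednK // e -[n in LHS]add0n wn.
have all j : w j = s (w j.+1).
  by have [_ [_ /= [h'|//]]] := wE j; case: h; exists j.
have H m : iter m s (w m) = w 0%N by elim: m => // m ih; rewrite iterSr -all.
apply: (aper (n := n.-1) (X1w 0%N)); rewrite prednK // -[RHS](H n); congr iter.
by rewrite -[n in RHS]add0n wn.
Qed.

Lemma merge_connected x y : X1 x -> connR G x y -> exists i j, iter i s x = iter j s y.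
Proof.
move=> X1x; move: y; apply: path_in_ind => [_|y z xy [i [j ij]] yz _]; first by exists 0%N, 0%N.
have [k [l kl]] := merge (X1inv X1x xy) yz.
by exists (k + i)%N, (j + l)%N; rewrite iterD ij -iterD addnC iterD kl -iterD.
Qed.

Lemma path_merge (A : set T) x y : X1 x -> connR G x y ->
  (forall n, A (iter n s x)) -> (forall n, A (iter n s y)) -> path_in Tr A x y.
Proof.
move=> X1x xy Ax Ay; have [i [j ij]] := merge_connected X1x xy.
apply: (@path_in_trans _ _ _ (iter i s x)); first by apply: path_iter => // m _; exact: Ax.
rewrite ij; apply: (path_in_sym function_graph_sym); apply: path_iter.
  exact: X1inv xy.
by move=> m _; exact: Ay.
Qed.

Lemma comp_function_graph x : X1 x -> Defs.comp Tr x = Defs.comp G x.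
Proof.
move=> X1x; apply/seteqP; split=> y; first by apply: path_in_mono => //; exact: function_graph_sub.
by move=> xy; apply: path_merge.
Qed.

(** Only finitely many points have a forward orbit that meets a finite set [F]. An infinite
    component off [F] therefore contains a point whose forward orbit avoids [F], and two such orbits
    merge. *)
Lemma function_graph_one_ended x : X1 x -> one_ended_at Tr x.
Proof.
move=> X1x; have orbit n y : X1 y -> connR Tr y (iter n s y) by move=> X1y; exact: path_iter.
split.
  exists set0; split; first exact: finite_set0.
  exists x; split; first by split=> //; exact: connR_refl.
  move=> h; apply: infinite_nat.
  have := finite_preimage (f := fun n => iter n s x) (in2W (iter_injective X1x)) h.
  apply: sub_finite_set => n _ /=; apply: path_iter => // m _.
  by split=> //; exact: orbit.
have cG u : connR Tr x u -> connR G x u by apply: path_in_mono => //; exact: function_graph_sub.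
move=> F finF y z [xy nFy] [xz nFz] infy infz.
have finB : finite_set (\bigcup_(a in F `&` X1) [set w | X1 w /\ exists n, iter n s w = a]).
  by apply: bigcup_finite => [|a [_ X1a]]; [exact: finite_setIl|exact: back_fin].
have escape u : infinite_set [set w | path_in Tr (Defs.comp Tr x `\` F) u w] ->
    exists w, path_in Tr (Defs.comp Tr x `\` F) u w /\ forall n, (Defs.comp Tr x `\` F) (iter n s w).
  move=> inf; have : [set w | path_in Tr (Defs.comp Tr x `\` F) u w] `\`
     (\bigcup_(a in F `&` X1) [set w | X1 w /\ exists n, iter n s w = a]) !=set0.
    exact/infinite_setN0/infinite_setD.
  move=> [w [uw nB]]; exists w; split=> // n.
  have [xw nFw] := path_in_target uw.
  have X1w : X1 w by apply: X1inv X1x (cG _ xw).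
  split; first by apply: path_in_trans xw _; exact: orbit.
  move=> Fn; apply: nB; exists (iter n s w); [split=> //; exact: X1iter|split=> //; by exists n].
have [y' [yy' hy]] := escape y infy; have [z' [zz' hz]] := escape z infz.
have xy' := cG _ (path_in_target yy').1; have xz' := cG _ (path_in_target zz').1.
apply: path_in_trans yy' _; apply: (@path_in_trans _ _ _ z'); last exact: (path_in_sym function_graph_sym).
apply: path_merge => //; first exact: X1inv xy'.
by apply: path_in_trans xz'; exact: path_in_sym.
Qed.

End FunctionTree.

(** * Thin sequences *)

(** Starting from everything, decreasing and vanishing, the sets put each vertex of [X1] into
    exactly one layer between consecutive members. Components of layers are finite by
    [thin_cofinite]. Each has an edge into the next member, because [V k] is connected within a
    component of [G] and [V k.+1] meets that component. *)
Record thin_sequence {d : measure_display} {X : measurableType d} (G : set (X * X)) (X1 : set X)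
    (V : nat -> set X) : Prop := ThinSequence {
  thin_measurable : forall k, measurable (V k);
  thin0 : V 0%N = setT;
  thin_decreasing : forall k, V k.+1 `<=` V k;
  thin_vanish : forall x, X1 x -> exists k, ~ V k x;
  thin_meets : forall k x, X1 x -> exists y, connR G x y /\ V k y;
  thin_connected : forall k x y, X1 x -> connR G x y -> V k x -> V k y -> path_in G (V k) x y;
  thin_cofinite : forall k x, X1 x -> finite_set [set y | path_in G (~` V k) x y] }.

Definition first_hit {T : Type} (G : set (T * T)) (A : set T) (x a : T) :=
  A a /\ (a = x \/ exists y, path_in G (~` A) x y /\ G (y, a)).

(* Wherever the flow along a thin sequence enters [A], the entry point is a [first_hit]; so
   this set is defined before the flow is, and [B] can be chosen to make it small. *)
Definition unmerged {T : Type} (G : set (T * T)) (A B : set T) := [set x | exists y, G (x, y) /\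
  exists a, first_hit G A x a /\ exists b, first_hit G A y b /\ ~ path_in G (A `\` B) a b].

Section ThinSequences.
Context {d : measure_display} {X : measurableType d}.
Variables (G : set (X * X)) (X1 : set X) (V : nat -> set X).
Hypothesis tV : thin_sequence G X1 V.

Lemma thin_mono k l : (k <= l)%N -> V l `<=` V k.
Proof.
elim: l => [|l ih]; first by rewrite leqn0 => /eqP ->.
rewrite leq_eqVlt => /predU1P[->//|kl] x /(thin_decreasing tV); exact: (ih kl).
Qed.

Lemma thin_vanish_eventually x : X1 x -> exists m, forall n, (m <= n)%N -> ~ V n x.
Proof.
by move=> /(thin_vanish tV)[m nm]; exists m => n mn; apply: contra_not nm => /(thin_mono mn).
Qed.

Lemma thin_subsequence (h : nat -> nat) : h 0%N = 0%N -> (forall i, (h i < h i.+1)%N) ->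
  thin_sequence G X1 (V \o h).
Proof.
move=> h0 hS; have hge i : (i <= h i)%N by elim: i => // i ih; apply: leq_ltn_trans (hS i).
split=> [k||k|x /thin_vanish_eventually[m hm]|k x|k x y|k x] /=.
- exact: thin_measurable tV _.
- by rewrite h0 (thin0 tV).
- exact/thin_mono/ltnW.
- by exists m; apply: hm.
- exact: thin_meets tV _ _.
- exact: thin_connected tV _ _ _.
- exact: thin_cofinite tV _ _.
Qed.

Lemma thin_shrink (X2 : set X) : X2 `<=` X1 -> thin_sequence G X2 V.
Proof.
move=> X21; split=> [k||k|x /X21|k x /X21|k x y /X21|k x /X21].
- exact: thin_measurable tV _.
- exact: thin0 tV.
- exact: thin_decreasing tV _.
- exact: thin_vanish tV _.
- exact: thin_meets tV _ _.
- exact: thin_connected tV _ _ _.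
- exact: thin_cofinite tV _ _.
Qed.

Hypothesis lG : locally_finite G.
Hypothesis X1inv : forall x y, X1 x -> connR G x y -> X1 y.

Lemma first_hit_finite k x : X1 x -> finite_set [set a | first_hit G (V k) x a].
Proof.
move=> X1x; apply: (@sub_finite_set _ _ ([set x] `|`
    \bigcup_(y in [set y | path_in G (~` V k) x y]) [set a | G (y, a)])).
  by move=> a [_ [->|[y [xy ya]]]]; [left|right; exists y].
by rewrite finite_setU; split=> //; apply: bigcup_finite => //; exact: thin_cofinite tV _ _ X1x.
Qed.

Lemma first_hit_connR A x a : first_hit G A x a -> connR G x a.
Proof.
move=> [_ [->|[y [xy ya]]]]; first exact: connR_refl.
exact: path_in_rcons (path_in_connR xy) ya _.
Qed.

Lemma path_in_avoid A x y : X1 x -> path_in G A x y ->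
  exists m, forall n, (m <= n)%N -> path_in G (A `\` V n) x y.
Proof.
move=> X1x; move: y; apply: path_in_ind => [Ax|y z xy [m1 h1] yz Az].
  have [m hm] := thin_vanish_eventually X1x; exists m => n /hm nV.
  exact: path_in_refl.
have [|m2 h2] := @thin_vanish_eventually z.
  by apply: (X1inv X1x); exact: path_in_rcons (path_in_connR xy) yz _.
exists (maxn m1 m2) => n; rewrite geq_max => /andP[/h1 xyn /h2 nz].
exact: path_in_rcons xyn yz _.
Qed.

(** Local finiteness and the finite components off [V k] leave finitely many pairs of first hits for
    [x] and its neighbours. Each pair is joined by a path in [V k], and the finitely many vertices
    of these paths lie outside [V n] for large [n]. *)
Lemma unmerged_vanish k x : X1 x -> symmetric_graph G ->
  exists m, forall n, (m <= n)%N -> ~ unmerged G (V k) (V n) x.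
Proof.
move=> X1x sG.
have X1y y : G (x, y) -> X1 y by move=> xy; exact: X1inv X1x (connR_edge xy).
pose S2 := \bigcup_(y in [set y | G (x, y)]) [set a | first_hit G (V k) y a].
have [||m hm] := @eventually_finite _ ([set a | first_hit G (V k) x a] `*` S2)
   (fun p n => path_in G (V k `\` V n) p.1 p.2).
- apply: finite_setX; first exact: first_hit_finite.
  by apply: bigcup_finite => // y xy; apply: first_hit_finite; exact: X1y.
- move=> [a b] [/= xa [y /= xy yb]]; apply: path_in_avoid.
    exact: X1inv X1x (first_hit_connR xa).
  apply: (thin_connected tV) (xa.1) (yb.1).
    exact: X1inv X1x (first_hit_connR xa).
  apply: (@path_in_trans _ _ _ x); first exact: (path_in_sym sG (first_hit_connR xa)).
  by apply: (@path_in_trans _ _ _ y); [exact: connR_edge|exact: (first_hit_connR yb)].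
- exists m => n mn [y [xy [a [xa [b [yb]]]]]]; apply; apply: (hm n mn (a, b)).
  by split=> //; exists y.
Qed.

End ThinSequences.

(** * Existence of thin sequences and sparse subsequences *)

Section SparseSets.
Context {d : measure_display} {X : measurableType d} {R : realType}.
Variables (P : probability X R) (G : set (X * X)) (f : X -> R) (g : nat -> X -> X).
Hypothesis finj : injective f.
Hypothesis mf : measurable_fun setT f.
Hypothesis mG : measurable G.
Hypothesis sG : symmetric_graph G.
Hypothesis lG : locally_finite G.
Hypothesis mg : forall n, measurable_fun setT (g n).
Hypothesis gG : forall n x, g n x = x \/ G (x, g n x).
Hypothesis Gg : forall x y, G (x, y) -> exists n, y = g n x.
Hypothesis mcpG : mcp P G.

Let eqX (d' : measure_display) (Y : measurableType d') (u v : Y -> X) :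
  measurable_fun setT u -> measurable_fun setT v -> mpred (fun x => u x = v x).
Proof. exact: (mpred_eq_fun finj mf). Qed.

Notation act := (act g).

Lemma mpred_path_set (A : set X) u v : measurable A ->
  mpred (fun x => path_in G A (act u x) (act v x)).
Proof.
move=> mA; apply: (@mpred_act_path _ _ G g mG mg Gg eqX (fun=> A)) => w.
exact: mpred_act_set.
Qed.

Lemma mpred_first_hit (A : set X) u v : measurable A ->
  mpred (fun x => first_hit G A (act u x) (act v x)).
Proof.
move=> mA; apply: mpredI; first exact: mpred_act_set.
apply: mpredU; first by apply: eqX; exact: measurable_act.
apply: (@eq_mpred _ _ (fun x => exists y, connR G x y /\
    (path_in G (~` A) (act u x) y /\ G (y, act v x)))).
  move=> x; split=> [[y [_ h]]|[y [uy yv]]]; exists y => //; split=> //.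
  by apply: path_in_trans (connR_act gG u x) _; exact: path_in_connR uy.
apply: (mpred_comp_ex gG Gg (Q := fun x y => path_in G (~` A) (act u x) y /\ G (y, act v x))) => w.
apply: mpredI; last exact: mpred_act_rel.
by apply: mpred_path_set; exact: measurableC.
Qed.

Lemma measurable_unmerged (A B : set X) : measurable A -> measurable B -> measurable (unmerged G A B).
Proof.
move=> mA mB; rewrite /unmerged; pose Q y a b := (first_hit G A y b) /\ ~ path_in G (A `\` B) a b.
apply: (@eq_mpred _ _ (fun x => exists y, connR G x y /\ (G (x, y) /\
  exists a, connR G x a /\ (first_hit G A x a /\ exists b, connR G x b /\ Q y a b)))).
  move=> x; split=> [[y [_ [xy [a [_ [xa [b [_ [yb h]]]]]]]]]|[y [xy [a [xa [b [yb h]]]]]]].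
    by exists y; split=> //; exists a; split=> //; exists b.
  exists y; split; first exact: connR_edge.
  split=> //; exists a; split; first exact: first_hit_connR xa.
  split=> //; exists b; split; last by [].
  by exact: path_in_trans (connR_edge xy) (first_hit_connR yb).
apply: (mpred_comp_ex gG Gg) => u; apply: mpredI; first exact: (@mpred_act_rel _ _ g mg G [::]).
apply: (mpred_comp_ex gG Gg) => v; apply: mpredI; first exact: (@mpred_first_hit A [::]).
apply: (mpred_comp_ex gG Gg) => w; apply: mpredI; first exact: mpred_first_hit.
by apply: mpredN; apply: mpred_path_set; exact: measurableD.
Qed.

Lemma merging_subsequence (X1 : set X) (V : nat -> set X) :
  P.-negligible (~` X1) -> (forall x y, X1 x -> connR G x y -> X1 y) -> thin_sequence G X1 V ->
  exists (X2 : set X) (U : nat -> set X), [/\ measurable X2, P.-negligible (~` X2),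
    forall x y, X2 x -> connR G x y -> X2 y, thin_sequence G X2 U &
    forall x, X2 x -> exists m, forall n, (m <= n)%N -> ~ unmerged G (U n) (U n.+1) x].
Proof.
move=> X1null X1inv tV.
have mV := thin_measurable tV.
have /choice[K hK] : forall k, exists n, (k < n)%N /\
    (P (unmerged G (V k) (V n)) <= (1 / (2 ^ k.+1)%:R)%:E)%E.
  move=> k; have [n hn] := prob_eventually_small (P := P) (B := fun n => unmerged G (V k) (V n))
      (fun n => measurable_unmerged (mV k) (mV n)) X1null
      (fun x nx => unmerged_vanish tV lG X1inv k (contrapT nx) sG)
      (ltac:(by rewrite divr_gt0 ?ltr0n ?expn_gt0) : 0 < 1 / (2 ^ k.+1)%:R :> R).
  exists (maxn n k.+1); split; first exact: leq_maxr.
  by apply/ltW/hn/leq_maxl.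
pose h i := iter i K 0%N.
have hS i : (h i < h i.+1)%N by exact: (hK (h i)).1.
have hge i : (i <= h i)%N by elim: i => // i ih; apply: leq_ltn_trans (hS i).
pose U := V \o h.
have tU : thin_sequence G X1 U by exact: thin_subsequence.
have mB n : measurable (unmerged G (U n) (U n.+1)).
  by apply: measurable_unmerged; exact: mV.
have PB n : (P (unmerged G (U n) (U n.+1)) <= (1 / (2 ^ n.+1)%:R)%:E)%E.
  (* As [n <= h n], the bound obtained at [h n] is at most the summable one at [n]. *)
  apply: le_trans (hK (h n)).2 _; rewrite lee_fin !div1r lef_pV2 ?posrE ?ltr0n ?expn_gt0 //.
  by rewrite ler_nat leq_exp2l // ltnS.
have aeQ : {ae P, forall x, X1 x /\ exists m, forall n, (m <= n)%N -> ~ unmerged G (U n) (U n.+1) x}.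
  have := negligibleU X1null (negligible_limsup mB PB).
  apply: negligibleS => x /= /not_andP[]; first by left.
  move=> nx; right => m; apply: contrapT => hm; apply: nx; exists m => n mn Bn.
  by apply: hm; exists n.
have [X2 [mX2 X2null X2inv X2Q]] := invariant_conull finj mf sG mg gG Gg mcpG aeQ.
exists X2, U; split=> //; last by move=> x /X2Q[].
by apply: thin_shrink tU _ _ => x /X2Q[].
Qed.

Variables (Gn : nat -> set (X * X)) (X0 : set X).
Hypothesis mGn : forall n, measurable (Gn n).
Hypothesis sGn : forall n, symmetric_graph (Gn n).
Hypothesis Gnmono : forall n, Gn n `<=` Gn n.+1.
Hypothesis GnG : \bigcup_n Gn n = G.
Hypothesis mX0 : measurable X0.
Hypothesis X0inv : forall x y, X0 x -> connR G x y -> X0 y.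
Hypothesis X0null : P.-negligible (~` X0).
Hypothesis oneG : forall x, X0 x -> one_ended_at G x.
Hypothesis finGn : forall n x, X0 x -> finite_set (Defs.comp (Gn n) x).

Notation frontier := (frontier G Gn).

Lemma path_off_frontier n (A : set X) x y : (forall z, A z -> ~ frontier n z) ->
  path_in G A x y -> connR (Gn n) x y.
Proof.
move=> hA; move: y; apply: path_in_ind => [_|y z xy ih yz Az]; first exact: connR_refl.
apply: path_in_trans ih _; apply: contrapT => nyz.
by apply: (hA y); [exact: path_in_target xy|exists z].
Qed.

(** A component without frontier vertices would lie in a single class, which is finite. *)
Lemma frontier_meets n x : X0 x -> exists y, connR G x y /\ frontier n y.
Proof.
move=> X0x; apply: contrapT => nf; have [[F [_ [y [[xy _] inf]]]] _] := oneG X0x.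
apply: inf; apply: sub_finite_set (finGn n X0x) => z yz.
apply: (@path_off_frontier n (Defs.comp G x)); first by move=> w xw fw; apply: nf; exists w.
apply: path_in_restrict; apply: path_in_trans xy _; exact: path_in_connR yz.
Qed.

(** [V k.+1] is the union of the small sets [W j] with [k <= j], and by Borel-Cantelli almost every
    vertex lies in finitely many of them. The union remains connected because frontiers shrink as
    [n] grows: for two of the sets, the frontier of the coarser of their two relations lies in both
    and meets every component. *)
Lemma exists_thin_sequence : exists (X1 : set X) (V : nat -> set X), [/\
  P.-negligible (~` X1), forall x y, X1 x -> connR G x y -> X1 y, X1 `<=` X0 & thin_sequence G X1 V].
Proof.
have /choice[nW hW] : forall j : nat, exists nW : nat * set X, [/\ measurable nW.2,
    (P nW.2 <= (1 / (2 ^ j.+1)%:R)%:E)%E, (forall x, X0 x -> frontier nW.1 x -> nW.2 x) &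
    forall x y, nW.2 x -> nW.2 y -> connR G x y -> X0 x /\ path_in G nW.2 x y].
  move=> j; have [|n [W [mW PW fW cW]]] := @small_connected_set _ _ _ P G f g finj mf mG sG lG mg
    gG Gg eqX Gn X0 mGn sGn Gnmono GnG mX0 X0inv X0null oneG finGn (1 / (2 ^ j.+1)%:R).
    by rewrite divr_gt0 ?ltr0n ?expn_gt0.
  by exists (n, W); split=> //; exact: ltW.
pose W j := (nW j).2; pose n j := (nW j).1.
have mW j : measurable (W j) by have [] := hW j.
pose V k := if k is k'.+1 then \bigcup_(j in [set j | (k' <= j)%N]) W j else setT.
have aeQ : {ae P, forall x, X0 x /\ exists m, forall n, (m <= n)%N -> ~ W n x}.
  have := negligibleU X0null (@negligible_limsup _ _ _ P W mW (fun j => let: And4 _ h _ _ := hW j in h)).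
  apply: negligibleS => x /= /not_andP[]; first by left.
  move=> nx; right => m; apply: contrapT => hm; apply: nx; exists m => j mj Wj.
  by apply: hm; exists j.
have [X1 [mX1 X1null X1inv X1Q]] := invariant_conull finj mf sG mg gG Gg mcpG aeQ.
have X10 : X1 `<=` X0 by move=> x /X1Q[].
have VW k x : V k.+1 x -> exists2 j, (k <= j)%N & W j x by move=> [j]; exists j.
have WV k j : (k <= j)%N -> W j `<=` V k.+1 by move=> kj x Wx; exists j.
exists X1, V; split=> //; split.
- by case=> [|k]; [exact: measurableT|exact: bigcup_measurable].
- by [].
- by case=> [//|k] x /VW[j kj Wx]; exact: (WV k j (ltnW kj)).
- move=> x /X1Q[_ [m hm]]; exists m.+1 => /VW[j mj]; exact: hm.
- move=> [|k] x X1x; first by exists x; split=> //; exact: connR_refl.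
  have [y [xy fy]] := frontier_meets (n k) (X10 _ X1x).
  exists y; split=> //; apply: (WV k k (leqnn k)); have [_ _ fW _] := hW k.
  by apply: fW => //; exact: X0inv (X10 _ X1x) xy.
- move=> [|k] x y X1x xy //; move=> /VW[i ki Wi] /VW[j kj Wj].
  have [z [xz fz]] := frontier_meets (maxn (n i) (n j)) (X10 _ X1x).
  have fW l : (n l <= maxn (n i) (n j))%N -> W l z.
    move=> hl; have [_ _ h _] := hW l; apply: h; first exact: X0inv (X10 _ X1x) xz.
    move: fz => [u [zu nzu]]; exists u; split=> //; apply: contra_not nzu.
    by apply: path_in_mono => //; exact: Gn_mono.
  apply: (@path_in_trans _ _ _ z).
    apply: (path_in_mono (@subset_refl _ G) (WV k i ki)).
    by have [_ _ _ cW] := hW i; have [] := cW x z Wi (fW i (leq_maxl _ _)) xz.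
  apply: (path_in_mono (@subset_refl _ G) (WV k j kj)).
  have zy : connR G z y by apply: path_in_trans xy; exact: path_in_sym.
  by have [_ _ _ cW] := hW j; have [] := cW z y (fW j (leq_maxr _ _)) Wj zy.
- move=> [|k] x X1x.
    by apply: sub_finite_set (finite_set0 X) => y h; exact: (path_in_target h).
  apply: sub_finite_set (finGn (n k) (X10 _ X1x)) => y xy.
  apply: (@path_off_frontier _ (X0 `&` ~` V k.+1)).
    move=> z [X0z nVz] fz; apply: nVz; apply: (WV k k (leqnn k)).
    by have [_ _ fW _] := hW k; exact: fW.
  apply: path_in_mono (path_in_restrict xy) => // z xz; split; last exact: path_in_target xz.
  by apply: X0inv (X10 _ X1x) _; exact: path_in_connR xz.
Qed.

End SparseSets.

(** * The flow along a thin sequence *)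

Section Flow.
Context {d : measure_display} {X : measurableType d} {R : realType}.
Variables (G : set (X * X)) (f : X -> R) (g : nat -> X -> X).
Hypothesis finj : injective f.
Hypothesis mf : measurable_fun setT f.
Hypothesis mG : measurable G.
Hypothesis sG : symmetric_graph G.
Hypothesis mg : forall n, measurable_fun setT (g n).
Hypothesis Gg : forall x y, G (x, y) -> exists n, y = g n x.
Variables (X1 : set X) (U : nat -> set X).
Hypothesis mX1 : measurable X1.
Hypothesis X1inv : forall x y, X1 x -> connR G x y -> X1 y.
Hypothesis tU : thin_sequence G X1 U.

Let eqX (d' : measure_display) (Y : measurableType d') (u v : Y -> X) :
  measurable_fun setT u -> measurable_fun setT v -> mpred (fun x => u x = v x).
Proof. exact: (mpred_eq_fun finj mf). Qed.

Notation act := (act g).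

Definition layer i := U i `\` U i.+1.

Definition layer_graph := [set p | G p /\ exists i, layer i p.1 /\ layer i p.2].
Notation E := layer_graph.

Let mU := thin_measurable tU.

Lemma measurable_layer i : measurable (layer i).
Proof. exact: measurableD. Qed.

Lemma layer_uniq i j x : layer i x -> layer j x -> i = j.
Proof.
move=> [Ui nUi] [Uj nUj]; case: (ltngtP i j) => // h; exfalso.
  exact/nUi/(thin_mono tU h).
exact/nUj/(thin_mono tU h).
Qed.

Lemma layer_exists x : X1 x -> exists i, layer i x.
Proof.
move=> /(thin_vanish tU)[]; elim=> [|k ih nU]; first by rewrite (thin0 tU); case.
by have [Ux|/ih//] := pselect (U k x); exists k.
Qed.

Lemma measurable_layer_graph : measurable E.
Proof.
apply: (@mpredI _ (X * X)%type G (fun p => exists i, layer i p.1 /\ layer i p.2)) => //.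
apply: mpred_ex => i; apply: mpredI; [apply: (@mpred_comp _ _ _ _ (layer i) fst)|apply: (@mpred_comp _ _ _ _ (layer i) snd)] => //;
  exact: measurable_layer.
Qed.

Lemma layer_graph_sym : symmetric_graph E.
Proof. by move=> x y [/= /sG ? [i [? ?]]]; split=> //; exists i. Qed.

Let EG : E `<=` G. Proof. by move=> p []. Qed.

Lemma layer_graph_path i x y : layer i x -> connR E x y <-> path_in G (layer i) x y.
Proof.
move=> Lx; split; move: y; apply: path_in_ind => [_|y z xy ih yz].
- exact: path_in_refl.
- move=> _; have [/= Gyz [j [Ly Lz]]] := yz.
  have ij := layer_uniq (path_in_target ih) Ly; rewrite -ij in Lz.
  exact: path_in_rcons ih Gyz Lz.
- exact: connR_refl.
- move=> Lz; apply: (path_in_rcons ih) => //; split=> //; exists i; split=> //.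
  exact: path_in_target xy.
Qed.

Lemma layer_connR i x y : layer i x -> connR E x y -> layer i y.
Proof. by move=> Lx xy; exact: path_in_target ((layer_graph_path y Lx).1 xy). Qed.

Lemma layer_graph_finite x : X1 x -> finite_set (Defs.comp E x).
Proof.
move=> X1x; have [i Lx] := layer_exists X1x.
apply: sub_finite_set (thin_cofinite tU i.+1 X1x) => y /(layer_graph_path y Lx).
by apply: path_in_mono => // z [].
Qed.

Lemma layer_exit i x : X1 x -> layer i x -> exists y z, [/\ connR E x y, G (y, z) & U i.+1 z].
Proof.
move=> X1x Lx; have [z [xz Uz]] := thin_meets tU i.+1 X1x.
have xzU := thin_connected tU X1x xz Lx.1 (thin_decreasing tU Uz).
have [||u [v [xu nUu Uv _ uv]]] := @path_in_cross _ _ _ (~` U i.+1) _ _ xzU; first exact: Lx.2.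
  by move=> /(_ Uz).
exists u, v; split=> //; last exact: contrapT.
by apply/(layer_graph_path u Lx).
Qed.

Lemma X1E x y : X1 x -> connR E x y -> X1 y.
Proof. by move=> X1x xy; apply: (X1inv X1x); exact: path_in_mono xy. Qed.

(** The exit is chosen at the base point of the layer component, hence it is common to all vertices
    of that component. *)
Lemma exit_point : exists e : X -> X, [/\ measurable_fun setT e,
  forall x, X1 x -> connR E x (e x),
  forall x y, X1 x -> connR E x y -> e x = e y &
  forall x i, X1 x -> layer i x -> exists n, G (e x, g n (e x)) /\ U i.+1 (g n (e x))].
Proof.
have [b [mb bE bconst]] := base_point finj mf mg Gg eqX measurable_layer_graph layer_graph_sym EG
  X1inv layer_graph_finite.
pose Q w x := connR E x (act w x) /\ exists n i, layer i x /\ (G (act w x, g n (act w x)) /\ U i.+1 (g n (act w x))).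
have grcons n w x : g n (act w x) = act (rcons w n) x by rewrite act_rcons.
have [|c [cQ mc]] := @measurable_choice _ X (seq nat) [::] Q.
  move=> w; apply: mpredI; first exact: (mpred_act_connR mg Gg eqX [::] w measurable_layer_graph EG).
  apply: mpred_ex => n; apply: mpred_ex => i; apply: mpredI; first exact: measurable_layer.
  rewrite (_ : (fun x => _) = fun x => G (act w x, act (rcons w n) x) /\ U i.+1 (act (rcons w n) x)).
    by apply: mpredI; [exact: mpred_act_rel|exact: mpred_act_set].
  by apply/funext => x; rewrite grcons.
have Qex x : X1 x -> exists w, Q w x.
  move=> X1x; have [i Lx] := layer_exists X1x; have [y [z [xy yz Uz]]] := layer_exit X1x Lx.
  have [w yw] := connR_word Gg (path_in_mono EG (fun _ h => h) xy); have [n zn] := Gg yz.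
  by exists w; rewrite /Q -yw; split=> //; exists n, i; rewrite -zn.
pose e x := act (c (b x)) (b x).
have eE x : X1 x -> connR E x (e x).
  move=> X1x; apply: path_in_trans (bE x X1x) _.
  by have [] := cQ _ (Qex _ (X1E X1x (bE x X1x))).
exists e; split=> //.
- apply: (@measurableT_comp _ _ _ _ _ _ (fun x => act (c x) x)) => //.
  by apply: (measurable_fun_glue (h := fun w x => act w x)) => // w; exact: measurable_act.
- by move=> x y X1x xy; rewrite /e (bconst x y).
- move=> x i X1x Lx; have xb := bE x X1x.
  have [_ [n [j [Lj [h1 h2]]]]] := cQ _ (Qex _ (X1E X1x xb)).
  by exists n; rewrite (layer_uniq (layer_connR Lx xb) Lj).
Qed.

Lemma exists_flow : exists s e : X -> X, [/\ measurable_fun setT s,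
  (forall x, X1 x -> G (x, s x)),
  (forall x y, X1 x -> connR E x y -> e x = e y),
  (forall x, X1 x -> exists n, iter n s x = e x) &
  (forall x i, X1 x -> layer i x -> layer i (e x) /\ U i.+1 (s (e x))) /\
  (forall x k, X1 x -> U k x -> U k (s x))].
Proof.
have [e [me eE econst eU]] := exit_point.
(* [D m x] says that a walk of length [m] in the layer graph leads from [x] to the exit. *)
pose D := fix D m x := if m is m'.+1 then exists n, E (x, g n x) /\ D m' (g n x) else x = e x.
have mE n : mpred (fun x => E (x, g n x)).
  exact: (mpred_act_rel mg [::] [:: n] measurable_layer_graph).
have mD m : mpred (D m).
  elim: m => [|m ih]; first exact: (eqX (mact mg [::]) me).
  apply: mpred_ex => n; apply: mpredI; first exact: mE.
  exact: (@mpred_comp _ _ _ _ (D m) (g n)).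
(* The exit steps into [U i.+1]. Any other vertex, at least distance [m.+1] from the exit, steps to
   a neighbour from which a walk of length [m] reaches it. *)
pose Q n x := (x = e x /\ exists i, layer i x /\ (G (x, g n x) /\ U i.+1 (g n x))) \/
  exists m, (D m.+1 x /\ forall m', (m' <= m)%N -> ~ D m' x) /\ (E (x, g n x) /\ D m (g n x)).
have [|c [cQ mc]] := @measurable_choice _ X nat 0%N Q.
  move=> n; apply: mpredU; first (apply: mpredI; first exact: (eqX (mact mg [::]) me)).
    apply: mpred_ex => i; apply: mpredI; first exact: measurable_layer.
    apply: mpredI; first exact: (mpred_act_rel mg [::] [:: n] mG).
    by apply: (@mpred_comp _ _ _ _ (U i.+1) (g n)) => //; exact: mU.
  apply: mpred_ex => m; apply: mpredI.
    apply: mpredI => //; apply: mpred_all => m'; apply: mpred_imp; first exact: mpred_cst.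
    exact: mpredN.
  by apply: mpredI; [exact: mE|exact: (@mpred_comp _ _ _ _ (D m) (g n))].
have rank x : X1 x -> exists m, D m x /\ forall m', (m' < m)%N -> ~ D m' x.
  move=> X1x; have [m Dm] : exists m, D m x.
    suff H y : connR E (e x) y -> exists m, D m y.
      by apply: H; apply: (path_in_sym layer_graph_sym); exact: eE.
    move: y; apply: path_in_ind => [_|y z xy [m Dm] yz _].
      by exists 0%N => /=; rewrite -(econst _ _ X1x (eE x X1x)).
    have zy := layer_graph_sym yz; have [n yn] := Gg (EG zy).
    by exists m.+1 => /=; exists n; rewrite -yn.
  have ex : exists m, `[< D m x >] by exists m; apply/asboolP.
  case: (ex_minnP ex) => m0 /asboolP D0 hmin; exists m0; split=> // m'.
  by rewrite ltnNge => /negP h' Dm'; apply: h'; apply: hmin; apply/asboolP.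
have Qex x : X1 x -> exists n, Q n x.
  move=> X1x; have [[|m] [Dm hm]] := rank x X1x.
    have [i Lx] := layer_exists X1x; have [n [h1 h2]] := eU x i X1x Lx.
    rewrite -Dm in h1 h2; exists n; left; split=> //; exists i; split=> //.
  by have [n [h1 h2]] := Dm; exists n; right; exists m; split=> //; split=> // m' m'm; exact: hm.
pose s x := g (c x) x.
have sQ x : X1 x -> Q (c x) x by move=> /Qex /cQ.
have sG' x : X1 x -> G (x, s x).
  by move=> /sQ[[_ [i [_ []]]]//|[m [_ [/EG]]]].
have sE x m : X1 x -> (D m.+1 x /\ forall m', (m' <= m)%N -> ~ D m' x) -> E (x, s x) /\ D m (s x).
  move=> X1x [Dx nD]; have [[xe _]|[m' [[Dx' nD'] h]]] := sQ x X1x; first by case: (nD 0%N).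
  have -> // : m = m'; case: (ltngtP m m') => // h'; exfalso.
    exact: (nD' m.+1).
  exact: (nD m'.+1).
exists s, e; split=> //.
- by apply: (measurable_fun_glue (h := g)).
- move=> x X1x; have [m [Dm _]] := rank x X1x.
  elim/ltn_ind: m x X1x Dm => m ih x X1x Dm.
  have [[|m0] [D0 h0]] := rank x X1x; first by exists 0%N.
  have m0m : (m0 < m)%N by rewrite ltnNge; apply/negP => h; exact: (h0 m).
  have [xs Ds] := sE x m0 X1x (conj D0 h0).
  have xs' := connR_edge xs.
  have [n hn] := ih m0 m0m (s x) (X1E X1x xs') Ds.
  by exists n.+1; rewrite iterSr hn (econst x (s x)).
split=> [x i X1x Lx|x k X1x Ux].
  have xe := eE x X1x; have Le := layer_connR Lx xe; have X1e := X1E X1x xe.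
  have ee : e x = e (e x) by exact: econst.
  split=> //; have [[_ [j [Lj [_ h]]]]|[m [[_ /(_ 0%N isT)]]]] := sQ _ X1e; last by [].
  by rewrite (layer_uniq Le Lj).
have [i Lx] := layer_exists X1x.
have ki : (k <= i)%N.
  by rewrite leqNgt; apply/negP => ik; case: Lx => _; apply; exact: (thin_mono tU ik).
have [[_ [j [Lj [_ h]]]]|[m [_ [xs _]]]] := sQ x X1x.
  by apply: (thin_mono tU) h; rewrite -(layer_uniq Lx Lj) leqW.
by have [/(thin_mono tU ki)] := layer_connR Lx (connR_edge xs).
Qed.

Hypothesis merging : forall x, X1 x -> exists m, forall n, (m <= n)%N -> ~ unmerged G (U n) (U n.+1) x.

(** For neighbours [x] and [y] and large [k], the orbits enter [U k] at first hits that are joined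
    outside [U k.+1], hence in one component of the layer [k]; from there both reach the same exit.
    Every orbit enters each [U k] and stays there, which excludes periodic points. An orbit that
    arrives at a point outside [U k] has avoided [U k] throughout, so only finitely many points lead
    there. *)
Lemma thin_sequence_tree : exists Tr : set (X * X), [/\ measurable Tr, symmetric_graph Tr,
  Tr `<=` G, acyclic Tr & forall x, X1 x -> one_ended_at Tr x /\ Defs.comp Tr x = Defs.comp G x].
Proof.
have [s [e [ms sE econst se [eU sU]]]] := exists_flow.
have X1s x : X1 x -> X1 (s x) by move=> X1x; exact: X1inv X1x (connR_edge (sE x X1x)).
have X1iter n x : X1 x -> X1 (iter n s x) by move=> X1x; elim: n => // n ih; exact: X1s.
have Uiter k n m x : X1 x -> (n <= m)%N -> U k (iter n s x) -> U k (iter m s x).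
  move=> X1x nm; rewrite -(subnK nm) iterD; elim: (m - n)%N => // l ih Ux.
  by rewrite iterS; apply: sU; [rewrite -iterD; exact: X1iter|exact: ih].
have hits k x : X1 x -> exists n, U k (iter n s x).
  move=> X1x; elim: k => [|k [n Un]]; first by exists 0%N; rewrite (thin0 tU).
  have [h|nU] := pselect (U k.+1 (iter n s x)); first by exists n.
  have X1n := X1iter n x X1x; have [l hl] := se _ X1n; exists (l.+1 + n)%N.
  by rewrite iterD iterS hl; have [] := eU _ k X1n.
have s_path (A : set X) n x : X1 x -> (forall m, (m <= n)%N -> A (iter m s x)) -> path_in G A x (iter n s x).
  move=> X1x; elim: n => [|n ih] hA; first by apply: path_in_refl; exact: (hA 0%N).
  apply: path_in_rcons (ih _) _ _; [by move=> m mn; apply/hA/leqW| |exact: hA].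
  by apply: sE; exact: X1iter.
have first k x : X1 x -> exists n, first_hit G (U k) x (iter n s x).
  move=> X1x; have ex : exists n, `[< U k (iter n s x) >].
    by have [n hn] := hits k x X1x; exists n; apply/asboolP.
  case: (ex_minnP ex) => -[|n] /asboolP Un hmin; first by exists 0%N; split=> //; left.
  exists n.+1; split=> //; right; exists (iter n s x); split; last by apply: sE; exact: X1iter.
  apply: s_path => // m mn Um; have /hmin : `[< U k (iter m s x) >] by apply/asboolP.
  by rewrite ltnNge mn.
have aper x n : X1 x -> iter n.+1 s x <> x.
  move=> X1x h; have per q : iter (q * n.+1)%N s x = x.
    by elim: q => // q ih; rewrite mulSn iterD ih.
  have [k nU] := thin_vanish tU X1x; have [m Um] := hits k x X1x; apply: nU.
  (* [m * n.+1] steps lead back to [x], and they are at least the [m] steps after which the orbit is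
     in [U k]. *)
  by rewrite -(per m); apply: (Uiter k m) => //; nia.
have back y : X1 y -> finite_set [set x | X1 x /\ exists n, iter n s x = y].
  move=> X1y; have [k nU] := thin_vanish tU X1y.
  apply: sub_finite_set (thin_cofinite tU k X1y) => x [X1x [n hn]].
  apply: path_in_sym => //; rewrite -hn; apply: s_path => // m mn Um; apply: nU.
  by rewrite -hn; exact: Uiter Um.
have merge x y : X1 x -> G (x, y) -> exists i j, iter i s x = iter j s y.
  move=> X1x xy; have X1y := X1inv X1x (connR_edge xy).
  have [k hk] := merging X1x; have [n xn] := first k x X1x; have [m ym] := first k y X1y.
  have : path_in G (U k `\` U k.+1) (iter n s x) (iter m s y).
    by apply: contrapT => np; apply: (hk k (leqnn k)); exists y; split=> //; exists (iter n s x); split=> //;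
      exists (iter m s y).
  move=> h; have /(layer_graph_path _ (path_in_source h)) hE := h.
  have [a ha] := se _ (X1iter n x X1x); have [b hb] := se _ (X1iter m y X1y).
  exists (a + n)%N, (b + m)%N; rewrite !iterD ha hb; apply: econst => //; exact: X1iter.
exists (function_graph X1 s); split.
- apply: (@mpredI _ (X * X)%type (fun p => X1 p.1) (fun p => X1 p.2 /\ (p.2 = s p.1 \/ p.1 = s p.2))).
    exact: (@mpred_comp _ _ _ _ X1 fst).
  apply: mpredI; first exact: (@mpred_comp _ _ _ _ X1 snd).
  by apply: mpredU; apply: eqX => //; exact: measurableT_comp.
- exact: function_graph_sym.
- exact: function_graph_sub.
- exact: function_graph_acyclic.
- move=> x X1x; split; first exact: (function_graph_one_ended sG X1inv sE aper back merge).
  exact: (comp_function_graph sG X1inv sE merge).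
Qed.

End Flow.

(** * Acyclic one-ended graphs *)

(** A walk of least length repeats no vertex, since a repetition could be cut out. *)
Lemma path_in_injective {T : Type} (E : set (T * T)) A x y : path_in E A x y ->
  exists (n : nat) (p : nat -> T), [/\ p 0%N = x, p n = y, (forall i, (i <= n)%N -> A (p i)),
    (forall i, (i < n)%N -> E (p i, p i.+1)) &
    (forall i j, (i <= n)%N -> (j <= n)%N -> p i = p j -> i = j)].
Proof.
pose L n := exists p : nat -> T, [/\ p 0%N = x, p n = y, (forall i, (i <= n)%N -> A (p i)) &
    (forall i, (i < n)%N -> E (p i, p i.+1))].
move=> [n [p hp]]; have ex : exists n, `[< L n >] by exists n; apply/asboolP; exists p.
case: (ex_minnP ex) => m /asboolP[q [q0 qm qA qE]] hmin; exists m, q; split=> //.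
suff H i j : (i < j <= m)%N -> q i <> q j.
  move=> i j im jm ij; case: (ltngtP i j) => // h; exfalso.
    by apply: (H i j); rewrite ?h.
  by apply: (H j i); rewrite ?h.
move=> /andP[ij jm] qij.
have : `[< L (m - (j - i))%N >].
  apply/asboolP; exists (fun k => if (k <= i)%N then q k else q (k + (j - i))%N); split.
  - by [].
  - case: ifP => h; last by rewrite subnK //; lia.
    have -> : (m - (j - i))%N = i by lia.
    by rewrite qij -qm; congr q; lia.
  - by move=> k km; case: ifP => h; apply: qA; lia.
  move=> k km; case: (ltngtP k i) => h.
  - by apply: qE; lia.
  - rewrite addSn; apply: qE; lia.
  - rewrite h qij; have -> : (i.+1 + (j - i) = j.+1)%N by lia.
    by apply: qE; lia.
by move=> /hmin; lia.
Qed.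

Lemma path_in_first_step {T : Type} (E : set (T * T)) A x z : path_in E A x z -> z <> x ->
  exists y, E (x, y) /\ path_in E (A `\ x) y z.
Proof.
move: z; apply: path_in_ind => [_ []//|y z xy ih yz Az zx].
have [yx|/ih[u [xu uy]]] := pselect (y = x); last first.
  by exists u; split=> //; exact: path_in_rcons uy yz _.
by exists z; rewrite -yx; split=> //; apply: path_in_refl; rewrite yx.
Qed.

Section AcyclicOneEnded.
Context {T : choiceType}.
Variables (Tr : set (T * T)) (X0 : set T) (s : T -> T).
Hypothesis sT : symmetric_graph Tr.
Hypothesis lT : locally_finite Tr.
Hypothesis aT : acyclic Tr.
Hypothesis X0inv : forall x y, X0 x -> connR Tr x y -> X0 y.
Hypothesis oneT : forall x, X0 x -> one_ended_at Tr x.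

Definition branch x y := [set z | path_in Tr (~` [set x]) y z].

Lemma edge_neq x y : Tr (x, y) -> x <> y.
Proof. by move=> xy e; rewrite e in xy; apply: aT.1 xy. Qed.

(** Otherwise an injective path from [y] to [y'] avoiding [x] would close up to a cycle through
    [x]. *)
Lemma branch_uniq x y y' : Tr (x, y) -> Tr (x, y') -> branch x y y' -> y = y'.
Proof.
move=> xy xy' h; have [n [p [p0 pn pA pE pinj]]] := path_in_injective h.
have [n0|n0] := posnP n; first by rewrite -p0 -pn n0.
pose v i := if i is i'.+1 then p i' else x.
exfalso; apply: (aT.2 n.+2 v) => //.
  move=> [|i] [|j] //=; rewrite ?ltnS => ni nj e.
  - by case: (pA j).
  - by case: (pA i); rewrite ?e.
  - by rewrite (pinj i j).
split=> [[|i] hi /=|/=]; [by rewrite p0|exact: pE|].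
by rewrite pn; exact: sT.
Qed.

Lemma infinite_branch x : X0 x -> exists y, Tr (x, y) /\ infinite_set (branch x y).
Proof.
move=> X0x; have [[F [_ [y [[xy _] infC]]]] _] := oneT X0x.
have infx : infinite_set (Defs.comp Tr x).
  apply: sub_infinite_set infC => z yz; apply: path_in_trans xy _; exact: path_in_connR yz.
have [z [[xz zx] infz]] := infinite_component sT lT infx (fun _ h => path_in_restrict h) (finite_set1 x).
have zx' : path_in Tr setT z x by exact: path_in_sym.
have [||u [v [_ zu nzv _ uv]]] := @path_in_cross _ _ _ (branch x z) _ _ zx'.
- exact: path_in_refl.
- by move=> h; exact: (path_in_target h).
have vx : v = x by apply: contrapT => nvx; apply: nzv; exact: path_in_rcons zu uv _.
rewrite vx in uv; exists u; split; first exact: sT.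
apply: sub_infinite_set infz => w zw; apply: (@path_in_trans _ _ _ z); first exact: path_in_sym zu.
by apply: path_in_mono zw => // ? [].
Qed.

Lemma infinite_branch_uniq x y y' : X0 x -> Tr (x, y) -> Tr (x, y') ->
  infinite_set (branch x y) -> infinite_set (branch x y') -> y = y'.
Proof.
move=> X0x xy xy' inf inf'; apply: (branch_uniq xy xy').
have C u : Tr (x, u) -> path_in Tr setT x u by exact: connR_edge.
have CD u : Tr (x, u) -> (Defs.comp Tr x `\` [set x]) u.
  by move=> xu; split; [exact: C|move=> /= e; exact: edge_neq xu (esym e)].
have sub u : Tr (x, u) -> branch x u `<=` [set w | path_in Tr (Defs.comp Tr x `\` [set x]) u w].
  move=> xu w uw; apply: path_in_mono (path_in_restrict uw) => // z uz.
  split; last exact: path_in_target uz.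
  by apply: path_in_trans (C u xu) _; exact: path_in_connR uz.
have [_ h] := oneT X0x.
have := h _ (finite_set1 x) y y' (CD y xy) (CD y' xy')
  (sub_infinite_set (sub y xy) inf) (sub_infinite_set (sub y' xy') inf').
by apply: path_in_mono => // ? [].
Qed.

Hypothesis sE : forall x, X0 x -> Tr (x, s x).
Hypothesis s_inf : forall x, X0 x -> infinite_set (branch x (s x)).

Let X0s x : X0 x -> X0 (s x).
Proof. by move=> X0x; exact: X0inv X0x (connR_edge (sE X0x)). Qed.

(** If [x] and [s x] pointed at each other, deleting both would leave an infinite component on
    either side of the edge. One-endedness joins the two without using [x] or [s x], so a second
    neighbour of [x] lies in the branch of [s x], against [branch_uniq]. *)
Lemma no_two_cycle x : X0 x -> s (s x) <> x.
Proof.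
move=> X0x ssx; pose y := s x; have xy : Tr (x, y) := sE X0x; have yx := sT xy.
have half a b : X0 a -> Tr (a, b) -> infinite_set (branch a b) ->
    exists z, [/\ (Defs.comp Tr a `\` [set a; b]) z, branch a b z &
      infinite_set [set w | path_in Tr (Defs.comp Tr a `\` [set a; b]) z w]].
  move=> X0a ab inf.
  have bh z : branch a b z -> path_in Tr (branch a b) b z by exact: path_in_restrict.
  have [z [[bz zb] infz]] := infinite_component sT lT inf bh (finite_set1 b).
  have sub : branch a b `\` [set b] `<=` Defs.comp Tr a `\` [set a; b].
    move=> w [bw wb]; split; last by move=> [wa|//]; exact: (path_in_target bw) wa.
    by apply: path_in_trans (connR_edge ab) _; exact: path_in_connR bw.
  exists z; split=> //; first by apply: sub; split.
  by apply: sub_infinite_set infz => w; apply: path_in_mono.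
have infy : infinite_set (branch y x) by have := s_inf (X0s X0x); rewrite ssx.
have [z1 [z1C z1b inf1]] := half x y X0x xy (s_inf X0x).
have [z2 [z2C z2b inf2]] := half y x (X0s X0x) yx infy.
have CE : Defs.comp Tr y `\` [set y; x] = Defs.comp Tr x `\` [set x; y].
  rewrite setUC; congr (_ `\` _); apply/seteqP; split=> w h.
    exact: path_in_trans (connR_edge xy) h.
  exact: path_in_trans (connR_edge yx) h.
rewrite CE in z2C inf2.
have fin : finite_set [set x; y] by rewrite finite_setU; split; exact: finite_set1.
have [_ h] := oneT X0x; have z12 := h _ fin z1 z2 z1C z2C inf1 inf2.
have yz2 : path_in Tr (~` [set x]) y z2.
  by apply: path_in_trans z1b _; apply: path_in_mono z12 => // w [_ nw] wx; apply: nw; left.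
have [|u [xu uz2]] := path_in_first_step z2b; first by move=> e; apply: z2C.2; left.
have uy : u <> y := (path_in_source uz2).1; case: uy; apply/esym/(branch_uniq xy xu).
apply: path_in_trans yz2 _; apply: path_in_sym => //.
by apply: path_in_mono uz2 => // w [].
Qed.

(** If the branches at both ends of the edge were finite, so would be their union, which is the
    whole component. *)
Lemma tree_edge_step x y : X0 x -> Tr (x, y) -> y = s x \/ x = s y.
Proof.
move=> X0x xy; have yx := sT xy; have X0y := X0inv X0x (connR_edge xy).
have [inf|fin1] := pselect (infinite_set (branch x y)).
  by left; exact: infinite_branch_uniq (sE X0x) inf (s_inf X0x).
have [inf|fin2] := pselect (infinite_set (branch y x)).
  by right; exact: infinite_branch_uniq (sE X0y) inf (s_inf X0y).
have [[F [_ [z [[xz _] infC]]]] _] := oneT X0x; exfalso; apply: infC.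
apply: (@sub_finite_set _ _ (branch x y `|` branch y x)); last first.
  by rewrite finite_setU; split; exact: contrapT.
move=> w zw; have xw : connR Tr x w by apply: path_in_trans xz _; exact: path_in_connR zw.
have nxy := edge_neq xy.
move: w xw {zw}; apply: path_in_ind => [_|u v xu ih uv _].
  by right; exact: path_in_refl.
case: ih => h.
  have [->|vx] := pselect (v = x); first by right; exact: path_in_refl.
  by left; exact: path_in_rcons h uv _.
have [->|vy] := pselect (v = y); first by left; apply: path_in_refl; exact: nesym.
by right; exact: path_in_rcons h uv _.
Qed.

Definition behind x := branch (s x) x.

Lemma behind_finite x : X0 x -> finite_set (behind x).
Proof.
move=> X0x; apply: contrapT => inf; apply: (no_two_cycle X0x).
have X0sx := X0s X0x.
exact: infinite_branch_uniq (sE X0sx) (sT (sE X0x)) (s_inf X0sx) inf.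
Qed.

Lemma behind_step x : X0 x -> behind x `<=` behind (s x) /\ behind (s x) (s x).
Proof.
move=> X0x; have X0sx := X0s X0x; have ne := edge_neq (sE X0sx).
split; last exact: path_in_refl.
move=> z xz; have n2 w : behind x w -> w <> s (s x).
  move=> xw e; rewrite {}e in xw; apply: (no_two_cycle X0x).
  by apply/esym; apply: branch_uniq xw; [apply/sT/sE|exact: sE].
apply: (@path_in_cons _ _ _ _ x) => //; first exact/sT/sE.
by apply: path_in_mono (path_in_restrict xz) => // w /n2.
Qed.

Let X0iter n x : X0 x -> X0 (iter n s x).
Proof. by move=> X0x; elim: n => // n ih; exact: X0s. Qed.

(** The sets [behind] increase along the orbit. If it returned to [x], the set behind [x] would
    contain [s x], which it avoids by definition. *)
Lemma tree_aperiodic x n : X0 x -> iter n.+1 s x <> x.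
Proof.
move=> X0x h; have mono m : behind (s x) (s x) /\ behind (s x) `<=` behind (iter m.+1 s x).
  split; first exact: (behind_step X0x).2.
  elim: m => // m ih; apply: subset_trans ih _; exact: (behind_step (X0iter m.+1 X0x)).1.
have [h1 h2] := mono n; rewrite h in h2; exact: (path_in_target (h2 _ h1)).
Qed.

Lemma tree_back_finite y : X0 y -> finite_set [set x | X0 x /\ exists n, iter n s x = y].
Proof.
move=> X0y; apply: sub_finite_set (behind_finite X0y) => x [X0x [n hn]].
apply: path_in_sym => //; rewrite -hn.
apply: (path_in_mono (function_graph_sub sT sE) (@subset_refl _ _)); apply: (path_iter X0inv sE) => // m mn /= e.
by apply: (tree_aperiodic (n := n - m) X0y); rewrite iterSr -hn -e -iterD subnK.
Qed.

End AcyclicOneEnded.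

(** * Hyperfiniteness from a one-ended spanning tree *)

Section TreeHyperfinite.
Context {d : measure_display} {X : measurableType d} {R : realType}.
Variables (P : probability X R) (G Tr : set (X * X)) (f : X -> R) (g : nat -> X -> X).
Hypothesis finj : injective f.
Hypothesis mf : measurable_fun setT f.
Hypothesis mG : measurable G.
Hypothesis sG : symmetric_graph G.
Hypothesis lG : locally_finite G.
Hypothesis mg : forall n, measurable_fun setT (g n).
Hypothesis gG : forall n x, g n x = x \/ G (x, g n x).
Hypothesis Gg : forall x y, G (x, y) -> exists n, y = g n x.
Variable X0 : set X.
Hypothesis mX0 : measurable X0.
Hypothesis X0null : P.-negligible (~` X0).
Hypothesis X0inv : forall x y, X0 x -> connR G x y -> X0 y.
Hypothesis mT : measurable Tr.
Hypothesis sT : symmetric_graph Tr.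
Hypothesis TG : Tr `<=` G.
Hypothesis aT : acyclic Tr.
Hypothesis oneT : forall x, X0 x -> one_ended_at Tr x.
Hypothesis compT : forall x, X0 x -> Defs.comp Tr x = Defs.comp G x.

Let eqX (d' : measure_display) (Y : measurableType d') (u v : Y -> X) :
  measurable_fun setT u -> measurable_fun setT v -> mpred (fun x => u x = v x).
Proof. exact: (mpred_eq_fun finj mf). Qed.

Notation act := (act g).

Let lT : locally_finite Tr.
Proof. by move=> x; apply: sub_finite_set (lG x) => y; exact: TG. Qed.

Let TGconn x y : connR Tr x y -> connR G x y.
Proof. exact: path_in_mono. Qed.

Let X0invT x y : X0 x -> connR Tr x y -> X0 y.
Proof. by move=> X0x /TGconn; exact: X0inv. Qed.

Lemma parent_function : exists s : X -> X, [/\ measurable_fun setT s,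
  forall x, X0 x -> Tr (x, s x) & forall x, X0 x -> infinite_set (branch Tr x (s x))].
Proof.
pose Q n x := Tr (x, g n x) /\ infinite_set (branch Tr x (g n x)).
have [|c [cQ mc]] := @measurable_choice _ X nat 0%N Q.
  move=> n; apply: mpredI; first exact: (mpred_act_rel mg [::] [:: n] mT).
  apply: mpredN; apply: (@eq_mpred _ _ (fun x => exists l : seq X, (forall y, y \in l -> connR G x y) /\
     (forall y, connR G x y -> branch Tr x (g n x) y -> y \in l))).
    have xb x y : branch Tr x (g n x) y -> connR G x y.
      move=> h; apply: path_in_trans (connR_act gG [:: n] x) _.
      by apply: TGconn; exact: path_in_connR h.
    move=> x; split=> [[l [_ hl]]|/finite_seqP[l hl]].
      apply: sub_finite_set (finite_seq l) => y hy; apply: hl => //; exact: xb hy.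
    exists l; split=> y; last by move=> _; rewrite hl.
    by move=> yl; apply: xb; rewrite hl.
  apply: (mpred_seq_ex gG Gg (Q := fun x l => forall y, connR G x y -> branch Tr x (g n x) y -> y \in l)) => ws.
  apply: (mpred_comp_all gG Gg) => w; apply: mpred_imp; last exact: mpred_pts.
  apply: (@mpred_path _ _ G g mg Gg _ _ Tr (fun x => ~` [set x]) (act [:: n]) (act w)) => //.
  - by move=> u v; exact: eqX.
  - exact: measurable_act.
  - exact: measurable_act.
  - move=> v; apply: mpredN.
    apply: (@eqX _ _ (fun x => act v (act [:: n] x)) (act [::])); last exact: measurable_act.
    by apply: measurable_act_fun => //; exact: measurable_act.
exists (fun x => g (c x) x); split; first by apply: (measurable_fun_glue (h := g)).
  move=> x X0x; have [y [xy inf]] := infinite_branch sT lT oneT X0x.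
  by have [|h _] := cQ x; first by have [n yn] := Gg (TG xy); exists n; rewrite /Q -yn.
move=> x X0x; have [y [xy inf]] := infinite_branch sT lT oneT X0x.
by have [|_ h] := cQ x; first by have [n yn] := Gg (TG xy); exists n; rewrite /Q -yn.
Qed.

Definition small_behind (s : X -> X) n := [set z | forall l : seq X, (forall y, y \in l -> connR G z y) ->
  uniq l -> (forall y, y \in l -> exists i, iter i s y = z) -> (size l <= n)%N].

Definition same_block s n (p : X * X) := exists i j, iter i s p.1 = iter j s p.2 /\ small_behind s n (iter i s p.1).

(** Edges off [X0] are kept at every stage, because the union has to be exactly [G] and not only
    almost everywhere. *)
Definition block_graph s n := [set p | G p /\ (~ X0 p.1 \/ same_block s n p)].

Lemma measurable_iter (s : X -> X) n : measurable_fun setT s -> measurable_fun setT (iter n s).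
Proof.
move=> ms; elim: n => [|n ih]; first exact: measurable_id.
exact: (measurableT_comp ms ih).
Qed.

Lemma measurable_block_graph s n : measurable_fun setT s -> measurable (block_graph s n).
Proof.
move=> ms.
have mS : measurable (small_behind s n).
  rewrite /small_behind; apply: (mpred_seq_all gG Gg (Q := fun z l => uniq l ->
    (forall y, y \in l -> exists i, iter i s y = z) -> (size l <= n)%N)) => ws.
  apply: mpred_imp; first exact: mpred_uniq_pts.
  apply: mpred_imp; last by rewrite /pts; under eq_fun do rewrite size_map; exact: mpred_cst.
  apply: (mpred_all_pts (Q := fun z y => exists i, iter i s y = z)) => w.
  apply: mpred_ex => i; apply: (@eqX _ _ (fun x => iter i s (act w x)) (act [::])).
    by apply: measurableT_comp; [exact: measurable_iter|exact: measurable_act].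
  exact: measurable_act.
have m1 i : measurable_fun setT (fun p : X * X => iter i s p.1).
  by apply: measurableT_comp => //; exact: measurable_iter.
have m2 i : measurable_fun setT (fun p : X * X => iter i s p.2).
  by apply: measurableT_comp => //; exact: measurable_iter.
apply: (@mpredI _ (X * X)%type G (fun p => ~ X0 p.1 \/ same_block s n p)) => //.
apply: mpredU; first by apply: mpredN; exact: (@mpred_comp _ _ _ _ X0 fst).
apply: mpred_ex => i; apply: mpred_ex => j; apply: mpredI; first exact: eqX.
exact: (@mpred_comp _ _ _ _ (small_behind s n) (fun p => iter i s p.1)).
Qed.

(** Both witnesses lie on the orbit of the middle point [y]; the later one serves for the outer
    pair. *)
Lemma same_block_trans s n x y z : same_block s n (x, y) -> same_block s n (y, z) -> same_block s n (x, z).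
Proof.
move=> [i [j /= [ij hi]]] [k [l /= [kl hk]]]; case: (leqP j k) => jk.
  have e : iter (k - j + i) s x = iter k s y by rewrite iterD ij -iterD subnK.
  by exists (k - j + i)%N, l; rewrite /= e.
exists i, (j - k + l)%N; split=> //=.
by rewrite iterD -kl -iterD subnK // ltnW.
Qed.

Lemma tree_hyperfinite : hyperfinite P G.
Proof.
have [s [ms sE s_inf]] := parent_function.
have aper := tree_aperiodic sT lT aT X0invT oneT sE s_inf.
have back := tree_back_finite sT lT aT X0invT oneT sE s_inf.
have merge x y : X0 x -> Tr (x, y) -> exists i j, iter i s x = iter j s y.
  move=> X0x xy; have [->|->] := tree_edge_step sT aT X0invT oneT sE s_inf X0x xy.
    by exists 1%N, 0%N.
  by exists 0%N, 1%N.
have X0iter i x : X0 x -> X0 (iter i s x).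
  by move=> X0x; elim: i => // i ih; exact: X0invT ih (connR_edge (sE _ ih)).
exists (block_graph s); split.
- move=> n; split; first exact: measurable_block_graph.
  move=> x y [/= xy h]; split; first exact: sG.
  case: h => [nx|[i [j /= [ij h]]]]; last by right; exists j, i; rewrite -ij.
  by left; apply: contra_not nx => X0y; apply: X0inv X0y _; exact/connR_edge/sG.
- move=> n p [Gp [h|[i [j [ij h]]]]]; split=> //; [by left|right].
  by exists i, j; split=> // l l1 l2 l3; apply: leqW; exact: h.
- apply/seteqP; split=> [p [n _ []]//|[x y] xy].
  have [X0x|nx] := pselect (X0 x); last by exists 0%N => //; split=> //; left.
  have xyT : Defs.comp Tr x y by rewrite compT //; exact: connR_edge.
  have [i [j ij]] := merge_connected X0invT merge X0x xyT.
  have /finite_seqP[l hl] := back _ (X0iter i x X0x).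
  exists (size l) => //; split=> //; right; exists i, j; split=> // l' l1 l2 l3.
  apply: uniq_leq_size => // y' yl; have : [set` l] y'; last by [].
  rewrite -hl; split; last exact: l3.
  exact: X0inv (X0iter i x X0x) (l1 _ yl).
- move=> n; apply: negligibleS X0null => x /= inf X0x; apply: inf.
  apply: (@sub_finite_set _ _ ([set x] `|` \bigcup_(i in `I_n)
     [set y | X0 y /\ exists j, iter j s y = iter i s x])); last first.
    rewrite finite_setU; split; first exact: finite_set1.
    by apply: bigcup_finite => [|i _]; [exact: finite_II|exact/back/X0iter].
  have bG : block_graph s n `<=` G by move=> p [].
  move=> y xy; have X0y : X0 y by apply: X0inv X0x _; exact: path_in_mono xy.
  suff : y = x \/ same_block s n (x, y).
    case=> [->|[i [j /= [ij hi]]]]; [by left|right; exists i; last by split=> //; exists j].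
    (* The [i.+1] distinct points from [x] to [iter i s x] all lie behind [iter i s x], so [i < n]
       and the whole block of [x] is behind one of the first [n] points of its orbit. *)
    have := hi [seq iter m s x | m <- iota 0 i.+1]; rewrite size_map size_iota; apply.
    - move=> _ /seq.mapP[m _ ->]; have xm k : connR G x (iter k s x).
        elim: k => [|k ih]; first exact: connR_refl.
        by apply: (path_in_rcons ih) => //; apply/TG/sE/X0iter.
      exact: path_in_trans (path_in_sym sG (xm _)) (xm _).
    - rewrite map_inj_uniq ?iota_uniq //; exact: (iter_injective X0invT sE aper X0x).
    - move=> _ /seq.mapP[m mi ->]; rewrite mem_iota /= add0n ltnS in mi.
      by exists (i - m)%N; rewrite -iterD subnK.
  move: y xy {X0y}; apply: path_in_ind => [_|y z xy ih [yz hyz] _]; first by left.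
  have X0y : X0 y by apply: X0inv X0x _; exact: path_in_mono xy.
  right; case: hyz => // yz'; case: ih => [<-//|h]; exact: same_block_trans h yz'.
Qed.

End TreeHyperfinite.

Theorem theorem1p2 (d : measure_display) (X : measurableType d) (R : realType)
  (P : probability X R) (G : set (X * X)) :
  @standard_borel d X R ->
  measurable G -> symmetric_graph G -> locally_finite G ->
  one_ended P G -> mcp P G ->
  (hyperfinite P G <-> has_one_ended_spanning_tree P G).
Proof.
move=> [f [finj mf fimg]] mG sG lG oneG mcpG.
have [g [mg gG Gg]] := neighbor_functions finj mf fimg mG lG.
have inv Q := @invariant_conull _ _ _ P G f g finj mf sG mg gG Gg mcpG Q.
split=> [[Gn [Gnm Gnmono GnG finGn]]|[Tr [mT sT TG aT /inv[X0 [mX0 X0null X0inv X0T]]]]]; last first.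
  apply: (tree_hyperfinite finj mf mG sG lG mg gG Gg mX0 X0null X0inv mT sT TG aT) => x /X0T[] //.
have aeQ : {ae P, forall x, one_ended_at G x /\ forall n, finite_set (Defs.comp (Gn n) x)}.
  by have /ae_foralln h := finGn; apply: negligibleS (negligibleU oneG h) => x /= /not_andP[]; [left|right].
have [X0 [mX0 X0null X0inv X0Q]] := inv _ aeQ.
have mGn n : measurable (Gn n) by have [] := Gnm n.
have sGn n : symmetric_graph (Gn n) by have [] := Gnm n.
have [X1 [V [X1null X1inv _ tV]]] := exists_thin_sequence finj mf mG sG lG mg gG Gg mcpG mGn sGn
  Gnmono GnG mX0 X0inv X0null (fun x X0x => (X0Q x X0x).1) (fun n x X0x => (X0Q x X0x).2 n).
have [X2 [U [mX2 X2null X2inv tU merging]]] :=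
  merging_subsequence finj mf mG sG lG mg gG Gg mcpG X1null X1inv tV.
have [Tr [mT sT TG aT hT]] := thin_sequence_tree finj mf mG sG mg Gg mX2 X2inv tU merging.
exists Tr; split=> //; apply: negligibleS X2null => x /= h X2x; apply: h; exact: hT.
Qed.
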